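(* Let $(M,\omega)$ be a symplectic surface, and let $F_t$ and $H_t=F_t\circ\phi_\rho^{-1}$, $0\le t\le1$, be the smooth time-dependent Hamiltonian functions on $M$ described in the context, with Hamiltonian isotopies $\{\phi_F^t\}$ and $\{\phi_H^t\}$. These Hamiltonian isotopies of $M$ are not $C^1$-conjugate, i.e. there exists no $C^1$-diffeomorphism $\psi$ of $M$ such that $\psi\circ\phi_F^t=\phi_H^t\circ\psi$ (for all $t$).
   Context: The Hamiltonian isotopy $\{\phi_G^t\}$ of a time-dependent Hamiltonian $G_t$ is given by $\phi_G^0=\mathrm{id}$, $\frac{d}{dt}\phi_G^t=X_{G_t}\circ\phi_G^t$, where $\iota_{X_{G_t}}\omega=dG_t$. Fix a Darboux chart of $M$ around a point corresponding to the origin of the plane, with rectangular coordinates $(x,y)$ and polar coordinates $(r,\theta)$. Let $f_t(r,\theta)$ be a smooth function that near the origin is given by the composition of the function $(r,\theta)\mapsto 1/r^2$ with the time-dependent area preserving change of coordinates $(x,y)\mapsto(\sigma(t)x,\frac{y}{\sigma(t)})$, where $\sigma$ is a function of $t\in[0,1]$ with $\sigma(t)=2$ near $t=0$ and $\sigma(t)=\frac12$ near $t=1$. Define a smooth function by $F_t(r,\theta)=e^{-f_t(r,\theta)}$ (with value $0$ at the origin). By cutting off outside a neighborhood of the origin, it is regarded as a smooth Hamiltonian function on $M$ compactly supported in the domain of the Darboux chart. Let $D^2\subset\mathbb R^2$ be a disk contained in the domain of the Darboux chart and centered at the origin, with radial coordinate $0\le r\le1$. Let $\rho\colon(0,1]\to\mathbb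 R$ be a smooth function with $\rho(r)=0$ near $r=1$, and let $\phi_\rho$ be the area preserving homeomorphism of $M$ given on $D^2$ by $(r,\theta)\mapsto(r,\theta+\rho(r))$ for $r>0$ and $\phi_\rho(0)=0$ at the origin, and equal to the identity outside $D^2$. The function $\rho$ is chosen appropriately: near $r=0$ one imposes $\rho>0$ and $\rho'(r)\to-\infty$ sufficiently fast as $r\to0^+$ (for instance, $\rho(r)$ growing like $r^{-a}$ for some $a>0$), so that $\phi_\rho$ is smooth everywhere except at the origin and is not Lipschitz, while the functions $H_t=F_t\circ\phi_\rho^{-1}$ are smooth Hamiltonian functions on $M$. The two isotopies are topologically conjugate: $\phi_\rho\circ\phi_F^t=\phi_H^t\circ\phi_\rho$. *)

(* Defs.v *)
From mathcomp Require Export all_boot all_order all_algebra.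
From mathcomp Require Export all_classical all_reals all_analysis.

Set Implicit Arguments.
Unset Strict Implicit.
Unset Printing Implicit Defensive.

Export Order.TTheory GRing.Theory Num.Theory.
Export numFieldNormedType.Exports.

#[global] Open Scope classical_set_scope.
#[global] Open Scope ring_scope.

Section Smoothness.
Context {R : realType} {V W : normedModType R}.

(* C^k on an open set U, for finite-dimensional V: f is C^(k+1) when it is
   differentiable and all its directional derivatives are C^k. *)
Fixpoint Ck_on (k : nat) (U : set V) (f : V -> W) : Prop :=
  match k with
  | 0 => forall x, U x -> {for x, continuous f}
  | k'.+1 => (forall x, U x -> differentiable f x) /\
             (forall v : V, Ck_on k' U (fun x => 'D_v f x))
  end.

(* C^oo on an arbitrary set A: f agrees, near each point of A, with a C^oo
   function defined on an open set.  On open A this is the usual notion; it is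
   needed on the half-open sets `]0, 1] and `[0, 1] `*` U. *)
Definition smooth_on (A : set V) (f : V -> W) : Prop :=
  forall a, A a -> exists (U : set V) (g : V -> W),
    [/\ open U, U a, (forall k, Ck_on k U g)
      & forall x, A x -> U x -> f x = g x].

End Smoothness.

Notation plane R := 'rV[R]_2.

Section Plane.
Context {R : realType}.
Implicit Types u v : plane R.

Definition vec2 (x y : R) : plane R := \row_j (if j == 0 then x else y).

(* The norm of the library on row vectors is the sup norm. *)
Definition enorm u : R := Num.sqrt (u 0 0 ^+ 2 + u 0 1 ^+ 2).

Definition det2 u v : R := u 0 0 * v 0 1 - u 0 1 * v 0 0.

Definition rotation (theta : R) u : plane R :=
  vec2 (cos theta * u 0 0 - sin theta * u 0 1)
       (sin theta * u 0 0 + cos theta * u 0 1).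

Definition stretch (s : R) u : plane R := vec2 (s * u 0 0) (u 0 1 / s).

Definition edisk (a : R) : set (plane R) := [set u | enorm u <= a].

End Plane.

Section Surfaces.
Context {R : realType}.

(* chart_map and chart_inv are total; only their restrictions to chart_dom and
   to its image are meaningful. *)
Record chart (M : topologicalType) := Chart {
  chart_dom : set M;
  chart_map :> M -> plane R;
  chart_inv : plane R -> M;
  chart_dom_open : open chart_dom;
  chart_img_open : open (chart_map @` chart_dom);
  chart_mapK : forall p, chart_dom p -> chart_inv (chart_map p) = p;
  chart_map_continuous : {within chart_dom, continuous chart_map};
  chart_inv_continuous :
    {within chart_map @` chart_dom, continuous chart_inv}
}.

Definition chart_img (M : topologicalType) (c : chart M) : set (plane R) :=
  c @` chart_dom c.

Definition transition (M : topologicalType) (c d : chart M) :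
  plane R -> plane R := d \o chart_inv c.

Definition overlap (M : topologicalType) (c d : chart M) : set (plane R) :=
  c @` (chart_dom c `&` chart_dom d).

(* A smooth surface (Hausdorff, second countable, with a maximal smooth atlas)
   with a nowhere vanishing 2-form omega, given by its densities
   omega = area_density c * dx /\ dy in the charts c of the atlas; being a
   2-form on a surface, omega is closed. *)
Record symplectic_surface := SymplecticSurface {
  surface_space :> topologicalType;
  surface_hausdorff : hausdorff_space surface_space;
  surface_second_countable : @second_countable surface_space;
  atlas : set (chart surface_space);
  atlas_cover : forall p, exists2 c, atlas c & chart_dom c p;
  atlas_compatible : forall c d, atlas c -> atlas d ->
    smooth_on (overlap c d) (transition c d);
  atlas_maximal : forall c,
    (forall d, atlas d -> smooth_on (overlap c d) (transition c d) /\
                          smooth_on (overlap d c) (transition d c)) ->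
    atlas c;
  area_density : chart surface_space -> plane R -> R;
  area_density_smooth : forall c, atlas c ->
    smooth_on (chart_img c) (area_density c : plane R -> R^o);
  area_density_neq0 : forall c u, atlas c -> chart_img c u ->
    area_density c u != 0;
  area_density_transition : forall c d u, atlas c -> atlas d ->
    overlap c d u ->
    area_density c u =
    area_density d (transition c d u) * \det (jacobian (transition c d) u)
}.

Definition area_form (M : symplectic_surface) (c : chart M) (u : plane R)
  (v w : plane R) : R := area_density c u * det2 v w.

Definition darboux_chart (M : symplectic_surface) (D : chart M) : Prop :=
  atlas D /\ forall u, chart_img D u -> area_density D u = 1.

Definition C1_map (M : symplectic_surface) (f : M -> M) : Prop :=
  continuous f /\
  forall c d, atlas c -> atlas d ->
    Ck_on 1 (c @` (chart_dom c `&` f @^-1` chart_dom d))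
          (d \o f \o chart_inv c).

Definition C1_diffeomorphism (M : symplectic_surface) (f : M -> M) : Prop :=
  exists g : M -> M, [/\ cancel f g, cancel g f, C1_map f & C1_map g].

(* Time-dependent functions and paths are only constrained for t in [0, 1]. *)
Definition smooth_hamiltonian (M : symplectic_surface) (G : R -> M -> R) :
  Prop :=
  forall c, atlas c ->
    smooth_on (`[0, 1] `*` chart_img c : set (R^o * plane R)%type)
      ((fun z => G z.1 (chart_inv c z.2)) : (R^o * plane R)%type -> R^o).

(* X represents in the chart c, at the point of coordinates u, the vector
   X_g defined by iota_(X_g) omega = dg. *)
Definition hamiltonian_vector (M : symplectic_surface) (g : M -> R)
  (c : chart M) (u X : plane R) : Prop :=
  forall v : plane R,
    area_form c u X v = 'D_v ((g \o chart_inv c) : plane R -> R^o) u.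

(* One-sided at the endpoints of [0, 1]. *)
Definition velocity (M : topologicalType) (c : chart M) (gamma : R -> M)
  (t : R) (X : plane R) : Prop :=
  (s - t)^-1 *: (c (gamma s) - c (gamma t))
    @[s --> within (`[0, 1] `\ t) (nbhs t)] --> X.

Definition hamiltonian_isotopy (M : symplectic_surface) (G : R -> M -> R)
  (phi : R -> M -> M) : Prop :=
  [/\ (forall p, phi 0 p = p),
      (forall p, {within `[0, 1], continuous (fun t => phi t p)})
    & forall p (t : R) (c : chart M), t \in `[0, 1] -> atlas c -> chart_dom c (phi t p) ->
        exists2 X, hamiltonian_vector (G t) c (c (phi t p)) X
                 & velocity c (fun s => phi s p) t X].

(* e^(-f) extended by 0 at the origin, where f is the composition of 1 / r^2
   with (x, y) |-> (s x, y / s). *)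
Definition model_hamiltonian (s : R) (u : plane R) : R :=
  if u == 0 then 0 else expR (- (enorm (stretch s u) ^+ 2)^-1).

(* (r, theta) |-> (r, theta + rho r), r = enorm u / a being the radial
   coordinate of the disk of radius a normalized to [0, 1]. *)
Definition twist (a : R) (rho : R -> R) (u : plane R) : plane R :=
  if u == 0 then 0 else rotation (rho (enorm u / a)) u.

Definition surface_twist (M : topologicalType) (D : chart M) (a : R)
  (rho : R -> R) (p : M) : M :=
  if `[< chart_dom D p /\ edisk a (D p) >]
  then chart_inv D (twist a rho (D p)) else p.

End Surfaces.

Arguments symplectic_surface : clear implicits.
Arguments chart : clear implicits.

(* Main.v *)
From mathcomp Require Import ring lra.
Require Import Defs.

(** Let [T] be [psi] followed by the inverse twist, and follow the orbit [y k = T^k 0] of the center.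
    Away from points sent to the center, [T] is a C^1 diffeomorphism preserving the Hamiltonian field
    of [F 0].  The points [y k] are stationary for all times: the flow of [F] fixes [y k], so the flow of
    [H] fixes [psi (y k)], where the field of [H] therefore vanishes.

    If the orbit never returns to [0], it accumulates in a compact set.  The field of [F 0] is flat at
    [0], hence has zero derivative at each [y k], since [T^k] transports it, and at an accumulation
    point, near which it has an arbitrarily small Lipschitz constant.  Let [y k] and [y j] be close to
    that point, with [k < j].  Since [y j] lies outside the image under [T^k] of the ellipse
    [quad 2 < c], the segment from [y k] to [y j] meets the image of its boundary.  This image is a
    periodic orbit of bounded period that stays close to [y k], which a small Lipschitz constant forbids.

    If [0] is reached first by [A = psi o T^(k-1)], then [A] is a local diffeomorphism fixing [0] and
    transporting the field of [F t] to that of [H t] for [t = 0] and [t = 1].  With [W] the inverse twist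
    applied to [A], comparing [F t] with [F t o W] along the ray spanned by [(1, 1)] shows that [W]
    asymptotically preserves both quadratic forms [quad 2] and [quad 2^-1] and controls their
    differentials.  These differentials are independent there, so the derivative of [W], and then that of
    the twist, is bounded along the ray; by rotational symmetry the twist is Lipschitz, a contradiction. *)

Set Implicit Arguments.
Unset Strict Implicit.
Unset Printing Implicit Defensive.

(** * Differential calculus in the plane *)

Section PlaneBasics.
Context {R : realType}.
Implicit Types u v w : plane R.

(** Nothing forces [psi] to fix the center: away from it [F] is only known to be smooth with compact
    support in the chart, and [psi] may carry the center to another flat zero. Hence an orbit has to
    be followed at all. It cannot be bounded by counting areas, since a C^1 conjugacy transports the
    Hamiltonian fields but need not preserve the area form; the periods of the closed orbits around
    the center do survive, and they are what the accumulation argument exploits.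

    The support of [H] keeps everything inside the chart: where the field of [F 0] is nonzero, so is
    the field of [H 0] at the image under [psi].

    The conjugacy at time [t] compares the fields only at points reached by the flow of [F] at that
    time. For [t = 0] these are all points; for [t = 1] the flow must be shown to cover a
    neighborhood of a stationary point. As an isotopy is given only through its individual paths,
    this covering, like the uniqueness of solutions, is derived from Lipschitz bounds on the
    field. *)

Lemma vec2E0 (x y : R) : vec2 x y 0 0 = x.
Proof. by rewrite mxE. Qed.

Lemma vec2E1 (x y : R) : vec2 x y 0 1 = y.
Proof. by rewrite mxE. Qed.

Lemma plane_eq u v : u 0 0 = v 0 0 -> u 0 1 = v 0 1 -> u = v.
Proof.
move=> h0 h1; apply/rowP => j.
by case: (unliftP 0 j) => [k ->|->//]; rewrite !(ord1 k); 
  have -> : lift 0 0 = 1 :> 'I_2 by apply/val_inj.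
Qed.

Lemma coord_le u j : `|u 0 j| <= `|u|.
Proof.
rewrite [leRHS]/Num.Def.normr/= mx_normrE.
exact: (le_bigmax _ (fun i : 'I_1 * 'I_2 => `|u i.1 i.2|) (0, j)).
Qed.

Lemma plane_norm_le u (e : R) : 0 <= e -> `|u 0 0| <= e -> `|u 0 1| <= e -> `|u| <= e.
Proof.
move=> e0 h0 h1; rewrite [leLHS]/Num.Def.normr/= mx_normrE.
apply: bigmax_le => // -[i j] _ /=; rewrite (ord1 i).
case: (unliftP 0 j) => [k ->|->//]; rewrite (ord1 k).
by have -> : lift 0 0 = 1 :> 'I_2 by apply/val_inj.
Qed.

Lemma vec2_basis u : u = u 0 0 *: vec2 1 0 + u 0 1 *: vec2 0 1.
Proof. by apply: plane_eq; rewrite !mxE /= ?mulr1 ?mulr0 ?addr0 ?add0r. Qed.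

End PlaneBasics.

Section C1.
Context {R : realType}.

Lemma near_eq_differentiable (V W : normedModType R) (f g : V -> W) (x : V) :
  (\near x, f x = g x) -> differentiable f x ->
  differentiable g x /\ 'd g x = 'd f x :> (V -> W).
Proof.
move=> fg df.
have fgx : f x = g x by exact: nbhs_singleton fg.
have E : g \o shift x = cst (g x) + 'd f x +o_ 0 id.
  apply/eqaddoP => e e0.
  have /eqaddoP/(_ e e0) H := diff_locally df.
  have fg0 : \forall h \near (0 : V), f (h + x) = g (h + x).
    have := fg; rewrite (near_shift 0 x) /=; apply: filterS => h /=.
    by rewrite subr0.
  by apply: filterS2 H fg0 => h /= + fgh; rewrite !fctE /= fgh fgx.
have dg : 'd g x = 'd f x :> (V -> W).
  by apply: diff_unique => //; exact: diff_continuous.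
split=> //; apply/diff_locallyP; rewrite dg; split=> //.
exact: diff_continuous.
Qed.

Lemma derive_comp (U V W : normedModType R) (f : U -> V) (g : V -> W) (x v : U) :
  differentiable f x -> differentiable g (f x) ->
  'D_v (g \o f) x = 'd g (f x) ('D_v f x).
Proof.
move=> df dg; rewrite deriveE; last exact: differentiable_comp.
by rewrite diff_comp//= deriveE.
Qed.

(** Differentiability is asked near [x], continuity of the derivatives at [x] alone. This pointwise
    form is stable under composition and still bounds the derivatives near [x]. *)
Definition C1_at (V W : normedModType R) (f : V -> W) (x : V) : Prop :=
  (\forall y \near x, differentiable f y) /\
  forall v, {for x, continuous (fun y => 'D_v f y)}.

Lemma C1_at_diff (V W : normedModType R) (f : V -> W) x : C1_at f x -> differentiable f x.
Proof. by move=> [/nbhs_singleton]. Qed.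

Lemma C1_at_continuous (V W : normedModType R) (f : V -> W) x :
  C1_at f x -> {for x, continuous f}.
Proof. by move=> /C1_at_diff; exact: differentiable_continuous. Qed.

Lemma Ck_on1_C1_at (V W : normedModType R) (U : set V) (f : V -> W) x :
  open U -> U x -> Ck_on 1 U f -> C1_at f x.
Proof.
move=> oU Ux [df cf]; split; last by move=> v; exact: cf.
by apply: filterS (open_nbhs_nbhs (conj oU Ux)) => y /df.
Qed.

Lemma C1_at_ext (V W : normedModType R) (f g : V -> W) x :
  (\near x, f x = g x) -> C1_at f x -> C1_at g x.
Proof.
move=> /near_join fg [df cf]; split.
  by apply: filterS2 fg df => y fgy dfy; have [] := near_eq_differentiable fgy dfy.
move=> v; have fgv : \forall y \near x, 'D_v f y = 'D_v g y.
  by apply: filterS fg => y; exact: near_eq_derive.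
rewrite /prop_for /continuous_at -(nbhs_singleton fgv).
by apply: cvg_trans (cf v); apply: near_eq_cvg.
Qed.

Lemma diff_plane (W : normedModType R) (g : plane R -> W) (x v : plane R) :
  differentiable g x ->
  'd g x v = v 0 0 *: 'D_(vec2 1 0) g x + v 0 1 *: 'D_(vec2 0 1) g x.
Proof. by move=> dg; rewrite !deriveE// {1}(vec2_basis v) linearD !linearZ. Qed.

Lemma derive_plane (W : normedModType R) (g : plane R -> W) (x v : plane R) :
  differentiable g x ->
  'D_v g x = v 0 0 *: 'D_(vec2 1 0) g x + v 0 1 *: 'D_(vec2 0 1) g x.
Proof. by move=> dg; rewrite -diff_plane// deriveE. Qed.

Lemma coord_cvg (T : Type) (F : set_system T) {FF : Filter F}
  (f : T -> plane R) (l : plane R) j :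
  f t @[t --> F] --> l -> f t 0 j @[t --> F] --> l 0 j.
Proof.
exact: (@continuous_cvg _ _ _ F _ f (fun M : plane R => M 0 j) l (@coord_continuous _ _ _ 0 j l)).
Qed.

Lemma vec2_cvg (T : Type) (F : set_system T) {FF : Filter F}
  (f g : T -> R) (a b : R) :
  f t @[t --> F] --> a -> g t @[t --> F] --> b ->
  vec2 (f t) (g t) @[t --> F] --> vec2 a b.
Proof.
move=> /cvgrPdist_le fa /cvgrPdist_le gb; apply/cvgrPdist_le => e e0.
apply: filterS2 (fa e e0) (gb e e0) => t h0 h1.
by apply: plane_norm_le; rewrite ?(ltW e0)// !mxE.
Qed.

(** Expanding ['d g (f y)] on the standard basis turns the chain rule into a sum of two products of
    continuous functions, so that continuity is needed only for directional derivatives in fixed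
    directions. *)
Lemma C1_at_comp (W : normedModType R) (f : plane R -> plane R) (g : plane R -> W) x :
  C1_at f x -> C1_at g (f x) -> C1_at (g \o f) x.
Proof.
move=> Cf Cg; have fx := C1_at_continuous Cf.
have dgf : \forall y \near x, differentiable g (f y) := fx _ Cg.1.
split; first by apply: filterS2 Cf.1 dgf => y; exact: differentiable_comp.
move=> v.
pose h y := ('D_v f y) 0 0 *: 'D_(vec2 1 0) g (f y) + ('D_v f y) 0 1 *: 'D_(vec2 0 1) g (f y).
have E : \forall y \near x, h y = 'D_v (g \o f) y.
  by apply: filterS2 Cf.1 dgf => y d1 d2; rewrite derive_comp// diff_plane.
rewrite /prop_for /continuous_at -(nbhs_singleton E).
apply: (@cvg_trans _ (h @ x)); first exact: near_eq_cvg E.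
have c0 := cvgZ (coord_cvg (j := 0) (Cf.2 v)) (continuous_cvg _ (Cg.2 (vec2 1 0)) fx).
have c1 := cvgZ (coord_cvg (j := 1) (Cf.2 v)) (continuous_cvg _ (Cg.2 (vec2 0 1)) fx).
exact: cvgD (c0 _ _ _) (c1 _ _ _).
Qed.

Lemma vec2_differentiable (V : normedModType R) (f g : V -> R^o) (x : V) :
  differentiable f x -> differentiable g x ->
  differentiable (fun y => vec2 (f y) (g y)) x /\
  'd (fun y => vec2 (f y) (g y)) x = (fun v => vec2 ('d f x v) ('d g x v)) :> (V -> plane R).
Proof.
move=> df dg.
have E : (fun y => vec2 (f y) (g y)) =
    (fun y => f y *: vec2 1 0) \+ (fun y => g y *: vec2 0 1) :> (V -> plane R).
  by apply/funext => y; rewrite /= [LHS]vec2_basis !mxE.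
have d1 := @differentiableZl _ _ _ f (vec2 1 0 : plane R) x df.
have d2 := @differentiableZl _ _ _ g (vec2 0 1 : plane R) x dg.
split; first by rewrite E; exact: differentiableD.
have e1 := diffZl (vec2 1 0 : plane R) df.
have e2 := diffZl (vec2 0 1 : plane R) dg.
rewrite E; apply: (etrans (diffD d1 d2)); apply/funext => v.
apply: (etrans (congr2 +%R (congr1 (@^~ v) e1) (congr1 (@^~ v) e2))).
by rewrite [RHS]vec2_basis vec2E0 vec2E1.
Qed.

Lemma C1_at_vec2 (V : normedModType R) (f g : V -> R^o) (x : V) :
  C1_at f x -> C1_at g x -> C1_at (fun y => vec2 (f y) (g y)) x.
Proof.
move=> [df cf] [dg cg]; split.
  by apply: filterS2 df dg => y d1 d2; have [] := vec2_differentiable d1 d2.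
move=> v.
have E : \forall y \near x, vec2 ('D_v f y) ('D_v g y) = 'D_v (fun y => vec2 (f y) (g y)) y.
  apply: filterS2 df dg => y d1 d2; have [d e] := vec2_differentiable d1 d2.
  by rewrite [RHS]deriveE// e (deriveE _ d1) (deriveE _ d2).
rewrite /prop_for /continuous_at -(nbhs_singleton E).
apply: cvg_trans (vec2_cvg (cf v) (cg v)); exact: near_eq_cvg E.
Qed.

Lemma C1_at_coord (V : normedModType R) (f : V -> plane R) (x : V) j :
  C1_at f x -> C1_at (fun y => f y 0 j : R^o) x.
Proof.
have dcoord y : differentiable f y -> 
   differentiable (fun y => f y 0 j : R^o) y /\ forall v, 'D_v (fun y => f y 0 j : R^o) y = ('D_v f y) 0 j.
  move=> d; split.
    apply: (@differentiable_comp _ _ _ _ f (fun M : plane R => M 0 j : R^o)) => //.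
    exact: differentiable_coord.
  by move=> v; rewrite derive_mx ?mxE//; exact: diff_derivable.
move=> [df cf]; split; first by apply: filterS df => y /dcoord[].
move=> v.
have E : \forall y \near x, ('D_v f y) 0 j = 'D_v (fun y => f y 0 j : R^o) y.
  by apply: filterS df => y /dcoord[_ ->].
rewrite /prop_for /continuous_at -(nbhs_singleton E).
apply: (@cvg_trans _ ((fun y => ('D_v f y) 0 j) @ x)); first exact: near_eq_cvg E.
by apply: coord_cvg; exact: cf.
Qed.

(** The local inverse is part of the data: in the applications it is supplied by the inverse of
    [psi] and by the opposite twist. Differentiability of [g] at the single point [f x] already
    makes ['d f x] invertible. *)
Definition loc_diffeo (f : plane R -> plane R) (x : plane R) : Prop :=
  C1_at f x /\ exists g : plane R -> plane R,
    [/\ differentiable g (f x), \forall y \near x, g (f y) = y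
      & \forall y \near f x, f (g y) = y].

Lemma loc_diffeo_comp f g x :
  loc_diffeo f x -> loc_diffeo g (f x) -> loc_diffeo (g \o f) x.
Proof.
move=> [Cf [f' [df' f'K fK]]] [Cg [g' [dg' g'K gK]]].
have f'x : f' (f x) = x by exact: nbhs_singleton f'K.
have g'x : g' (g (f x)) = f x by exact: nbhs_singleton g'K.
split; first exact: C1_at_comp.
exists (f' \o g'); split.
- by apply: differentiable_comp => //=; rewrite g'x.
- have := C1_at_continuous Cf g'K.
  by apply: filterS2 f'K => y e /= -> .
- have c : g' y @[y --> g (f x)] --> f x.
    by rewrite -[X in _ --> X]g'x; exact: differentiable_continuous.
  have := c _ fK.
  by apply: filterS2 gK => y e /= ->.
Qed.

Lemma loc_diffeo_id x : loc_diffeo id x.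
Proof.
have d y : differentiable (@id (plane R)) y by exact: ex_diff.
split; last by exists id; split; [exact: d|by apply: filterE|by apply: filterE].
split; first by apply: filterE.
move=> v; have -> : (fun y => 'D_v id y) = cst v by apply/funext => y; rewrite derive_id.
exact: cst_continuous.
Qed.

Lemma loc_diffeo_diff f x : loc_diffeo f x -> differentiable f x.
Proof. by move=> [/C1_at_diff]. Qed.

Lemma loc_diffeo_diffK f x : loc_diffeo f x ->
  exists L : plane R -> plane R, cancel ('d f x) L /\ cancel L ('d f x).
Proof.
move=> [Cf [g [dg gf fg]]]; have df := C1_at_diff Cf.
have gx : g (f x) = x by exact: nbhs_singleton gf.
exists ('d g (f x)); split => v.
  have := @diff_comp _ _ _ _ f g x df dg => /(congr1 (@^~ v)) /= <-.
  have E : \forall y \near x, id y = (g \o f) y by apply: filterS gf => y /= ->.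
  have [_ ->] := near_eq_differentiable E (@ex_diff _ _ _ _ _ _ _ (is_diff_id x)).
  by rewrite diff_val.
have := @diff_comp _ _ _ _ g f (f x) dg; rewrite gx => /(_ df) /(congr1 (@^~ v)) /= <-.
have E : \forall y \near f x, id y = (f \o g) y by apply: filterS fg => y /= ->.
have [_ ->] := near_eq_differentiable E (@ex_diff _ _ _ _ _ _ _ (is_diff_id (f x))).
by rewrite diff_val.
Qed.

Lemma loc_diffeo_inj f x v : loc_diffeo f x -> 'd f x v = 0 -> v = 0.
Proof.
by move=> /loc_diffeo_diffK[L [LK _]] fv0; apply: (can_inj LK); rewrite fv0 linear0.
Qed.

Lemma loc_diffeo_surj f x w : loc_diffeo f x -> exists v, 'd f x v = w.
Proof. by move=> /loc_diffeo_diffK[L [_ LK]]; exists (L w). Qed.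

(** The local right inverse is continuous at [f x], hence sends all points near [f x] into [U]. *)
Lemma loc_diffeo_open (f : plane R -> plane R) (U : set (plane R)) :
  open U -> (forall x, U x -> loc_diffeo f x) -> open (f @` U).
Proof.
move=> oU fU; rewrite openE => _ [x Ux <-].
have [_ [g [dg gf fg]]] := fU x Ux.
have gx : g (f x) = x by exact: nbhs_singleton gf.
have gU : \forall y \near f x, U (g y).
  by apply: (differentiable_continuous dg); rewrite gx; exact: open_nbhs_nbhs.
by apply: filterS2 gU fg => y Ugy fgy; exists (g y).
Qed.

End C1.

(** * Scalar functions of class C^1 *)

Section Scalar.
Context {R : realType}.
Implicit Types V : normedModType R.

Lemma C1_at_cst V (W : normedModType R) (c : W) (x : V) : C1_at (cst c) x.
Proof.
split; first by apply: filterE.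
move=> v; have -> : (fun y => 'D_v (cst c) y) = cst 0 :> (V -> W).
  by apply/funext => y; rewrite derive_cst.
exact: cst_continuous.
Qed.

Lemma C1_at_plane_coord j (x : plane R) : C1_at (fun u : plane R => u 0 j : R^o) x.
Proof. by apply: C1_at_coord; case: (loc_diffeo_id x). Qed.

Lemma C1_at_add V (f g : V -> R^o) x :
  C1_at f x -> C1_at g x -> C1_at (fun y => f y + g y : R^o) x.
Proof.
move=> [df cf] [dg cg]; split.
  by apply: filterS2 df dg => y d1 d2; exact: differentiableD.
move=> v.
have E : \forall y \near x, 'D_v f y + 'D_v g y = 'D_v (fun y => f y + g y : R^o) y.
  apply: filterS2 df dg => y d1 d2.
  by have := deriveD (@diff_derivable _ _ _ _ _ v d1) (@diff_derivable _ _ _ _ _ v d2) => <-.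
rewrite /prop_for /continuous_at -(nbhs_singleton E).
by apply: cvg_trans (cvgD (cf v) (cg v)); exact: near_eq_cvg E.
Qed.

Lemma C1_at_mul V (f g : V -> R^o) x :
  C1_at f x -> C1_at g x -> C1_at (fun y => f y * g y : R^o) x.
Proof.
move=> [df cf] [dg cg]; split.
  by apply: filterS2 df dg => y d1 d2; exact: differentiableM.
move=> v.
have E : \forall y \near x, f y *: 'D_v g y + g y *: 'D_v f y = 'D_v (fun y => f y * g y : R^o) y.
  apply: filterS2 df dg => y d1 d2.
  by have := deriveM (@diff_derivable _ _ _ _ _ v d1) (@diff_derivable _ _ _ _ _ v d2) => <-.
rewrite /prop_for /continuous_at -(nbhs_singleton E).
have fx : {for x, continuous f} by exact: differentiable_continuous (nbhs_singleton df).
have gx : {for x, continuous g} by exact: differentiable_continuous (nbhs_singleton dg).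
by apply: cvg_trans (cvgD (cvgZ fx (cg v)) (cvgZ gx (cf v))); exact: near_eq_cvg E.
Qed.

Lemma derive_comp1 V (f : V -> R^o) (g : R^o -> R^o) x v :
  differentiable f x -> differentiable g (f x) ->
  'D_v (g \o f) x = 'D_v f x * derive1 g (f x).
Proof.
move=> df dg; rewrite derive_comp//.
by have /deriv1E -> := (derivable1_diffP g (f x)).2 dg.
Qed.

Lemma C1_at_comp1 V (f : V -> R^o) (g : R^o -> R^o) x :
  C1_at f x -> C1_at g (f x) -> C1_at (fun y => g (f y)) x.
Proof.
move=> Cf Cg; have fx := C1_at_continuous Cf.
have dgf : \forall y \near x, differentiable g (f y) := fx _ Cg.1.
split; first by apply: filterS2 Cf.1 dgf => y; exact: differentiable_comp.
move=> v.
have E : \forall y \near x, 'D_v f y * 'D_1 g (f y) = 'D_v (g \o f) y.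
  by apply: filterS2 Cf.1 dgf => y d1 d2; rewrite derive_comp1// derive1E.
rewrite /prop_for /continuous_at -(nbhs_singleton E).
apply: cvg_trans (cvgM (Cf.2 v) (continuous_cvg _ (Cg.2 1) fx)); exact: near_eq_cvg E.
Qed.

Lemma C1_at_line (f df : R -> R) (x : R) :
  (\forall y \near x, is_derive (y : R^o) (1 : R^o) (f : R^o -> R^o) (df y)) ->
  {for x, continuous df} -> C1_at (f : R^o -> R^o) x.
Proof.
move=> dE cdf; split.
  by apply: filterS dE => y [d _]; exact/derivable1_diffP.
move=> v.
have E : \forall y \near x, v * df y = 'D_v (f : R^o -> R^o) y.
  apply: filterS dE => y [d e]; rewrite deriveE; last exact/derivable1_diffP.
  by have /deriv1E -> := d; rewrite derive1E e.
rewrite /prop_for /continuous_at -(nbhs_singleton E).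
by apply: cvg_trans (cvgM (cvg_cst v) cdf); exact: near_eq_cvg E.
Qed.

Lemma C1_at_cos (x : R) : C1_at (cos : R^o -> R^o) x.
Proof.
apply: (@C1_at_line _ (fun y => - sin y)); first by apply: filterE => y; exact: is_derive_cos.
by apply: continuousN; exact: continuous_sin.
Qed.

Lemma C1_at_sin (x : R) : C1_at (sin : R^o -> R^o) x.
Proof.
apply: (@C1_at_line _ cos); first by apply: filterE => y; exact: is_derive_sin.
exact: continuous_cos.
Qed.

Lemma C1_at_sqrt (x : R) : 0 < x -> C1_at (Num.sqrt : R^o -> R^o) x.
Proof.
move=> x0; apply: (@C1_at_line _ (fun y => (2 * Num.sqrt y)^-1)).
  apply: filterS (lt_nbhsr x0) => y y0; exact: is_derive1_sqrt.
apply: cvgV; first by rewrite mulf_neq0// gt_eqF// sqrtr_gt0.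
by apply: cvgM; [exact: cvg_cst|exact: sqrt_continuous].
Qed.

End Scalar.

(** * Twists of the plane *)

Section Twist.
Context {R : realType}.
Implicit Types u v w : plane R.

Definition sqnorm u : R := u 0 0 ^+ 2 + u 0 1 ^+ 2.
Definition perp u : plane R := vec2 (- u 0 1) (u 0 0).
Definition dot u v : R := u 0 0 * v 0 0 + u 0 1 * v 0 1.

Lemma sqnorm_ge0 u : 0 <= sqnorm u.
Proof. by rewrite addr_ge0// sqr_ge0. Qed.

Lemma sqnorm_eq0 u : (sqnorm u == 0) = (u == 0).
Proof.
apply/idP/eqP => [|->]; last by rewrite /sqnorm !mxE expr0n/= addr0.
rewrite paddr_eq0 ?sqr_ge0// !sqrf_eq0 => /andP[/eqP h0 /eqP h1].
by apply: plane_eq; rewrite !mxE.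
Qed.

Lemma sqnorm_gt0 u : (0 < sqnorm u) = (u != 0).
Proof. by rewrite lt_neqAle sqnorm_ge0 andbT eq_sym sqnorm_eq0. Qed.

Lemma enorm_sqr u : enorm u ^+ 2 = sqnorm u.
Proof. by rewrite sqr_sqrtr// sqnorm_ge0. Qed.

Lemma enorm_ge0 u : 0 <= enorm u.
Proof. exact: sqrtr_ge0. Qed.

Lemma enorm_gt0 u : (0 < enorm u) = (u != 0).
Proof. by rewrite sqrtr_gt0 -/(sqnorm u) sqnorm_gt0. Qed.

Lemma enorm0 : enorm (0 : plane R) = 0.
Proof. by rewrite /enorm !mxE expr0n/= addr0 sqrtr0. Qed.

Lemma norm_le_enorm u : `|u| <= enorm u.
Proof.
apply: plane_norm_le; rewrite ?enorm_ge0// -sqrtr_sqr ler_wsqrtr//.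
  by rewrite lerDl sqr_ge0.
by rewrite lerDr sqr_ge0.
Qed.

Lemma enorm_le_norm u : enorm u <= 2 * `|u|.
Proof.
have h j : (u 0 j) ^+ 2 <= `|u| ^+ 2.
  by rewrite -real_normK ?num_real// ler_pXn2r ?nnegrE// coord_le.
rewrite -(@ler_pXn2r _ 2) ?nnegrE ?enorm_ge0 ?mulr_ge0//.
rewrite enorm_sqr exprMn /sqnorm; move: (h 0) (h 1) (sqr_ge0 `|u|); lra.
Qed.

Lemma enorm_continuous : continuous (enorm : plane R -> R).
Proof.
move=> u.
have c j : (fun x : plane R => x 0 j) x @[x --> u] --> u 0 j by exact: coord_continuous.
have s : sqnorm x @[x --> u] --> sqnorm u.
  exact: cvgD (cvgM (c 0) (c 0)) (cvgM (c 1) (c 1)).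
exact: (continuous_cvg _ (@sqrt_continuous R (sqnorm u)) s).
Qed.

Lemma rotation_sqnorm t u : sqnorm (rotation t u) = sqnorm u.
Proof.
rewrite /sqnorm vec2E0 vec2E1; have := cos2Dsin2 t.
move: (cos t) (sin t) => c s h.
transitivity ((c ^+ 2 + s ^+ 2) * (u 0 0 ^+ 2 + u 0 1 ^+ 2)); first by ring.
by rewrite h mul1r.
Qed.

Lemma rotation_enorm t u : enorm (rotation t u) = enorm u.
Proof. by rewrite /enorm -/(sqnorm _) rotation_sqnorm. Qed.

Lemma rotation0 t : rotation t (0 : plane R) = 0.
Proof. by apply: plane_eq; rewrite ?vec2E0 ?vec2E1 !mxE !mulr0 ?subrr ?addr0. Qed.

Lemma rotationK t : cancel (@rotation R t) (rotation (- t)).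
Proof.
move=> u; have := cos2Dsin2 t; rewrite /rotation cosN sinN !vec2E0 !vec2E1.
move: (cos t) (sin t) => c s h; apply: plane_eq; rewrite ?vec2E0 ?vec2E1.
  transitivity ((c ^+ 2 + s ^+ 2) * u 0 0); first by ring.
  by rewrite h mul1r.
transitivity ((c ^+ 2 + s ^+ 2) * u 0 1); first by ring.
by rewrite h mul1r.
Qed.

Lemma twistE a (rho : R -> R) u : twist a rho u = rotation (rho (enorm u / a)) u.
Proof. by rewrite /twist; case: eqP => [->|//]; rewrite rotation0. Qed.

Lemma twist_enorm a rho u : enorm (twist a rho u) = enorm u.
Proof. by rewrite twistE rotation_enorm. Qed.

Lemma twist0 a rho : twist a rho 0 = 0 :> plane R.
Proof. by rewrite twistE rotation0. Qed.

Lemma twist_eq0 a rho u : (twist a rho u == 0) = (u == 0).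
Proof. by apply: negb_inj; rewrite -!enorm_gt0 twist_enorm. Qed.

Lemma twistK a rho : cancel (twist a rho) (twist a (fun r : R => - rho r)).
Proof. by move=> u; rewrite [X in twist _ _ X]twistE twistE rotation_enorm rotationK. Qed.

Lemma twistNK a rho : cancel (twist a (fun r : R => - rho r)) (twist a rho).
Proof.
move=> u; have := twistK a (fun r => - rho r) u.
by congr (twist a _ _ = _); apply/funext => r /=; rewrite opprK.
Qed.

Lemma twist_continuous0 a rho : {for 0, continuous (twist a rho : plane R -> plane R)}.
Proof.
rewrite /prop_for /continuous_at twist0; apply/(@cvgrPdist_le _ _ _ (nbhs (0 : plane R))) => e e0.
have : \forall u \near (0 : plane R), `|u| < e / 2.
  by apply: nbhs0_lt; rewrite divr_gt0.
apply: filterS => u /ltW h; rewrite sub0r normrN; apply: le_trans (norm_le_enorm _) _.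
by rewrite twist_enorm; apply: le_trans (enorm_le_norm _) _; rewrite mulrC -ler_pdivlMr.
Qed.

Lemma C1_at_rotation (th : plane R -> R^o) u : C1_at th u ->
  C1_at (fun x => rotation (th x) x) u.
Proof.
move=> Cth.
have Cc := C1_at_comp1 Cth (C1_at_cos (th u)).
have Cs := C1_at_comp1 Cth (C1_at_sin (th u)).
have C0 := C1_at_plane_coord 0 u; have C1 := C1_at_plane_coord 1 u.
apply: C1_at_vec2; last exact: C1_at_add (C1_at_mul Cs C0) (C1_at_mul Cc C1).
apply: (@C1_at_ext _ _ _ (fun x => cos (th x) * x 0 0 + (- 1) * (sin (th x) * x 0 1) : R^o)).
  by apply: filterE => x; rewrite mulN1r.
apply: C1_at_add; first exact: C1_at_mul Cc C0.
by apply: C1_at_mul; [exact: C1_at_cst|exact: C1_at_mul Cs C1].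
Qed.

(** Differentiating a rotation with respect to its angle composes it with the quarter turn
    [perp]. *)
Lemma derive_rotation (th : plane R -> R^o) u v : differentiable th u ->
  'D_v (fun x => rotation (th x) x) u =
  rotation (th u) v + 'D_v th u *: rotation (th u) (perp u).
Proof.
move=> dth.
have dc x : differentiable (cos : R^o -> R^o) x by exact: C1_at_diff (C1_at_cos x).
have ds x : differentiable (sin : R^o -> R^o) x by exact: C1_at_diff (C1_at_sin x).
have dj j : differentiable (fun x : plane R => x 0 j : R^o) u by exact: differentiable_coord.
have ej j : 'D_v (fun x : plane R => x 0 j : R^o) u = v 0 j.
  have := @derive_mx R _ 1 2 id u v (@derivable_id _ _ _ _).
  by rewrite derive_id => /(congr1 (fun M : plane R => M 0 j)); rewrite mxE.
have ec : 'D_v (fun x => cos (th x) : R^o) u = 'D_v th u * - sin (th u).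
  by rewrite (derive_comp1 _ dth)// derive1E; have [_ ->] := is_derive_cos (th u).
have es : 'D_v (fun x => sin (th x) : R^o) u = 'D_v th u * cos (th u).
  by rewrite (derive_comp1 _ dth)// derive1E; have [_ ->] := is_derive_sin (th u).
have ic : derivable (fun x => cos (th x) : R^o) u v.
  by apply: diff_derivable; apply: (differentiable_comp dth).
have is_ : derivable (fun x => sin (th x) : R^o) u v.
  by apply: diff_derivable; apply: (differentiable_comp dth).
have ij j : derivable (fun x : plane R => x 0 j : R^o) u v by exact: diff_derivable.
have Crot : derivable (fun x => rotation (th x) x) u v.
  apply/derivable_mxP => i j; rewrite (ord1 i).
  have [->|] := eqVneq j 0.
    apply: (@near_eq_derivable _ _ _ (fun x => cos (th x) * x 0 0 - sin (th x) * x 0 1 : R^o)).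
      by apply: filterE => x; rewrite vec2E0.
    by apply: derivableB; apply: derivableM.
  rewrite -[j != 0]/(j != 0) => j0; have -> : j = 1.
    by case: (unliftP 0 j) j0 => [k ->|->]; rewrite ?eqxx// (ord1 k) => _; apply/val_inj.
  apply: (@near_eq_derivable _ _ _ (fun x => sin (th x) * x 0 0 + cos (th x) * x 0 1 : R^o)).
    by apply: filterE => x; rewrite vec2E1.
  by apply: derivableD; apply: derivableM.
rewrite derive_mx//; apply: plane_eq; rewrite !mxE /=.
  have -> : 'D_v (fun x => rotation (th x) x 0 0 : R^o) u =
      'D_v (fun x => cos (th x) * x 0 0 - sin (th x) * x 0 1 : R^o) u.
    by congr ('D_v _ u); apply/funext => x; rewrite vec2E0.
  rewrite (deriveB (derivableM ic (ij 0)) (derivableM is_ (ij 1))).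
  rewrite (deriveM ic (ij 0)) (deriveM is_ (ij 1)) !ej ec es /GRing.scale/=; ring.
have -> : 'D_v (fun x => rotation (th x) x 0 1 : R^o) u =
    'D_v (fun x => sin (th x) * x 0 0 + cos (th x) * x 0 1 : R^o) u.
  by congr ('D_v _ u); apply/funext => x; rewrite vec2E1.
rewrite (deriveD (derivableM is_ (ij 0)) (derivableM ic (ij 1))).
rewrite (deriveM is_ (ij 0)) (deriveM ic (ij 1)) !ej ec es /GRing.scale/=; ring.
Qed.

End Twist.

Section TwistC1.
Context {R : realType}.
Implicit Types u v w : plane R.
Variables (a : R) (rho : R -> R).
Hypothesis a_gt0 : 0 < a.
Hypothesis rhoC1 : forall r : R, 0 < r -> C1_at (rho : R^o -> R^o) r.

Let angle u : R^o := rho (enorm u / a).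

Lemma enorm_C1_at u : u != 0 -> C1_at (enorm : plane R -> R^o) u.
Proof.
rewrite -sqnorm_gt0 => u0.
have Cj j := C1_at_plane_coord j u.
exact: (C1_at_comp1 (C1_at_add (C1_at_mul (Cj 0) (Cj 0)) (C1_at_mul (Cj 1) (Cj 1))) (C1_at_sqrt u0)).
Qed.

Lemma derive_enorm u v : u != 0 -> 'D_v (enorm : plane R -> R^o) u = dot u v / enorm u.
Proof.
move=> u0; have Cj j := C1_at_plane_coord j u.
have sq0 : 0 < sqnorm u by rewrite sqnorm_gt0.
have dj j := C1_at_diff (Cj j).
have ej j : 'D_v (fun x : plane R => x 0 j : R^o) u = v 0 j.
  have := @derive_mx R _ 1 2 id u v (@derivable_id _ _ _ _).
  by rewrite derive_id => /(congr1 (fun M : plane R => M 0 j)); rewrite mxE.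
have ij j : derivable (fun x : plane R => x 0 j : R^o) u v by exact: diff_derivable.
have dsq : 'D_v (sqnorm : plane R -> R^o) u = 2 * dot u v.
  rewrite [LHS](deriveD (derivableM (ij 0) (ij 0)) (derivableM (ij 1) (ij 1))).
  by rewrite !deriveM// !ej /dot /GRing.scale/=; ring.
have dfsq := C1_at_diff (C1_at_add (C1_at_mul (Cj 0) (Cj 0)) (C1_at_mul (Cj 1) (Cj 1))).
rewrite -[LHS]/('D_v ((Num.sqrt : R^o -> R^o) \o sqnorm) u).
rewrite derive_comp1//; last exact: C1_at_diff (C1_at_sqrt sq0).
rewrite dsq derive1E; have [_ ->] := is_derive1_sqrt sq0.
rewrite -/(enorm u); have : enorm u != 0 by rewrite gt_eqF// enorm_gt0.
by move: (enorm u) (dot u v) => x y x0; field.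
Qed.

Let angle_C1 u : u != 0 -> C1_at angle u.
Proof.
move=> u0; apply: C1_at_comp1; last by apply: rhoC1; rewrite divr_gt0// enorm_gt0.
by apply: C1_at_mul; [exact: enorm_C1_at|exact: C1_at_cst].
Qed.

Let derive_angle u v : u != 0 ->
  'D_v angle u = dot u v / (enorm u * a) * derive1 rho (enorm u / a).
Proof.
move=> u0; have Ce := C1_at_mul (enorm_C1_at u0) (C1_at_cst (a^-1 : R^o) u).
rewrite (@derive_comp1 _ _ (fun x : plane R => enorm x / a : R^o) (rho : R^o -> R^o)).
- congr (_ * _).
  have := deriveM (@diff_derivable _ _ _ _ _ v (C1_at_diff (enorm_C1_at u0)))
                  (@derivable_cst _ _ _ (a^-1 : R^o) u v).
  rewrite derive_cst scaler0 add0r derive_enorm// => e; rewrite [LHS]e /GRing.scale/=.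
  by rewrite invfM mulrC mulrA.
- exact: C1_at_diff Ce.
- by apply: C1_at_diff; apply: rhoC1; rewrite divr_gt0// enorm_gt0.
Qed.

Lemma twist_C1_at u : u != 0 -> C1_at (twist a rho) u.
Proof.
move=> u0; apply: (C1_at_ext _ (C1_at_rotation (angle_C1 u0))).
by apply: filterE => x; rewrite twistE.
Qed.

Lemma derive_twist u v : u != 0 ->
  'D_v (twist a rho) u = rotation (rho (enorm u / a)) v +
    (dot u v / (enorm u * a) * derive1 rho (enorm u / a)) *:
      rotation (rho (enorm u / a)) (perp u).
Proof.
move=> u0; rewrite -derive_angle//.
rewrite -derive_rotation; last exact: C1_at_diff (angle_C1 u0).
by congr ('D_v _ u); apply/funext => x; rewrite twistE.
Qed.

(** Up to a rotation, the differential is the identity plus the rank one map sending [v] to a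
    multiple of [dot u v *: perp u]. That map is nilpotent because [perp u] is orthogonal to [u], so
    the determinant is 1. *)
Lemma det2_derive_twist u v w : u != 0 ->
  det2 ('D_v (twist a rho) u) ('D_w (twist a rho) u) = det2 v w.
Proof.
move=> u0; rewrite !derive_twist//.
have := cos2Dsin2 (rho (enorm u / a)).
rewrite /det2 /dot !mxE/=.
move: (derive1 rho _) (cos _) (sin _) (enorm u * a) => d c s n h.
transitivity ((c ^+ 2 + s ^+ 2) * (v 0 0 * w 0 1 - v 0 1 * w 0 0)); last by rewrite h mul1r.
by move: n^-1 => m; ring.
Qed.

(** In the radial direction the differential is a rotation of [u] plus [r * rho' r] times [perp u],
    two orthogonal vectors of equal length. A bound on this single derivative is therefore a bound
    on [r * rho' r]. *)
Lemma sqnorm_derive_twist u : u != 0 ->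
  sqnorm ('D_u (twist a rho) u) =
  sqnorm u * (1 + (enorm u / a * derive1 rho (enorm u / a)) ^+ 2).
Proof.
move=> u0; rewrite !derive_twist//.
have := cos2Dsin2 (rho (enorm u / a)).
have -> : dot u u / (enorm u * a) = enorm u / a.
  have -> : dot u u = enorm u ^+ 2 by rewrite enorm_sqr /sqnorm !expr2.
  have : enorm u != 0 by rewrite gt_eqF// enorm_gt0.
  by move: (enorm u) (lt0r_neq0 a_gt0) => x a0 x0; field; rewrite x0 a0.
rewrite /sqnorm !mxE/=.
move: (enorm u / a) (derive1 rho _) (sin _) (cos _) => n d s c h.
transitivity ((c ^+ 2 + s ^+ 2) * ((u 0 0 ^+ 2 + u 0 1 ^+ 2) * (1 + (n * d) ^+ 2))).
  by ring.
by rewrite h mul1r.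
Qed.

End TwistC1.

Section TwistDiffeo.
Context {R : realType}.
Variables (a : R) (rho : R -> R).
Hypothesis a_gt0 : 0 < a.
Hypothesis rhoC1 : forall r : R, 0 < r -> C1_at (rho : R^o -> R^o) r.

Lemma C1_at_opp (r : R) : C1_at (rho : R^o -> R^o) r -> C1_at ((fun x => - rho x) : R^o -> R^o) r.
Proof.
move=> C; apply: (@C1_at_ext _ _ _ (fun x : R^o => (- 1) * rho x : R^o)).
  by apply: filterE => x; rewrite mulN1r.
exact: (@C1_at_mul R R^o (cst (-1)) (rho : R^o -> R^o) r (@C1_at_cst R R^o R^o _ _) C).
Qed.

Lemma twist_loc_diffeo (u : plane R) : u != 0 -> loc_diffeo (twist a rho) u.
Proof.
move=> u0; split; first exact: twist_C1_at.
exists (twist a (fun r => - rho r)); split.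
- apply: C1_at_diff; apply: twist_C1_at; rewrite ?twist_eq0// => r r0.
  by apply: C1_at_opp; exact: rhoC1.
- by apply: filterE => x; rewrite twistK.
- by apply: filterE => x; rewrite twistNK.
Qed.

(* The angle varies by at most [C (|v| - |u|) / |u|] between radii [|u| <= |v|], while the rotated vector has length [|u|]. *)
Lemma twist_lipschitz (C : R) :
  (forall r, 0 < r -> r <= 1 -> `|r * derive1 rho r| <= C) ->
  [lipschitz twist a rho u | u in edisk a].
Proof.
move=> rhoC.
have C0 : 0 <= C by apply: le_trans (rhoC 1 ltr01 (lexx _)).
have rhoD x y : 0 < x -> x <= y -> y <= 1 -> `|rho y - rho x| * x <= C * (y - x).
  move=> x0 xy y1.
  have d z : z \in `]x, y[ -> is_derive z 1 rho (derive1 rho z).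
    rewrite in_itv/= => /andP[xz _]; have := C1_at_diff (rhoC1 (lt_trans x0 xz)).
    by move=> /derivable1_diffP dz; split=> //; rewrite derive1E.
  have c : {within `[x, y], continuous rho}.
    apply: continuous_in_subspaceT => z; rewrite inE/= in_itv/= => /andP[xz _].
    by apply: (C1_at_continuous (rhoC1 _)); exact: lt_le_trans xz.
  have [z /[!in_itv]/= /andP[xz zy] ->] := MVT_segment xy d c.
  have z0 : 0 < z by exact: lt_le_trans xz.
  rewrite normrM (ger0_norm (_ : 0 <= y - x)) ?subr_ge0// mulrAC ler_wpM2r ?subr_ge0//.
  apply: le_trans (rhoC z z0 (le_trans zy y1)); rewrite normrM mulrC.
  by rewrite ler_wpM2r// gtr0_norm.
have lip1 (f df : R -> R) : (forall z : R, is_derive z 1 f (df z)) -> (forall z, `|df z| <= 1) ->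
    forall x y, `|f x - f y| <= `|x - y|.
  move=> fd df1 x y; wlog yx : x y / y <= x.
    by move=> H; case: (leP y x) => [/H//|/ltW/H]; rewrite distrC (distrC y).
  have c : {within `[y, x], continuous f}.
    apply: continuous_subspaceT => z; have [d _] := fd z.
    by apply: differentiable_continuous; exact/derivable1_diffP.
  have [z _ ->] := MVT_segment yx (fun z _ => fd z) c.
  by rewrite normrM ler_piMl.
have cosL (x y : R) : `|cos x - cos y| <= `|x - y|.
  apply: (lip1 cos (fun z => - sin z)) => z.
  by rewrite normrN; exact: sin_max.
have sinL (x y : R) : `|sin x - sin y| <= `|x - y|.
  by apply: (lip1 sin cos) => z; exact: cos_max.
have cle (c s x y m : R) : `|c| <= m -> `|s| <= m -> forall e, `|x| <= e -> `|y| <= e ->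
    `|c * x - s * y| <= 2 * (m * e) /\ `|s * x + c * y| <= 2 * (m * e).
  move=> cm sm e xe ye; have e0 : 0 <= e by exact: le_trans xe.
  have m0 : 0 <= m by exact: le_trans cm.
  have E : 2 * (m * e) = m * e + m * e by rewrite mulr2n mulrDl mul1r.
  by rewrite E; split; (apply: le_trans (ler_normB _ _) _ || apply: le_trans (ler_normD _ _) _);
    rewrite !normrM; apply: lerD; apply: ler_pM.
have coE (u : plane R) j : `|u 0 j| <= enorm u.
  exact: le_trans (coord_le _ _) (norm_le_enorm _).
have enormB (u v : plane R) : enorm v - enorm u <= 2 * `|v - u|.
  have [s0|s0] := ltP 0 (enorm v + enorm u); last first.
    apply: (@le_trans _ _ 0); last by rewrite mulr_ge0.
    by rewrite subr_le0; move: (enorm_ge0 u) (enorm_ge0 v) s0; lra.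
  rewrite -(ler_pM2r s0) -subr_sqr !enorm_sqr /sqnorm.
  have t j : v 0 j ^+ 2 - u 0 j ^+ 2 <= `|v - u| * (enorm v + enorm u).
    rewrite subr_sqr; apply: le_trans (ler_norm _) _; rewrite normrM.
    apply: ler_pM => //; first by have := coord_le (v - u) j; rewrite !mxE.
    by apply: le_trans (ler_normD _ _) _; rewrite lerD.
  by move: (t 0) (t 1); lra.
(* The 2 bounds a rotation in the sup norm. The [4 * C] is the same 2 times the bound
   [2 * C * |u - v|] for the change of angle multiplied by the radius. *)
have main (u v : plane R) : enorm u <= enorm v -> enorm v <= a ->
    `|twist a rho u - twist a rho v| <= (2 + 4 * C) * `|u - v|.
  move=> uv va; rewrite !twistE.
  set tu := rho (enorm u / a); set tv := rho (enorm v / a).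
  have tuv : `|tu - tv| * enorm u <= C * (2 * `|u - v|).
    have [->|u0] := eqVneq u 0; first by rewrite enorm0 mulr0 !mulr_ge0.
    rewrite -enorm_gt0 in u0.
    have h1 : 0 < enorm u / a by rewrite divr_gt0.
    have h2 : enorm u / a <= enorm v / a by rewrite ler_pM2r// invr_gt0.
    have h3 : enorm v / a <= 1 by rewrite ler_pdivrMr// mul1r.
    have := rhoD _ _ h1 h2 h3; rewrite -/tu -/tv -mulrBl !mulrA ler_pM2r ?invr_gt0// => h.
    rewrite distrC; apply: le_trans h _; rewrite -mulrA ler_wpM2l// distrC; exact: enormB.
  have -> : rotation tu u - rotation tv v =
      rotation tv (u - v) + vec2 ((cos tu - cos tv) * u 0 0 - (sin tu - sin tv) * u 0 1)
                                 ((sin tu - sin tv) * u 0 0 + (cos tu - cos tv) * u 0 1).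
    by apply: plane_eq; rewrite !mxE /=; ring.
  apply: le_trans (ler_normD _ _) _; rewrite [leRHS]mulrDl; apply: lerD.
    have [h1 h2] := cle _ _ _ _ _ (cos_max tv) (sin_max tv) _ (coord_le (u - v) 0) (coord_le (u - v) 1).
    by rewrite mul1r in h1 h2; apply: plane_norm_le; rewrite ?mulr_ge0// ?vec2E0 ?vec2E1.
  apply: (@le_trans _ _ (2 * (`|tu - tv| * enorm u))).
    have [h1 h2] := cle _ _ _ _ _ (cosL tu tv) (sinL tu tv) _ (coE u 0) (coE u 1).
    by apply: plane_norm_le; rewrite ?mulr_ge0 ?enorm_ge0 ?vec2E0 ?vec2E1.
  by move: tuv; set p := _ * enorm u; set q := `|u - v|; nra.
rewrite /lipschitz_on; near=> M; move=> [u v] [/= ua va].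
apply: (@le_trans _ _ ((2 + 4 * C) * `|u - v|)); last first.
  by rewrite ler_wpM2r//; near: M; apply: nbhs_pinfty_ge; exact: num_real.
have [uv|vu] := leP (enorm u) (enorm v); first exact: main.
by rewrite distrC (distrC u); apply: main => //; exact: ltW.
Unshelve. all: by end_near. Qed.

End TwistDiffeo.

(** * The model Hamiltonian *)

Section Model.
Context {R : realType}.
Implicit Types (u v w : plane R) (s : R).

Definition quad s u : R := s ^+ 2 * u 0 0 ^+ 2 + u 0 1 ^+ 2 / s ^+ 2.

Lemma enorm_stretch s u : enorm (stretch s u) ^+ 2 = quad s u.
Proof. by rewrite enorm_sqr /sqnorm vec2E0 vec2E1 /quad exprMn expr_div_n. Qed.

Lemma quad_ge0 s u : 0 <= quad s u.
Proof. by rewrite -enorm_stretch sqr_ge0. Qed.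

Lemma quad0 s : quad s 0 = 0.
Proof. by rewrite /quad !mxE expr0n/= mulr0 mul0r addr0. Qed.

Lemma quad_gt0 s u : s != 0 -> u != 0 -> 0 < quad s u.
Proof.
move=> s0 u0; rewrite lt_neqAle quad_ge0 andbT eq_sym paddr_eq0; last 2 first.
- by rewrite mulr_ge0// sqr_ge0.
- by rewrite divr_ge0// sqr_ge0.
apply: contra u0; rewrite !mulf_eq0 invr_eq0 !sqrf_eq0 !(negbTE s0) !orbF !orFb !orbb.
move=> /andP[/eqP h0 /eqP h1].
by apply/eqP/plane_eq; rewrite !mxE.
Qed.

Lemma model0 s : model_hamiltonian s 0 = 0 :> R.
Proof. by rewrite /model_hamiltonian eqxx. Qed.

Lemma modelE s u : u != 0 -> model_hamiltonian s u = expR (- (quad s u)^-1).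
Proof. by move=> /negbTE u0; rewrite /model_hamiltonian u0 enorm_stretch. Qed.

Lemma model_ge0 s u : 0 <= model_hamiltonian s u.
Proof. by rewrite /model_hamiltonian; case: ifP => // _; exact: expR_ge0. Qed.

Lemma model_gt0 s u : u != 0 -> 0 < model_hamiltonian s u.
Proof. by move=> u0; rewrite modelE// expR_gt0. Qed.

(** This is [x <= expR x] applied to the reciprocal of [quad s u]. *)
Lemma model_le_quad s u : s != 0 -> model_hamiltonian s u <= quad s u.
Proof.
move=> s0; have [->|u0] := eqVneq u 0; first by rewrite model0 quad_ge0.
have q0 := quad_gt0 s0 u0; rewrite modelE// expRN.
rewrite -[leRHS]invrK lef_pV2 ?posrE ?invr_gt0 ?expR_gt0//.
by apply: le_trans (expR_ge1Dx _); rewrite lerDr.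
Qed.

Lemma quad_C1_at s u : C1_at (quad s : plane R -> R^o) u.
Proof.
have Cj j := C1_at_plane_coord j u.
have Cc c := C1_at_cst (c : R^o) u.
exact: (C1_at_add (C1_at_mul (Cc (s ^+ 2)) (C1_at_mul (Cj 0) (Cj 0)))
                  (C1_at_mul (C1_at_mul (Cj 1) (Cj 1)) (Cc (s ^+ 2)^-1))).
Qed.

Definition dquad s u v : R := 2 * (s ^+ 2 * u 0 0 * v 0 0 + u 0 1 * v 0 1 / s ^+ 2).

Lemma derive_coord j u v : 'D_v (fun x : plane R => x 0 j : R^o) u = v 0 j.
Proof.
have := @derive_mx R _ 1 2 id u v (@derivable_id _ _ _ _).
by rewrite derive_id => /(congr1 (fun M : plane R => M 0 j)); rewrite mxE.
Qed.

Lemma derive_quad s u v : 'D_v (quad s : plane R -> R^o) u = dquad s u v.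
Proof.
have ij j : derivable (fun x : plane R => x 0 j : R^o) u v.
  exact: diff_derivable (C1_at_diff (C1_at_plane_coord j u)).
have ii j : derivable (fun x : plane R => x 0 j * x 0 j : R^o) u v := derivableM (ij j) (ij j).
have e j : 'D_v (fun x : plane R => x 0 j * x 0 j : R^o) u = 2 * (u 0 j * v 0 j).
  by rewrite [LHS](deriveM (ij j) (ij j)) !derive_coord /GRing.scale/=; ring.
have -> : (quad s : plane R -> R^o) = (fun x => s ^+ 2 *: (x 0 0 * x 0 0 : R^o)) +
    (fun x => (s ^+ 2)^-1 *: (x 0 1 * x 0 1 : R^o)).
  by apply/funext => x; rewrite /quad [RHS]/= /GRing.scale/= !expr2 [X in _ + X]mulrC.
rewrite (deriveD (derivableZ (ii 0)) (derivableZ (ii 1))).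
rewrite (deriveZ _ (ii 0)) (deriveZ _ (ii 1)) !e /dquad /GRing.scale/=.
by move: (s ^+ 2)^-1 => m; ring.
Qed.

Lemma near_neq0 u : u != 0 -> \forall x \near u, x != 0.
Proof.
rewrite -sqnorm_gt0 => u0.
have c : {for u, continuous (sqnorm : plane R -> R^o)}.
  have Cj j := C1_at_plane_coord j u.
  exact: C1_at_continuous (C1_at_add (C1_at_mul (Cj 0) (Cj 0)) (C1_at_mul (Cj 1) (Cj 1))).
have H : \forall x \near u, 0 < sqnorm x := c _ (lt_nbhsr u0).
by apply: filterS H => x; rewrite sqnorm_gt0.
Qed.

Let bump (x : R) : R := expR (- x^-1).

Let is_derive_bump (x : R) : 0 < x -> is_derive x 1 bump (bump x / x ^+ 2).
Proof.
move=> x0.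
have dinv : is_derive x 1 (fun y : R => - y^-1) (x ^- 2).
  have [d e] : is_derive x 1 (fun y : R => y) 1 by exact: is_derive_id.
  have x0' : (fun y : R => y) x != 0 by rewrite gt_eqF.
  have dV := derivableV x0' d; split; first exact: derivableN.
  by rewrite [LHS](deriveN dV) (deriveV x0' d) e /GRing.scale/= mulr1 opprK.
by have := @is_derive1_comp R expR (fun y : R => - y^-1) x _ _ (is_derive_expR _) dinv.
Qed.

Lemma model_C1_at s u : s != 0 -> u != 0 -> C1_at (model_hamiltonian s : plane R -> R^o) u.
Proof.
move=> s0 u0; apply: (@C1_at_ext _ _ _ (fun x => bump (quad s x) : R^o)).
  by apply: filterS (near_neq0 u0) => x x0; rewrite modelE.
apply: (C1_at_comp1 (quad_C1_at s u)).
apply: (@C1_at_line _ _ (fun x => bump x / x ^+ 2)).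
  by apply: filterS (lt_nbhsr (quad_gt0 s0 u0)) => y y0; exact: is_derive_bump.
have q0 := quad_gt0 s0 u0.
have cb : {for quad s u, continuous bump}.
  by have [d _] := is_derive_bump q0; apply: differentiable_continuous; exact/derivable1_diffP.
have cs : {for quad s u, continuous (fun x : R => x * x)} by exact: cvgM cvg_id cvg_id.
by apply: (cvgM cb); apply: cvgV => //; rewrite mulf_neq0// gt_eqF.
Qed.

Lemma derive_model s u v : s != 0 -> u != 0 ->
  'D_v (model_hamiltonian s : plane R -> R^o) u =
  model_hamiltonian s u / quad s u ^+ 2 * dquad s u v.
Proof.
move=> s0 u0; have q0 := quad_gt0 s0 u0.
transitivity ('D_v (fun x => bump (quad s x) : R^o) u).
  by apply: near_eq_derive; apply: filterS (near_neq0 u0) => x x0; rewrite modelE.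
have [d e] := is_derive_bump q0.
rewrite (@derive_comp1 _ _ (quad s : plane R -> R^o) (bump : R^o -> R^o)).
- by rewrite derive_quad derive1E [X in _ * X]e modelE// mulrC.
- exact: C1_at_diff (quad_C1_at s u).
- exact/derivable1_diffP.
Qed.

Lemma model_continuous s : s != 0 -> continuous (model_hamiltonian s : plane R -> R).
Proof.
move=> s0 u; have [->|u0] := eqVneq u 0; last exact: C1_at_continuous (model_C1_at s0 u0).
rewrite /continuous_at model0.
have : quad s x @[x --> (0 : plane R)] --> (0 : R).
  by rewrite -[X in _ --> X](quad0 s); exact: C1_at_continuous (quad_C1_at s 0).
have E : \forall x \near (0 : plane R), 0 <= model_hamiltonian s x <= quad s x.
  by apply: filterE => x; rewrite model_ge0 model_le_quad.
move=> q0; exact: (squeeze_cvgr E (cvg_cst (0 : R)) q0).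
Qed.

End Model.

(** * Hamiltonian vectors and determinants in the plane *)

Section Hamiltonian.
Context {R : realType}.
Implicit Types (u v w : plane R).

Definition ham (f : plane R -> R^o) u : plane R :=
  vec2 ('D_(vec2 0 1) f u) (- 'D_(vec2 1 0) f u).

Lemma det2_ham f u v : differentiable f u -> det2 (ham f u) v = 'D_v f u.
Proof.
move=> df; rewrite derive_plane// /det2 vec2E0 vec2E1 /GRing.scale/=; ring.
Qed.

Lemma ham_unique f u X : (forall v, det2 X v = 'D_v f u) -> X = ham f u.
Proof.
move=> XE; apply: plane_eq; rewrite ?vec2E0 ?vec2E1 -XE /det2 vec2E0 vec2E1; ring.
Qed.

Lemma det2_basis (L : {linear plane R -> plane R}) v w :
  det2 (L v) (L w) = det2 (L (vec2 1 0)) (L (vec2 0 1)) * det2 v w.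
Proof.
rewrite [in LHS](vec2_basis v) [in LHS](vec2_basis w) !linearD !linearZ /det2 !mxE; ring.
Qed.

Lemma cramer v w z : det2 v w != 0 ->
  (det2 z w / det2 v w) *: v + (det2 v z / det2 v w) *: w = z.
Proof.
move=> vw; apply: plane_eq; rewrite !mxE.
  transitivity (z 0 0 * det2 v w / det2 v w); last by rewrite mulfK.
  by move: (det2 v w)^-1 => m; rewrite /det2; ring.
transitivity (z 0 1 * det2 v w / det2 v w); last by rewrite mulfK.
by move: (det2 v w)^-1 => m; rewrite /det2; ring.
Qed.

Lemma det2_le v w (m : R) : `|v| <= m -> `|det2 v w| <= 2 * (m * `|w|).
Proof.
move=> vm; have v0 := le_trans (coord_le v 0) vm; have v1 := le_trans (coord_le v 1) vm.
have -> : 2 * (m * `|w|) = m * `|w| + m * `|w| by ring.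
by apply: le_trans (ler_normB _ _) _; rewrite !normrM; apply: lerD; apply: ler_pM => //; exact: coord_le.
Qed.

Lemma det2C v w : det2 w v = - det2 v w.
Proof. by rewrite /det2; ring. Qed.

Lemma det2_eq0 w : (forall z, det2 z w = 0) -> w = 0.
Proof.
move=> H; apply: plane_eq; rewrite !mxE.
  by have := H (vec2 0 1); rewrite /det2 vec2E0 vec2E1; lra.
by have := H (vec2 1 0); rewrite /det2 vec2E0 vec2E1; lra.
Qed.

Definition jac (A : plane R -> plane R) u : R :=
  det2 ('D_(vec2 1 0) A u) ('D_(vec2 0 1) A u).

Lemma det2_diff (A : plane R -> plane R) u v w : differentiable A u ->
  det2 ('d A u v) ('d A u w) = jac A u * det2 v w.
Proof. by move=> dA; rewrite det2_basis /jac !deriveE. Qed.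

Lemma jac_neq0 (A : plane R -> plane R) u : loc_diffeo A u -> jac A u != 0.
Proof.
move=> Ad; apply/eqP => j0.
have dA := loc_diffeo_diff Ad.
have [v0 e0] := loc_diffeo_surj (vec2 1 0) Ad.
have [v1 e1] := loc_diffeo_surj (vec2 0 1) Ad.
have := det2_diff v0 v1 dA; rewrite j0 mul0r e0 e1 /det2 !vec2E0 !vec2E1; lra.
Qed.

Lemma jac_continuous (A : plane R -> plane R) u : C1_at A u -> {for u, continuous (jac A)}.
Proof.
move=> CA.
have c v k : {for u, continuous (fun x => ('D_v A x) 0 k)}.
  exact: (@coord_cvg _ _ (nbhs u) _ _ _ k (CA.2 v)).
exact: cvgB (cvgM (c _ 0) (c _ 1)) (cvgM (c _ 1) (c _ 0)).
Qed.

Lemma is_derive_line (W : normedModType R) (F : plane R -> W) (p v : plane R) (t : R) :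
  differentiable F (t *: v + p) ->
  is_derive t 1 (fun x : R => F (x *: v + p)) ('D_v F (t *: v + p)).
Proof.
move=> dF.
have E : (fun h : R => h^-1 *: (F ((h *: 1 + t) *: v + p) - F (t *: v + p))) =
         (fun h : R => h^-1 *: (F (h *: v + (t *: v + p)) - F (t *: v + p))).
  by apply/funext => h; rewrite scalerDl -addrA [h%:A]mulr1.
split; last by rewrite /derive E.
by rewrite /derivable E; exact: diff_derivable.
Qed.

(** Here [x] and [y] are the squared coordinates of a point at which [quad 2] and [quad 2^-1] nearly
    take the value [17 / 4 * T] that both have on the diagonal, with [T] the square of the
    parameter. Two transverse ellipses then keep the point off both axes. *)
Lemma ellipses_lower (x y T : R) : 0 <= T ->
  33 * (4 * x + y / 4) <= 34 * (17 / 4 * T) -> 34 * (17 / 4 * T) <= 35 * (4 * x + y / 4) ->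
  33 * (x / 4 + 4 * y) <= 34 * (17 / 4 * T) -> 34 * (17 / 4 * T) <= 35 * (x / 4 + 4 * y) ->
  T / 4 <= x /\ T / 4 <= y.
Proof. by move=> *; split; lra. Qed.

(** Inversion of the linear system formed by the differentials of [quad 2] and [quad 2^-1], in which
    the unknowns are the products of corresponding coordinates of the point and of the vector. *)
Lemma ellipses_upper (x y c c' : R) : 0 <= c -> 0 <= c' ->
  `|8 * x + y / 2| <= c -> `|x / 2 + 8 * y| <= c' -> `|x| <= c + c' /\ `|y| <= c + c'.
Proof.
rewrite !ler_norml => c0 c0' /andP[a1 a2] /andP[b1 b2]; split; apply/andP; split; lra.
Qed.

Lemma sqnorm_le (z : plane R) (m : R) : `|z| <= m -> sqnorm z <= 2 * m ^+ 2.
Proof.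
move=> zm; have h i : z 0 i ^+ 2 <= m ^+ 2.
  have zi := le_trans (coord_le z i) zm.
  rewrite -[leLHS]real_normK ?num_real// ler_pXn2r ?nnegrE//.
  exact: le_trans (normr_ge0 _) zi.
by have := lerD (h 0) (h 1); rewrite [2 * _]mulr_natl mulr2n.
Qed.

(** Extracts the bound on [r * rho' r], in the role of [y], from [sqnorm_derive_twist]. *)
Lemma one_sqr_le (y k w x : R) : 0 <= k -> 0 < w -> x ^+ 2 = w ->
  w * (1 + y ^+ 2) <= 2 * (k * x) ^+ 2 -> `|y| <= 2 * k.
Proof.
move=> k0 w0 xw; rewrite exprMn xw mulrA [leLHS]mulrC => h.
have {}h : 1 + y ^+ 2 <= 2 * k ^+ 2 by move: h; rewrite ler_pM2r// => ->.
rewrite -(@ler_pXn2r _ 2) ?nnegrE ?mulr_ge0// real_normK ?num_real//.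
by rewrite exprMn; move: h (sqr_ge0 k); lra.
Qed.

End Hamiltonian.

(** * First return to the center *)

Section Ray.
Context {R : realType}.
Implicit Types (u v w : plane R).
Variables (a : R) (rho : R -> R).
Hypothesis a_gt0 : 0 < a.
Hypothesis rhoC1 : forall r : R, 0 < r -> C1_at (rho : R^o -> R^o) r.
Variable A : plane R -> plane R.
Hypothesis A0 : A 0 = 0.
Hypothesis Ad : loc_diffeo A 0.

Let tau : plane R -> plane R := twist a (fun r => - rho r).
Let g (s : R) : plane R -> R^o := model_hamiltonian s.
Let W u := tau (A u).

Hypothesis Aconj : forall s : R, s = 2 \/ s = 2^-1 ->
  \forall u \near (0 : plane R), 'd A u (ham (g s) u) = ham (g s \o tau) (A u).

Let tau_diff u : u != 0 -> differentiable tau u.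
Proof. move=> u0; exact: C1_at_diff (twist_C1_at a_gt0 (fun r r0 => C1_at_opp (rhoC1 r0)) u0). Qed.

Let s_neq0 (s : R) : s = 2 \/ s = 2^-1 -> s != 0.
Proof. by case=> ->; rewrite ?invr_eq0 pnatr_eq0. Qed.

Let near_A_neq0 : \forall u \near (0 : plane R), u != 0 -> A u != 0.
Proof.
have [_ [B [_ BA _]]] := Ad.
have B0 : B 0 = 0 by rewrite -[in LHS]A0; exact: nbhs_singleton BA.
by apply: filterS BA => u BAu; apply: contraNneq => Au0; rewrite -BAu Au0 B0.
Qed.

(** A differential is the determinant against its Hamiltonian vector. [Aconj] transports that
    vector, and the differential of [A] multiplies determinants by [jac A], so the two differentials
    are proportional. *)
Let pullback (s : R) : s = 2 \/ s = 2^-1 ->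
  \forall u \near (0 : plane R), u != 0 ->
    differentiable (fun x => g s (W x) : R^o) u /\
    forall v, 'D_v (fun x => g s (W x) : R^o) u = jac A u * 'D_v (g s) u.
Proof.
move=> sE; have s0 := s_neq0 sE.
apply: filterS3 Ad.1.1 near_A_neq0 (Aconj sE) => u dA Au0 conj u0.
have dg : differentiable (g s) u by exact: C1_at_diff (model_C1_at s0 u0).
have dgt : differentiable (g s \o tau) (A u).
  apply: differentiable_comp; first exact: tau_diff (Au0 u0).
  by apply: C1_at_diff; apply: model_C1_at => //; rewrite twist_eq0 Au0.
split; first exact: (differentiable_comp dA dgt).
move=> v; rewrite [LHS](derive_comp _ dA dgt).
by rewrite -(deriveE _ dgt) -(det2_ham _ dgt) -conj (deriveE _ dA) det2_diff// det2_ham.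
Qed.

(** The sign stays open at this stage, since [A] might reverse the orientation. *)
Let jac_bounds : exists c C : R, [/\ 0 < c, 0 < C &
  (\forall u \near (0 : plane R), c <= jac A u <= C) \/
  (\forall u \near (0 : plane R), - C <= jac A u <= - c)].
Proof.
have j0 := jac_neq0 Ad; have cj := jac_continuous Ad.1.
have [jp|jn] : 0 < jac A 0 \/ jac A 0 < 0 by move: j0; rewrite neq_lt orbC => /orP.
  exists (jac A 0 / 2), (jac A 0 * 2); split; [by rewrite divr_gt0|by rewrite mulr_gt0|left].
  have h1 : jac A 0 / 2 < jac A 0 by rewrite ltr_pdivrMr// ltr_pMr// ltr1n.
  have h2 : jac A 0 < jac A 0 * 2 by rewrite ltr_pMr// ltr1n.
  have H1 : \forall u \near (0 : plane R), jac A 0 / 2 < jac A u := cj _ (lt_nbhsr h1).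
  have H2 : \forall u \near (0 : plane R), jac A u < jac A 0 * 2 := cj _ (lt_nbhsl h2).
  by apply: filterS2 H1 H2 => u /ltW -> /ltW ->.
exists (- jac A 0 / 2), (- jac A 0 * 2); rewrite divr_gt0 ?mulr_gt0 ?oppr_gt0//; split=> //; right.
have h1 : jac A 0 < - (- jac A 0 / 2) by move: jn; move: (jac A 0) => x; lra.
have h2 : - (- jac A 0 * 2) < jac A 0 by move: jn; move: (jac A 0) => x; lra.
have H1 : \forall u \near (0 : plane R), jac A u < - (- jac A 0 / 2) := cj _ (lt_nbhsl h1).
have H2 : \forall u \near (0 : plane R), - (- jac A 0 * 2) < jac A u := cj _ (lt_nbhsr h2).
by apply: filterS2 H1 H2 => u /ltW -> /ltW ->.
Qed.

Let e : plane R := vec2 1 1.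

Let expand (s t : R) (v : plane R) : s != 0 -> 0 < t ->
  'D_v (g s) (t *: e) = g s (t *: e) / quad s (t *: e) ^+ 2 * dquad s (t *: e) v.
Proof.
move=> s0 t0; rewrite derive_model//.
apply/eqP => /(congr1 (fun M : plane R => M 0 0)); rewrite !mxE /= mulr1 => t0'.
by move: t0; rewrite t0' ltxx.
Qed.

Let ray_neq0 (t : R) : 0 < t -> t *: e != 0.
Proof.
move=> t0; apply/eqP => /(congr1 (fun M : plane R => M 0 0)); rewrite !mxE /= mulr1 => t0'.
by move: t0; rewrite t0' ltxx.
Qed.

Let near_ray (P : plane R -> Prop) : (\forall u \near (0 : plane R), P u) ->
  exists2 d : R, 0 < d & forall t, 0 < t -> t < d -> P (t *: e).
Proof.
move=> /nbhs_ballP[d /= d0 dP]; exists d => // t t0 td; apply: dP.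
rewrite -ball_normE /= sub0r normrN normrZ gtr0_norm//.
rewrite (le_lt_trans _ td)// ler_piMr ?(ltW t0)//.
by apply: plane_norm_le; rewrite ?vec2E0 ?vec2E1 ?normr1.
Qed.

Let W_continuous : {for 0, continuous W}.
Proof.
have cA := C1_at_continuous Ad.1.
have ct : {for A 0, continuous tau} by rewrite A0; exact: twist_continuous0.
exact: continuous_cvg ct cA.
Qed.

(* The sign of the Jacobian is forced, because both functions vanish at the origin and are positive elsewhere. *)
Let compare (s : R) : s = 2 \/ s = 2^-1 -> exists c C : R, [/\ 0 < c, 0 < C &
  exists2 d : R, 0 < d & forall t, 0 < t -> t < d ->
    [/\ c * g s (t *: e) <= g s (W (t *: e)), g s (W (t *: e)) <= C * g s (t *: e) &
      `|jac A (t *: e)| <= C]].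
Proof.
move=> sE; have s0 := s_neq0 sE.
have [c [C [c0 C0 jb]]] := jac_bounds; exists c, C; split=> //.
have [d1 d10 Hpull] := near_ray (pullback sE).
have [d2 d20 HA] := near_ray near_A_neq0.
have le_c : {for 0, continuous (fun t : R => t *: e)}.
  by rewrite /prop_for /continuous_at scale0r -[X in _ --> X](scale0r e); apply: cvgZr_tmp; exact: cvg_id.
have W0 : W 0 = 0 by rewrite /W A0 /tau twist0.
have e0 : (0 : R) *: e = 0 by rewrite scale0r.
have pc : {for 0, continuous (fun t : R => g s (t *: e) : R)}.
  by apply: (continuous_cvg _ _ le_c); exact: model_continuous.
have fc : {for 0, continuous (fun t : R => g s (W (t *: e)) : R)}.
  apply: (continuous_cvg _ (@model_continuous R s s0 (W (0 *: e)))).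
  by apply: (continuous_cvg _ _ le_c); rewrite e0; exact: W_continuous.
have dline (F : plane R -> R^o) (t : R) : differentiable F (t *: e) ->
    is_derive t 1 (fun x : R => F (x *: e) : R) ('D_e F (t *: e)).
  by move=> dF; have := @is_derive_line R R^o F 0 e t; rewrite addr0 => /(_ dF);
    congr (is_derive _ _ _ _); apply/funext => x; rewrite addr0.
(* Along the ray the derivative of this combination is [l * jac A + k] times the derivative of
   [g s], which is nonnegative there, and the combination vanishes at 0. The choices [1, -c] and
   [-1, C] give the two estimates; [-1, -c] refutes a negative Jacobian. *)
have mono (l k d : R) : 0 < d -> d <= d1 ->
    (forall t, 0 < t -> t < d -> 0 <= l * jac A (t *: e) + k) ->
    forall t, 0 < t -> t < d -> 0 <= l * g s (W (t *: e)) + k * g s (t *: e).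
  move=> d0 dd1 H t t0 td.
  pose h (x : R) : R := l * g s (W (x *: e)) + k * g s (x *: e).
  have h0 : h 0 = 0 by rewrite /h e0 W0 /g model0 !mulr0 addr0.
  have hd (x : R) : 0 < x -> x < d ->
      is_derive x 1 h ((l * jac A (x *: e) + k) * 'D_e (g s) (x *: e)).
    move=> x0 xd; have [dF DF] := Hpull x x0 (lt_le_trans xd dd1) (ray_neq0 x0).
    have i1 := dline _ _ dF; rewrite DF in i1.
    have i2 := dline _ _ (C1_at_diff (model_C1_at s0 (ray_neq0 x0))).
    have := is_deriveD (is_deriveZ l i1) (is_deriveZ k i2).
    by move=> [dd ee]; split; [exact: dd|rewrite [LHS]ee /g /GRing.scale/=; ring].
  have hc : {within `[0, t], continuous h}.
    apply: continuous_in_subspaceT => x; rewrite inE/= in_itv/= => /andP[x0 xt].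
    have [->|xn0] := eqVneq x 0; first exact: cvgD (cvgM (cvg_cst l) fc) (cvgM (cvg_cst k) pc).
    have xp : 0 < x by rewrite lt_neqAle eq_sym xn0.
    have [dx _] := hd x xp (le_lt_trans xt td).
    by apply: differentiable_continuous; exact/derivable1_diffP.
  have hd1 (x : R) : x \in `]0, t[ -> derivable h x 1.
    by rewrite in_itv/= => /andP[x0 xt]; have [] := hd x x0 (lt_trans xt td).
  have hd2 (x : R) : x \in `]0, t[ -> 0 <= derive1 h x.
    rewrite in_itv/= => /andP[x0 xt]; rewrite derive1E.
    have [_ ->] := hd x x0 (lt_trans xt td); rewrite mulr_ge0//; first exact: H (lt_trans xt td).
    rewrite expand// mulr_ge0// ?divr_ge0 ?model_ge0 ?sqr_ge0//.
    have -> : dquad s (x *: e) e = 2 * (x * (s ^+ 2 + (s ^+ 2)^-1)).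
      by rewrite /dquad !mxE /=; move: (s ^+ 2)^-1 => m; ring.
    by rewrite mulr_ge0// mulr_ge0 ?(ltW x0)// addr_ge0 ?invr_ge0 ?sqr_ge0.
  rewrite -[leRHS]/(h t) -[leLHS]h0; apply: (ger0_derive1_le_cc hd1 hd2 hc).
  - by rewrite in_itv/= lexx (ltW t0).
  - by rewrite in_itv/= lexx (ltW t0).
  - exact: ltW.
case: jb => /near_ray[d3 d30 jb]; pose d := Num.min d1 (Num.min d2 d3);
  (have d0 : 0 < d by rewrite !lt_min d10 d20 d30); 
  have dd1 : d <= d1 by rewrite ge_min lexx.
- exists d => // t t0 td; have jbt x : 0 < x -> x < d -> c <= jac A (x *: e) <= C.
    by move=> x0; rewrite !lt_min => /and3P[_ _ xd]; exact: jb.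
  split.
  + rewrite -subr_ge0 -mulNr -[X in 0 <= X + _]mul1r; apply: (mono _ _ d) => // x x0 xd.
    by rewrite mul1r subr_ge0; have /andP[] := jbt x x0 xd.
  + rewrite -subr_ge0 addrC -mulN1r; apply: (mono _ _ d) => // x x0 xd.
    by rewrite mulN1r addrC subr_ge0; have /andP[] := jbt x x0 xd.
  + have /andP[h1 h2] := jbt t t0 td; rewrite ger0_norm//; exact: le_trans (ltW c0) h1.
- have : 0 <= - 1 * g s (W ((d / 2) *: e)) + (- c) * g s ((d / 2) *: e).
    apply: (mono _ _ d) => //; rewrite ?divr_gt0// ?ltr_pdivrMr// ?ltr_pMr ?ltr1n//.
    move=> x x0; rewrite !lt_min => /and3P[_ _ xd].
    by rewrite mulN1r -opprD oppr_ge0 -[c]opprK subr_le0; have /andP[] := jb x x0 xd.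
  have d2' : 0 < d / 2 by rewrite divr_gt0.
  have p0 := model_gt0 s (ray_neq0 d2').
  have f0 : 0 < g s (W ((d / 2) *: e)).
    apply: model_gt0; rewrite twist_eq0; apply: HA => //; last exact: ray_neq0.
    apply: (@lt_le_trans _ _ d); first by rewrite ltr_pdivrMr// ltr_pMr ?ltr1n.
    by rewrite /d !ge_min lexx orbT.
  rewrite mulN1r mulNr -opprD oppr_ge0 => /(lt_le_trans (addr_gt0 f0 (mulr_gt0 c0 p0))).
  by rewrite ltxx.
Qed.

(** Since [g s] is the exponential of minus a reciprocal, a bounded quotient of values is a bounded
    difference of the reciprocals of [quad s]. Multiplying by [quad s (t *: e)], which tends to 0,
    shows that the quotient of the quadratic forms tends to 1. Once the exponential factors are
    divided out of [pullback], the differentials of the quadratic forms are comparable too. *)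
Let ratio (s : R) : s = 2 \/ s = 2^-1 -> exists2 C : R, 0 < C &
  exists2 d : R, 0 < d & forall t, 0 < t -> t < d ->
    [/\ 33 * quad s (W (t *: e)) <= 34 * quad s (t *: e),
      34 * quad s (t *: e) <= 35 * quad s (W (t *: e)) &
      forall v, `|dquad s (W (t *: e)) ('D_v W (t *: e))| <= C * (t * `|v|)].
Proof.
move=> sE; have s0 := s_neq0 sE.
have [c [C [c0 C0 [d d0 cmp]]]] := compare sE.
have [d1 d10 Hpull] := near_ray (pullback sE).
have [d2 d20 HA] := near_ray near_A_neq0.
have [d3 d30 HdA] := near_ray Ad.1.1.
pose K := Num.max `|ln c| `|ln C|.
have K0 : 0 <= K by rewrite le_max normr_ge0.
have Qe (t : R) : quad s (t *: e) = 17 / 4 * t ^+ 2.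
  by rewrite /quad !mxE /= !mulr1; case: sE => ->; field.
(* Product of the bounds [C] for the Jacobian, [c^-1] for the quotient of the values of [g s], 2 for
   the squared quotient of the quadratic forms, and [17 / 2] for the differential of [quad s] on the
   ray. *)
exists (17 * C / c); first by rewrite divr_gt0// mulr_gt0.
have K1 : 0 < K + 1 by apply: ltr_wpDl.
(* The 200 exceeds [34 * 17 / 4], so that [34 * K * quad s (t *: e) <= 1] for these [t]; this is
   what produces the ratios 33/34 and 34/35. *)
exists (Num.min (Num.min d d1) (Num.min (Num.min d2 d3) (Num.min 1 (200 * (K + 1))^-1))).
  by rewrite !lt_min d0 d10 d20 d30 ltr01 invr_gt0 mulr_gt0.
move=> t t0; rewrite !lt_min -!andbA => /and5P[td td1 td2 td3 /andP[t1 tK]].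
have u0 := ray_neq0 t0.
have [cp Cp jC] := cmp t t0 td.
have [dF DF] := Hpull t t0 td1 u0.
have Au0 := HA t t0 td2 u0.
have dA := HdA t t0 td3.
have W0 : W (t *: e) != 0 by rewrite twist_eq0.
have dW : differentiable W (t *: e) by apply: (differentiable_comp dA); exact: tau_diff.
have Q0 := quad_gt0 s0 u0; have Y0 := quad_gt0 s0 W0.
have p0 := model_gt0 s u0; have f0 := model_gt0 s W0.
(* The identity of [pullback] with both derivatives of [g s] written out and solved for the
   differential of [quad s] at the image point. *)
have expand2 v : dquad s (W (t *: e)) ('D_v W (t *: e)) =
    jac A (t *: e) * (g s (t *: e) / g s (W (t *: e))) *
    (quad s (W (t *: e)) / quad s (t *: e)) ^+ 2 * dquad s (t *: e) v.
  have dg : differentiable (g s) (W (t *: e)) by exact: C1_at_diff (model_C1_at s0 W0).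
  have := DF v; rewrite [LHS](derive_comp v dW dg) -(deriveE _ dg) /g !derive_model//.
  set z := dquad s (W _) _; set j := jac _ _; set x := dquad _ _ v.
  move: (lt0r_neq0 Q0) (lt0r_neq0 Y0) (lt0r_neq0 p0) (lt0r_neq0 f0).
  move: (quad _ _) (quad _ _) (model_hamiltonian _ _) (model_hamiltonian _ _) z j x.
  move=> Y Q f p z j x nQ nY np nf E.
  have -> : z = (f / Y ^+ 2 * z) * (Y ^+ 2 / f) by field; rewrite nf nY.
  by rewrite E; field; rewrite nf nQ.
have R1 : `|(quad s (t *: e))^-1 - (quad s (W (t *: e)))^-1| <= K.
  move: cp Cp; rewrite /g !modelE// -[X in X * _ <= _](lnK c0) -[X in _ <= X * _](lnK C0).
  rewrite -!expRD !ler_expR => h1 h2; rewrite ler_norml /K.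
  have := ler_norm (ln C); have := ler_norm (- ln c); rewrite normrN => h3 h4.
  have h5 : `|ln c| <= Num.max `|ln c| `|ln C| by rewrite le_max lexx.
  have h6 : `|ln C| <= Num.max `|ln c| `|ln C| by rewrite le_max lexx orbT.
  by apply/andP; split; lra.
have KQ : 34 * (K * quad s (t *: e)) <= 1.
  rewrite Qe; have t2 : t ^+ 2 <= t by rewrite expr2 ler_piMl// ltW.
  have tK' : t * (200 * (K + 1)) <= 1.
    by rewrite -ler_pdivlMr ?mulr_gt0// mul1r ltW.
  have := ler_wpM2l K0 t2; move: (t ^+ 2) tK' t0 => y; lra.
have [R2 R3] : 33 * quad s (W (t *: e)) <= 34 * quad s (t *: e) /\
    34 * quad s (t *: e) <= 35 * quad s (W (t *: e)).
  move: R1 KQ Q0 Y0; move: (quad s (t *: e)) (quad s (W (t *: e))) => Q Y + KQ Q0 Y0.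
  rewrite -(ler_pM2r Q0) -[X in _ * X <= _](gtr0_norm Q0) -normrM.
  have -> : (Q^-1 - Y^-1) * Q = 1 - Q / Y.
    by rewrite mulrBl mulVf ?gt_eqF// mulrC.
  move=> h; have {}h : `|1 - Q / Y| <= 34^-1.
    by apply: le_trans h _; rewrite -[leRHS]mul1r ler_pdivlMr// mulrC.
  move: h; rewrite ler_norml => /andP[h1 h2].
  have E : Q = Q / Y * Y by rewrite divfK ?gt_eqF.
  by rewrite E; split; move: (Q / Y) h1 h2 => x h1 h2; nra.
have normM4 (x1 x2 x3 x4 : R) : `|x1 * x2 * x3 * x4| = `|x1| * `|x2| * `|x3| * `|x4|.
  by rewrite !normrM.
split=> // v; rewrite expand2 normM4.
have B1 : `|dquad s (t *: e) v| <= 17 / 2 * (t * `|v|).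
  have -> : dquad s (t *: e) v = 2 * (t * (s ^+ 2 * v 0 0 + (s ^+ 2)^-1 * v 0 1)).
    by rewrite /dquad !mxE /=; move: (s ^+ 2)^-1 => m; ring.
  rewrite !normrM (gtr0_norm t0) (gtr0_norm (_ : 0 < 2))//.
  have -> : 17 / 2 * (t * `|v|) = 2 * (t * (17 / 4 * `|v|)) by field.
  rewrite ler_pM2l// ler_pM2l//; have := coord_le v 0; have := coord_le v 1.
  have [[-> ->]|[-> ->]] : (s ^+ 2 = 4 /\ (s ^+ 2)^-1 = 4^-1) \/ (s ^+ 2 = 4^-1 /\ (s ^+ 2)^-1 = 4).
  - by case: sE => ->; [left|right]; split; field.
  - move=> h1 h0; apply: le_trans (ler_normD _ _) _; rewrite !normrM.
    rewrite (ger0_norm (_ : 0 <= 4)) ?invr_ge0// (ger0_norm (_ : 0 <= 4^-1)) ?invr_ge0//.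
    by move: h0 h1; move: `|v| `|v 0 0| `|v 0 1| => x y z; lra.
  - move=> h1 h0; apply: le_trans (ler_normD _ _) _; rewrite !normrM.
    rewrite (ger0_norm (_ : 0 <= 4)) ?invr_ge0// (ger0_norm (_ : 0 <= 4^-1)) ?invr_ge0//.
    by move: h0 h1; move: `|v| `|v 0 0| `|v 0 1| => x y z; lra.
have B2 : `|g s (t *: e) / g s (W (t *: e))| <= c^-1.
  rewrite ger0_norm ?divr_ge0 ?model_ge0// ler_pdivrMr//.
  by rewrite -(ler_pM2l c0) mulrA divff ?gt_eqF// mul1r.
have B3 : `|(quad s (W (t *: e)) / quad s (t *: e)) ^+ 2| <= 2.
  rewrite ger0_norm ?sqr_ge0//.
  have : quad s (W (t *: e)) / quad s (t *: e) <= 34 / 33.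
    by rewrite ler_pdivrMr// mulrAC ler_pdivlMr// mulrC.
  have : 0 <= quad s (W (t *: e)) / quad s (t *: e) by rewrite divr_ge0// ltW.
  by move: (_ / quad _ _) => x; nra.
have -> : 17 * C / c * (t * `|v|) = C * c^-1 * 2 * (17 / 2 * (t * `|v|)) by field; rewrite gt_eqF.
by rewrite !ler_pM// ?mulr_ge0// ?invr_ge0 ?(ltW c0) ?(ltW C0).
Qed.

Let A_bounds : exists M : R, 0 < M /\ \forall u \near (0 : plane R),
  [/\ `|jac A u|^-1 <= M, jac A u != 0, `|'D_(vec2 1 0) A u| <= M & `|'D_(vec2 0 1) A u| <= M].
Proof.
have j0 := jac_neq0 Ad; have cj := jac_continuous Ad.1.
have nb v : exists2 m : R, 0 < m & \forall u \near (0 : plane R), `|'D_v A u| <= m.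
  have c : {for 0, continuous (fun u => `|'D_v A u|)}.
    exact: (continuous_cvg _ (@norm_continuous _ _ _) (Ad.1.2 v)).
  have h : `|'D_v A 0| < `|'D_v A 0| + 1 by rewrite ltrDl.
  exists (`|'D_v A 0| + 1); first by apply: ltr_wpDl.
  have H : \forall u \near (0 : plane R), `|'D_v A u| < `|'D_v A 0| + 1 := c _ (lt_nbhsl h).
  by apply: filterS H => u /ltW.
have [m m_gt0 nj] : exists2 m : R, 0 < m &
    \forall u \near (0 : plane R), `|jac A u|^-1 <= m /\ jac A u != 0.
  have c : {for 0, continuous (fun u => `|jac A u|)}.
    exact: (continuous_cvg _ (@norm_continuous _ _ _) cj).
  have j00 : 0 < `|jac A 0| / 2 by rewrite divr_gt0// normr_gt0.
  have h : `|jac A 0| / 2 < `|jac A 0| by rewrite ltr_pdivrMr// ltr_pMr ?normr_gt0// ltr1n.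
  have inv_le_inv (x y : R) : 0 < x -> x < y -> y^-1 <= x^-1.
    by move=> x0 xy; rewrite lef_pV2 ?posrE ?(ltW xy) ?(lt_trans x0 xy).
  exists (`|jac A 0| / 2)^-1; first by rewrite invr_gt0.
  have H : \forall u \near (0 : plane R), `|jac A 0| / 2 < `|jac A u| := c _ (lt_nbhsr h).
  apply: filterS H => u hu; have ju := lt_trans j00 hu; split.
    exact: inv_le_inv j00 hu.
  by rewrite -normr_gt0.
have [m1 m10 H1] := nb (vec2 1 0); have [m2 m20 H2] := nb (vec2 0 1).
exists (m + m1 + m2); split; first by rewrite !addr_gt0.
apply: filterS3 nj H1 H2 => u [h1 h2] h3 h4; split=> //.
- by apply: (le_trans h1); rewrite -addrA lerDl addr_ge0// ltW.
- by apply: (le_trans h3); rewrite addrAC lerDr addr_ge0// ltW.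
- by apply: (le_trans h4); rewrite lerDr addr_ge0// ltW.
Qed.

(** With [x = W (t *: e)] and [z] the derivative of the inverse twist at [w = A (t *: e)] in the
    radial direction [w], the estimates of [ratio] for both values of [s] bound the products of the
    coordinates of [x] and [z]. The coordinates of [x] are at least [t / 2] in absolute value, so
    [z] is bounded by a multiple of [w], and [sqnorm_derive_twist] reads off [r * rho' r]. *)
Let ray_bound : exists C d : R, 0 < d /\ forall t, 0 < t -> t < d ->
  let r := enorm (A (t *: e)) / a in 0 < r /\ `|r * derive1 rho r| <= C.
Proof.
have [M [M0 /near_ray[d1 d10 HM]]] := A_bounds.
have [C C0 [d2 d20 H2]] := ratio (or_introl erefl).
have [C' C'0 [d3 d30 H3]] := ratio (or_intror erefl).
have [d4 d40 HA] := near_ray near_A_neq0.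
have [d5 d50 HdA] := near_ray Ad.1.1.
pose K := C + C'.
(* Three factors 2: from dividing by [t / 2], from Cramer's rule in [vM], and from [one_sqr_le]. *)
exists (8 * (K * (M * M))), (Num.min (Num.min d1 d2) (Num.min (Num.min d3 d4) d5)).
split; first by rewrite !lt_min d10 d20 d30 d40.
move=> t t0; rewrite !lt_min -!andbA => /and5P[td1 td2 td3 td4 td5] r.
have u0 := ray_neq0 t0.
have [jM j0 M1 M2] := HM t t0 td1.
have [R1 R2 R3] := H2 t t0 td2.
have [R1' R2' R3'] := H3 t t0 td3.
have Au0 := HA t t0 td4 u0.
have dA := HdA t t0 td5.
have r0 : 0 < r by rewrite divr_gt0// enorm_gt0.
split=> //.
set w := A (t *: e) in Au0 r r0 *.
set A1 := 'D_(vec2 1 0) A (t *: e) in M1; set A2 := 'D_(vec2 0 1) A (t *: e) in M2.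
have jE : jac A (t *: e) = det2 A1 A2 by [].
set j := jac A (t *: e) in jM j0 jE.
(* The preimage of the radial vector [w] under the differential of [A], by Cramer's rule.
   Differentiating [W] along [v] then differentiates the inverse twist radially. *)
pose v : plane R := vec2 (det2 w A2 / j) (det2 A1 w / j).
have dAv : 'D_v A (t *: e) = w.
  by rewrite derive_plane// vec2E0 vec2E1; exact: cramer.
have vM : `|v| <= 2 * (M * M) * `|w|.
  have B : 0 <= 2 * (M * M) * `|w| by rewrite !mulr_ge0// ltW.
  have E : 2 * (M * M) * `|w| = 2 * (M * `|w|) * M by ring.
  have h1 : `|det2 w A2| <= 2 * (M * `|w|) by rewrite det2C normrN; exact: (det2_le w M2).
  have h2 : `|det2 A1 w| <= 2 * (M * `|w|) := det2_le w M1.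
  by apply: plane_norm_le => //; rewrite /v ?vec2E0 ?vec2E1 E normrM normfV; apply: ler_pM; rewrite ?invr_ge0.
have W0 : W (t *: e) = tau w by [].
pose z := 'D_w tau w.
have zE : 'D_v W (t *: e) = z.
  by rewrite /z -[X in 'D_X tau _]dAv (derive_comp v dA (tau_diff Au0)) (deriveE _ (tau_diff Au0)).
have Qe (s : R) : s = 2 \/ s = 2^-1 -> quad s (t *: e) = 17 / 4 * t ^+ 2.
  by move=> sE; rewrite /quad !mxE /= !mulr1; case: sE => ->; field.
rewrite Qe in R1 R2; last by left.
rewrite Qe in R1' R2'; last by right.
move: (R3 v) (R3' v); rewrite zE => {R3 R3'}.
set x := W (t *: e) in R1 R2 R1' R2' * => B1 B2.
have q2 : quad 2 x = 4 * x 0 0 ^+ 2 + x 0 1 ^+ 2 / 4 by rewrite /quad; field.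
have qh : quad 2^-1 x = x 0 0 ^+ 2 / 4 + 4 * x 0 1 ^+ 2 by rewrite /quad; field.
have x2 : (t / 2) ^+ 2 <= x 0 0 ^+ 2 /\ (t / 2) ^+ 2 <= x 0 1 ^+ 2.
  rewrite q2 in R1 R2; rewrite qh in R1' R2'.
  have -> : (t / 2) ^+ 2 = t ^+ 2 / 4 by field.
  exact: ellipses_lower (sqr_ge0 t) R1 R2 R1' R2'.
have lowx j' : (t / 2) ^+ 2 <= x 0 j' ^+ 2 -> t / 2 <= `|x 0 j'|.
  rewrite -[x 0 j' ^+ 2]real_normK ?num_real// ler_pXn2r ?nnegrE// divr_ge0// ltW//.
have e2 : dquad 2 x z = 8 * (x 0 0 * z 0 0) + x 0 1 * z 0 1 / 2 by rewrite /dquad; field.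
have eh : dquad 2^-1 x z = x 0 0 * z 0 0 / 2 + 8 * (x 0 1 * z 0 1) by rewrite /dquad; field.
have zz : `|x 0 0 * z 0 0| <= K * (t * `|v|) /\ `|x 0 1 * z 0 1| <= K * (t * `|v|).
  have p1 : 0 <= C * (t * `|v|) by rewrite !mulr_ge0// ltW.
  have p2 : 0 <= C' * (t * `|v|) by rewrite !mulr_ge0// ltW.
  by rewrite e2 in B1; rewrite eh in B2; rewrite mulrDl; exact: ellipses_upper.
have zle j' : t / 2 <= `|x 0 j'| -> `|x 0 j' * z 0 j'| <= K * (t * `|v|) -> `|z 0 j'| <= 2 * K * `|v|.
  move=> tx; rewrite normrM => h.
  have : t / 2 * `|z 0 j'| <= K * (t * `|v|) by apply: le_trans h; rewrite ler_wpM2r.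
  have -> : K * (t * `|v|) = t / 2 * (2 * K * `|v|) by field.
  by rewrite ler_pM2l// divr_gt0.
have K0 : 0 <= K by rewrite addr_ge0// ltW.
have zM : `|z| <= 4 * (K * (M * M)) * `|w|.
  apply: (@le_trans _ _ (2 * K * `|v|)).
    apply: plane_norm_le; first by rewrite !mulr_ge0.
      exact: (zle 0 (lowx 0 x2.1) zz.1).
    exact: (zle 1 (lowx 1 x2.2) zz.2).
  have -> : 4 * (K * (M * M)) * `|w| = 2 * K * (2 * (M * M) * `|w|) by ring.
  by apply: ler_wpM2l => //; rewrite mulr_ge0.
have rhoNC1 (x0 : R) : 0 < x0 -> C1_at ((fun y => - rho y) : R^o -> R^o) x0.
  by move=> x00; apply: C1_at_opp; exact: rhoC1.
have sq := @sqnorm_derive_twist R a _ a_gt0 rhoNC1 w Au0.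
have dN : derive1 (fun y => - rho y) (enorm w / a) = - derive1 rho (enorm w / a).
  rewrite !derive1E; apply: deriveN; apply/derivable1_diffP.
  exact: C1_at_diff (rhoC1 r0).
rewrite dN -/r -/z mulrN sqrrN in sq.
have w0 : 0 < sqnorm w by rewrite sqnorm_gt0.
have L0 : 0 <= 4 * (K * (M * M)) by rewrite !mulr_ge0// ltW.
have := sqnorm_le (le_trans zM (ler_wpM2l L0 (norm_le_enorm w))).
rewrite sq => /(one_sqr_le L0 w0 (enorm_sqr w)).
by rewrite mulrA -natrM.
Qed.

(** By the intermediate value theorem the radii of the points [A (t *: e)] fill an interval starting
    at 0, and [r * rho' r] depends on the radius alone; the bound on a single ray thus holds for all
    small radii. On the remaining radii up to 1 it holds by compactness. *)
Theorem twist_lipschitz_of_return : [lipschitz twist a rho u | u in edisk a].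
Proof.
have [C [d [d0 Cb]]] := ray_bound.
have [d1 d10 HdA] := near_ray Ad.1.1.
pose m := Num.min d d1; have m0 : 0 < m by rewrite lt_min d0 d10.
have m2 : 0 < m / 2 by rewrite divr_gt0.
have mm : m / 2 < m by rewrite ltr_pdivrMr// ltr_pMr// ltr1n.
pose h (t : R) : R := enorm (A (t *: e)) / a.
have h0 : h 0 = 0 by rewrite /h scale0r A0 enorm0 mul0r.
have hc : {within `[0, m / 2], continuous h}.
  apply: continuous_in_subspaceT => t; rewrite inE/= in_itv/= => /andP[t0 tm].
  have cA : {for t *: e, continuous A}.
    have [->|tn0] := eqVneq t 0; first by rewrite scale0r; exact: C1_at_continuous Ad.1.
    apply: differentiable_continuous; apply: HdA; first by rewrite lt_neqAle eq_sym tn0.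
    by apply: le_lt_trans tm _; apply: lt_le_trans mm _; rewrite ge_min lexx orbT.
  have cl : {for t, continuous (fun t : R => t *: e)} by apply: cvgZr_tmp; exact: cvg_id.
  have cE := continuous_cvg _ (@enorm_continuous R _) (continuous_cvg _ cA cl).
  exact: (cvgM (cE _ _) (cvg_cst a^-1)).
have md : m / 2 < d by apply: lt_le_trans mm _; rewrite ge_min lexx.
have [hm0 _] := Cb _ m2 md; rewrite -/(h (m / 2)) in hm0.
have small r : 0 < r -> r <= h (m / 2) -> `|r * derive1 rho r| <= C.
  move=> r0 rh.
  have [t /[!in_itv]/= /andP[t0 tm] ht] : exists2 t, t \in `[0, m / 2] & h t = r.
    by apply: (IVT (ltW m2) hc); rewrite h0 (min_idPl (ltW hm0)) (max_idPr (ltW hm0)) ltW.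
  have tn0 : t != 0 by apply: contraTneq r0 => t00; rewrite -ht t00 h0 ltxx.
  have tp : 0 < t by rewrite lt_neqAle eq_sym tn0.
  by have [_] := Cb t tp (le_lt_trans tm md); rewrite -/(h t) ht.
have [C' large] : exists C', forall r, h (m / 2) <= r -> r <= 1 -> `|r * derive1 rho r| <= C'.
  have [h1|h1] := leP (h (m / 2)) 1; last first.
    by exists 0 => r hr r1; move: (lt_le_trans h1 hr); rewrite ltNge r1.
  have c : {within `[h (m / 2), 1], continuous (fun r : R => `|r * derive1 rho r|)}.
    apply: continuous_in_subspaceT => r; rewrite inE/= in_itv/= => /andP[r0 _].
    have cr : {for r, continuous (derive1 rho)}.
      have -> : derive1 rho = 'D_1 rho by apply/funext => y; rewrite derive1E.
      exact: (rhoC1 (lt_le_trans hm0 r0)).2.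
    exact: (continuous_cvg _ (@norm_continuous _ _ _) (cvgM cvg_id cr)).
  have [r _ Hr] := EVT_max h1 c.
  by exists (`|r * derive1 rho r|) => x hx x1; apply: Hr; rewrite in_itv/= hx x1.
apply: (@twist_lipschitz R a rho a_gt0 rhoC1 (Num.max C C')) => r r0 r1.
rewrite le_max; case: (leP r (h (m / 2))) => [/(small r r0) ->//|/ltW hr].
by rewrite (large r hr r1) orbT.
Qed.

End Ray.

(** * Accumulation of the orbit of the center *)

Section Curves.
Context {R : realType}.
Implicit Types (u v w : plane R).

Lemma norm_increment_le (f df : R -> R) (a b C : R) : a <= b ->
  (forall t, a < t -> t < b -> is_derive t 1 f (df t) /\ `|df t| <= C) ->
  {within `[a, b], continuous f} -> `|f b - f a| <= C * (b - a).
Proof.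
move=> ab fd fc.
have [->|anb] := eqVneq a b; first by rewrite !subrr normr0 mulr0.
have altb : a < b by rewrite lt_neqAle anb.
have d t : t \in `]a, b[ -> is_derive t 1 f (df t).
  by rewrite in_itv/= => /andP[h1 h2]; have [] := fd t h1 h2.
have [t /[!in_itv]/= /andP[h1 h2] ->] := MVT altb d fc.
by rewrite normrM (ger0_norm (_ : 0 <= b - a)) ?subr_ge0// ler_wpM2r ?subr_ge0//; have [] := fd t h1 h2.
Qed.

(** Mean value inequality on the segment, which stays in the ball by convexity. The factor 2 adds
    the contributions of the two partial derivatives. *)
Lemma lipschitz_ball (f : plane R -> R^o) (z : plane R) (r C : R) :
  (forall u, ball z r u -> differentiable f u /\
     `|'D_(vec2 1 0) f u| <= C /\ `|'D_(vec2 0 1) f u| <= C) ->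
  forall p q, ball z r p -> ball z r q -> `|f p - f q| <= 2 * C * `|p - q|.
Proof.
move=> H p q zp zq.
pose g (x : R) : R := f (x *: (p - q) + q).
have seg (x : R) : 0 <= x -> x <= 1 -> ball z r (x *: (p - q) + q).
  move=> x0 x1; rewrite -ball_normE /= in zp zq *.
  have -> : z - (x *: (p - q) + q) = x *: (z - p) + (1 - x) *: (z - q).
    by rewrite scalerBr !scalerBl !scale1r; apply: plane_eq; rewrite !mxE; ring.
  apply: le_lt_trans (ler_normD _ _) _; rewrite !normrZ ger0_norm// ger0_norm ?subr_ge0//.
  have -> : r = x * r + (1 - x) * r by ring.
  have [->|xn0] := eqVneq x 0; first by rewrite !mul0r subr0 !mul1r !add0r.
  apply: ltr_leD; first by rewrite ltr_pM2l// lt_neqAle eq_sym xn0.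
  by rewrite ler_wpM2l ?subr_ge0// ltW.
have dg (x : R) : 0 <= x -> x <= 1 ->
    is_derive x 1 g ('D_(p - q) f (x *: (p - q) + q)).
  by move=> x0 x1; apply: is_derive_line; have [] := H _ (seg x x0 x1).
have := @norm_increment_le g (fun x => 'D_(p - q) f (x *: (p - q) + q)) 0 1 (2 * C * `|p - q|) ler01.
rewrite /g scale1r subrK scale0r add0r subr0 mulr1; apply.
  move=> x /ltW x0 /ltW x1; split; first exact: dg.
  have [d [c0 c1]] := H _ (seg x x0 x1); rewrite derive_plane//.
  apply: le_trans (ler_normD _ _) _; rewrite !normrZ.
  have -> : 2 * C * `|p - q| = `|p - q| * C + `|p - q| * C by ring.
  by apply: lerD; apply: ler_pM => //; exact: coord_le.
apply: continuous_in_subspaceT => x; rewrite inE/= in_itv/= => /andP[x0 x1].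
by have [d _] := dg x x0 x1; apply: differentiable_continuous; exact/derivable1_diffP.
Qed.

Lemma within_continuous_coord (x : R -> plane R) (A : set R) i :
  {within A, continuous x} -> {within A, continuous (fun t => x t 0 i)}.
Proof.
move=> xc t; exact: (@continuous_cvg _ _ _ _ _ _ (fun M : plane R => M 0 i) _ (@coord_continuous _ _ _ _ _ _) (xc t)).
Qed.

(* A Gronwall estimate on a time interval so short that the supremum of [|x - y|] absorbs its own contribution. *)
Lemma short_time_bound (x V : R -> plane R) (y : plane R) (a b d : R) :
  a <= b -> 0 <= d -> d * (b - a) <= 2^-1 ->
  {within `[a, b], continuous x} ->
  (forall t, a < t -> t < b -> (forall i, is_derive t 1 (fun s => x s 0 i) (V t 0 i)) /\
     `|V t| <= d * `|x t - y|) ->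
  forall t, a <= t -> t <= b -> `|x t - y| <= 2 * `|x a - y|.
Proof.
move=> ab d0 dab xc xV.
have nc : {within `[a, b], continuous (fun t => `|x t - y|)}.
  move=> t; apply: (@continuous_cvg _ _ _ _ _ _ (fun u : plane R => `|u|)); first exact: norm_continuous.
  by apply: cvgB; [exact: xc|exact: cvg_cst].
have [m /[!in_itv]/= /andP[am mb] mM] := EVT_max ab nc.
have mM' t : a <= t -> t <= b -> `|x t - y| <= `|x m - y|.
  by move=> h1 h2; apply: mM; rewrite in_itv/= h1 h2.
have coord i : `|x m 0 i - x a 0 i| <= d * `|x m - y| * (m - a).
  apply: (@norm_increment_le (fun s => x s 0 i) (fun t => V t 0 i)) => //.
    move=> t at_ tm; have [dV Vd] := xV t at_ (lt_le_trans tm mb).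
    split=> //; apply: le_trans (coord_le _ _) _; apply: le_trans Vd _.
    by rewrite ler_wpM2l// mM'// ltW//; exact: lt_le_trans tm mb.
  by apply: within_continuous_coord; apply: continuous_subspaceW xc => t /=; rewrite !in_itv/=;
    move=> /andP[-> tm]; exact: le_trans tm mb.
have key : `|x m - y| <= 2 * `|x a - y|.
  have B : d * `|x m - y| * (m - a) <= 2^-1 * `|x m - y|.
    rewrite mulrAC ler_wpM2r//; apply: le_trans dab.
    by rewrite ler_wpM2l// lerB.
  have B0 : 0 <= 2^-1 * `|x m - y| by rewrite mulr_ge0.
  have H : `|x m - x a| <= 2^-1 * `|x m - y|.
    by apply: plane_norm_le => //; rewrite !mxE; apply: le_trans B.
  have := ler_normD (x m - x a) (x a - y); rewrite subrKA.
  by move: H; move: `|x m - x a| `|x m - y| `|x a - y| => p q r; lra.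
by move=> t at_ tb; apply: le_trans (mM' t at_ tb) key.
Qed.

(** The exit time is the infimum of the times spent outside [U]. Openness of [U] and continuity show
    that the infimum is attained, and it differs from [a] because [x a] lies in [U]. *)
Lemma first_exit (T : topologicalType) (x : R -> T) (U : set T) (a b : R) :
  a <= b -> {within `[a, b], continuous x} -> open U -> U (x a) ->
  (forall t, a <= t -> t <= b -> U (x t)) \/
  exists t, [/\ a < t, t <= b, ~ U (x t) & forall s, a <= s -> s < t -> U (x s)].
Proof.
move=> ab xc oU Ua.
have [H|] := pselect (forall t, a <= t -> t <= b -> U (x t)); [by left|move=> nH; right].
pose S := [set t | [/\ a <= t, t <= b & ~ U (x t)]].
have S0 : S !=set0.
  by move: nH => /existsNP[t /not_implyP[h1 /not_implyP[h2 h3]]]; exists t.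
have Slb : lbound S a by move=> t [].
have hS : has_inf S by split=> //; exists a.
pose m := inf S.
have am : a <= m by exact: lb_le_inf.
have inf_le t : a <= t -> t <= b -> ~ U (x t) -> m <= t.
  by move=> h1 h2 h3; apply: (ge_inf hS.2); split.
have mb : m <= b by case: S0 => t [h1 h2 h3]; exact: le_trans (inf_le t h1 h2 h3) h2.
have before t : a <= t -> t < m -> U (x t).
  move=> h1 h2; apply: contrapT => nU; have := h2; rewrite ltNge => /negP; apply.
  by exact: inf_le h1 (ltW (lt_le_trans h2 mb)) nU.
have cm t : a <= t -> t <= b -> U (x t) -> exists2 e : R, 0 < e &
    forall s, a <= s -> s <= b -> `|t - s| < e -> U (x s).
  move=> h1 h2 Ut.
  have tab : `[a, b]%classic t by rewrite /= in_itv/= h1 h2.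
  have /subspace_continuousP/(_ _ tab)/(_ _ (open_nbhs_nbhs (conj oU Ut))) := xc.
  move=> /nbhs_ballP[e /= e0 He]; exists e => // s s1 s2 ts.
  by apply: (He s); rewrite -?ball_normE //= in_itv/= s1 s2.
have nUm : ~ U (x m).
  move=> Um; have [e e0 He] := cm m am mb Um.
  have : m + e <= m.
    apply: lb_le_inf => // t [h1 h2 h3]; rewrite leNgt; apply/negP => tm.
    have mt := inf_le t h1 h2 h3; apply: h3.
    by apply: He => //; rewrite distrC ger0_norm ?subr_ge0// ltrBlDr addrC.
  by rewrite gerDl leNgt e0.
exists m; split=> //; rewrite lt_neqAle am andbT.
by apply/eqP => amE; apply: nUm; rewrite -amE.
Qed.

End Curves.

(** * Short periodic orbits *)

Section PeriodicOrbit.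
Context {R : realType}.
Implicit Types (u v w : plane R).

(* Yorke's argument: a field with a small Lipschitz constant has no short nonconstant periodic orbit. *)
Lemma short_orbit_constant (X : plane R -> plane R) (B : set (plane R)) (x : R -> plane R) (P d : R) :
  0 < P -> 0 <= d -> d * P < 1 ->
  (forall p q, B p -> B q -> `|X p - X q| <= d * `|p - q|) ->
  (forall t, 0 <= t -> t <= P -> B (x t)) ->
  continuous x ->
  (forall (t : R) i, is_derive t 1 (fun s => x s 0 i) (X (x t) 0 i)) ->
  x P = x 0 -> X (x 0) = 0.
Proof.
move=> P0 d0 dP LX xB xc xX xP.
have xci i : continuous (fun s => x s 0 i).
  by move=> t; have [dx _] := xX t i; apply: differentiable_continuous; exact/derivable1_diffP.
have fc : {within `[0, P], continuous (fun t => `|X (x t)|)}.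
  apply/subspace_continuousP => t; rewrite /= in_itv/= => /andP[t0 tP].
  apply/cvgrPdist_le => e e0.
  have d1 : 0 < d + 1 by apply: ltr_wpDl.
  have /cvgrPdist_le/(_ (e / (d + 1)) (divr_gt0 e0 d1)) := xc t.
  apply: filterS => s h; rewrite /= in_itv/= => /andP[s0 sP].
  apply: le_trans (ler_dist_dist _ _) _; apply: le_trans (LX _ _ (xB _ t0 tP) (xB _ s0 sP)) _.
  by rewrite ler_pdivlMr// in h; apply: le_trans h; rewrite mulrC ler_wpM2l// lerDl.
have [m /[!in_itv]/= /andP[m0 mP] mM] := EVT_max (ltW P0) fc.
have mM' t : 0 <= t -> t <= P -> `|X (x t)| <= `|X (x m)|.
  by move=> h1 h2; apply: mM; rewrite in_itv/= h1 h2.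
have speed i s t : 0 <= s -> s <= t -> t <= P -> `|x t 0 i - x s 0 i| <= `|X (x m)| * P.
  move=> s0 st tP; apply: (@le_trans _ _ (`|X (x m)| * (t - s))).
    apply: (@norm_increment_le _ (fun s => x s 0 i) (fun t => X (x t) 0 i)) => //.
      move=> r sr rt; split; first exact: xX.
      apply: le_trans (coord_le _ _) _; apply: mM'.
        by apply: le_trans s0 _; exact: ltW.
      by apply: le_trans tP; exact: ltW.
    by apply: continuous_subspaceT => r; exact: xci.
  by rewrite ler_wpM2l//; move: s0 tP; lra.
have dist s t : 0 <= s -> s <= P -> 0 <= t -> t <= P -> `|x t - x s| <= `|X (x m)| * P.
  move=> s0 sP t0 tP; have B0 : 0 <= `|X (x m)| * P by rewrite mulr_ge0// ltW.
  have [st|/ltW ts] := leP s t.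
    by apply: plane_norm_le => //; rewrite !mxE; exact: speed.
  by rewrite distrC; apply: plane_norm_le => //; rewrite !mxE; exact: speed.
(* By periodicity and Rolle's theorem each coordinate of the velocity vanishes at some time. The
   Lipschitz bound then compares it with its value at the time [m] of maximal speed, the two
   positions being at most maximal speed times [P] apart. *)
have key i : `|X (x m) 0 i| <= d * P * `|X (x m)|.
  have dx (t : R) : t \in `]0, P[ -> derivable (fun s => x s 0 i) t 1 by move=> _; have [] := xX t i.
  have cx : {within `[0, P], continuous (fun s => x s 0 i)} by apply: continuous_subspaceT; exact: xci.
  have e0 : (fun s => x s 0 i) 0 = (fun s => x s 0 i) P by rewrite /= xP.
  have [c /[!in_itv]/= /andP[/ltW c0 /ltW cP] [_ Dc]] := Rolle P0 dx cx e0.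
  have Xc : X (x c) 0 i = 0 by rewrite -Dc; have [_ ->] := xX c i.
  have -> : X (x m) 0 i = (X (x m) - X (x c)) 0 i by rewrite !mxE Xc subr0.
  apply: le_trans (coord_le _ _) _; apply: le_trans (LX _ _ (xB _ m0 mP) (xB _ c0 cP)) _.
  by rewrite -mulrA ler_wpM2l// mulrC; exact: dist.
have Xm : `|X (x m)| <= d * P * `|X (x m)|.
  by apply: plane_norm_le; rewrite ?mulr_ge0 ?(ltW P0).
have Xm0 : `|X (x m)| = 0.
  apply/eqP; rewrite eq_le normr_ge0 andbT leNgt; apply/negP => Xp.
  by move: Xm; rewrite leNgt => /negP; apply; rewrite -[ltRHS]mul1r ltr_pM2r.
by apply/eqP; rewrite -normr_le0 -[leRHS]Xm0; apply: mM' => //; exact: ltW.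
Qed.

End PeriodicOrbit.

(** * The flow of the model Hamiltonian *)

Section ModelFlow.
Context {R : realType}.
Implicit Types (u v w : plane R).

Lemma ham_model u : u != 0 ->
  ham (model_hamiltonian 2) u =
  model_hamiltonian 2 u / quad 2 u ^+ 2 *: vec2 (u 0 1 / 2) (- (8 * u 0 0)).
Proof.
move=> u0; have n2 : (2 : R) != 0 by rewrite pnatr_eq0.
rewrite /ham !derive_model//; apply: plane_eq; rewrite !mxE /= /dquad !mxE/=.
  by congr (_ * _); field.
by rewrite -mulrN; congr (_ * _); field.
Qed.

(* The circular motion on the ellipse [quad 2 = c], with angular speed [2 m]. *)
Definition model_flow (m : R) v (t : R) : plane R :=
  vec2 (v 0 0 * cos (2 * m * t) + v 0 1 / 4 * sin (2 * m * t))
       (v 0 1 * cos (2 * m * t) - 4 * v 0 0 * sin (2 * m * t)).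

Lemma quad_model_flow m v t : quad 2 (model_flow m v t) = quad 2 v.
Proof.
rewrite /quad /model_flow vec2E0 vec2E1; have := cos2Dsin2 (2 * m * t).
move: (cos _) (sin _) => c s h.
transitivity ((c ^+ 2 + s ^+ 2) * (2 ^+ 2 * v 0 0 ^+ 2 + v 0 1 ^+ 2 / 2 ^+ 2)); last by rewrite h mul1r.
by field.
Qed.

Lemma model_flow0 m v : model_flow m v 0 = v.
Proof.
by rewrite /model_flow mulr0 cos0 sin0; apply: plane_eq; rewrite !mxE /= !mulr1 mulr0 ?addr0 ?subr0.
Qed.

Lemma model_flow_period m v : 0 < m -> model_flow m v (pi / m) = v.
Proof.
move=> m0; rewrite -[RHS](model_flow0 m v) /model_flow mulr0 cos0 sin0.
have -> : 2 * m * (pi / m) = pi + pi by field; rewrite gt_eqF.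
by rewrite -mulr2n cos2pi sin2pi.
Qed.

Lemma model_flow_diff m v (t : R) :
  differentiable (model_flow m v : R^o -> plane R) (t : R^o) /\
  'D_1 (model_flow m v : R^o -> plane R) (t : R^o) =
  m *: vec2 ((model_flow m v t) 0 1 / 2) (- (8 * (model_flow m v t) 0 0)).
Proof.
have dk : is_derive t 1 (fun t : R => 2 * m * t) (2 * m).
  have := is_deriveZ (2 * m) (@is_derive_id R R t 1).
  by move=> [d e]; split; [exact: d|rewrite [LHS]e /GRing.scale/= mulr1].
have dc : is_derive t 1 (fun t : R => cos (2 * m * t)) (- sin (2 * m * t) * (2 * m)).
  exact: (is_derive1_comp (is_derive_cos (2 * m * t)) dk).
have ds : is_derive t 1 (fun t : R => sin (2 * m * t)) (cos (2 * m * t) * (2 * m)).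
  exact: (is_derive1_comp (is_derive_sin (2 * m * t)) dk).
have lin (p q : R) : is_derive t 1 (fun t : R => p * cos (2 * m * t) + q * sin (2 * m * t))
    (p * (- sin (2 * m * t) * (2 * m)) + q * (cos (2 * m * t) * (2 * m))).
  have [d e] := is_deriveD (is_deriveZ p dc) (is_deriveZ q ds).
  by split; [exact: d|rewrite [LHS]e].
have [d0 e0] := lin (v 0 0) (v 0 1 / 4); have [d1 e1] := lin (v 0 1) (- (4 * v 0 0)).
move/derivable1_diffP: d0 => d0; move/derivable1_diffP: d1 => d1.
have [d e] := @vec2_differentiable R R^o _ _ (t : R^o) d0 d1.
have E : (model_flow m v : R^o -> plane R) = fun y : R^o =>
    vec2 (v 0 0 * cos (2 * m * y) + v 0 1 / 4 * sin (2 * m * y))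
         (v 0 1 * cos (2 * m * y) + - (4 * v 0 0) * sin (2 * m * y)).
  by apply/funext => y; rewrite /model_flow mulNr.
rewrite E; split=> //; rewrite deriveE// e.
rewrite -!deriveE// e0 e1.
by apply: plane_eq; rewrite !mxE /=; field.
Qed.

End ModelFlow.

(** * Flatness of the Hamiltonian field at the center *)

Section Flat.
Context {R : realType}.
Implicit Types (u v w : plane R).

Lemma quad2_le u : quad 2 u <= 17 / 4 * `|u| ^+ 2.
Proof.
have h j : u 0 j ^+ 2 <= `|u| ^+ 2.
  by rewrite -[leLHS]real_normK ?num_real// ler_pXn2r ?nnegrE// coord_le.
have -> : quad 2 u = 4 * u 0 0 ^+ 2 + u 0 1 ^+ 2 / 4 by rewrite /quad; field.
by move: (h 0) (h 1); lra.
Qed.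

Lemma ham_model_le u : u != 0 -> `|ham (model_hamiltonian 2) u| <= 918 * `|u| ^+ 3.
Proof.
move=> u0; have q0 : 0 < quad 2 u by rewrite quad_gt0// pnatr_eq0.
(* The exponential is the cube of [expR (- (3 * quad 2 u)^-1)], and that factor is at most
   [3 * quad 2 u]. The cube absorbs the division by [quad 2 u ^+ 2] and leaves one power;
   [918 = 27 * 17 / 4 * 8]. *)
have g3 : model_hamiltonian 2 u <= 27 * quad 2 u ^+ 3.
  rewrite modelE//.
  have -> : - (quad 2 u)^-1 = 3%:R * (- (3 * quad 2 u)^-1) by field; rewrite gt_eqF.
  rewrite expRM_natl.
  have -> : 27 * quad 2 u ^+ 3 = (3 * quad 2 u) ^+ 3 by ring.
  rewrite ler_pXn2r ?nnegrE ?expR_ge0 ?mulr_ge0 ?(ltW q0)// expRN.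
  rewrite -[leRHS]invrK lef_pV2 ?posrE ?invr_gt0 ?expR_gt0 ?mulr_gt0//.
  by apply: le_trans (expR_ge1Dx _); rewrite lerDr.
rewrite ham_model// normrZ ger0_norm ?divr_ge0 ?model_ge0 ?sqr_ge0//.
have m1 : model_hamiltonian 2 u / quad 2 u ^+ 2 <= 459 / 4 * `|u| ^+ 2.
  rewrite ler_pdivrMr ?exprn_gt0//; apply: le_trans g3 _.
  have -> : 27 * quad 2 u ^+ 3 = 27 * quad 2 u * quad 2 u ^+ 2 by ring.
  by rewrite ler_pM2r ?exprn_gt0//; move: (quad2_le u); lra.
have v1 : `|vec2 (u 0 1 / 2) (- (8 * u 0 0))| <= 8 * `|u|.
  apply: plane_norm_le; rewrite ?mulr_ge0// ?vec2E0 ?vec2E1.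
    by rewrite normrM; have := coord_le u 1; rewrite (ger0_norm (_ : 0 <= 2^-1)) ?invr_ge0//; 
      move: (normr_ge0 u); lra.
  by rewrite normrN normrM ger0_norm// ler_wpM2l// coord_le.
have -> : 918 * `|u| ^+ 3 = 459 / 4 * `|u| ^+ 2 * (8 * `|u|) by field.
by apply: ler_pM => //; rewrite divr_ge0 ?model_ge0 ?sqr_ge0.
Qed.

Lemma ham_model_le2 u : u != 0 -> `|u| < 1 ->
  `|ham (model_hamiltonian 2) u| <= 918 * `|u| ^+ 2.
Proof.
move=> u0 u1; apply: le_trans (ham_model_le u0) _.
apply: ler_wpM2l; first by rewrite ler0n.
by rewrite [leLHS]exprS; apply: ler_piMl; [exact: sqr_ge0|exact: ltW].
Qed.

Lemma comb_le u v w (k m0 m1 : R) (x : R) : `|u| <= k * x -> `|v| <= m0 -> `|w| <= m1 ->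
  `|u 0 0 *: v + u 0 1 *: w| <= (m0 + m1) * k * x.
Proof.
move=> hu hv hw; have -> : (m0 + m1) * k * x = k * x * m0 + k * x * m1 by ring.
apply: le_trans (ler_normD _ _) _; rewrite !normrZ.
by apply: lerD; apply: ler_pM => //; apply: le_trans (coord_le _ _) hu.
Qed.

Lemma derive_flat (W : normedModType R) (F : plane R -> W) (M : R) (v : plane R) : F 0 = 0 ->
  (\forall u \near (0 : plane R), `|F u| <= M * `|u| ^+ 2) -> 'D_v F 0 = 0.
Proof.
move=> F0 FM; apply/cvg_lim => //; apply/cvgrPdist_le => e e0.
pose k := `|M| * `|v| ^+ 2 + 1.
have k0 : 0 < k by apply: ltr_wpDl => //; rewrite mulr_ge0// sqr_ge0.
have small : \forall h \near (0 : R)^', `|h| < e / k.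
  by apply: dnbhs0_lt; rewrite divr_gt0.
have FMh : \forall h \near (0 : R)^', `|F (h *: v)| <= M * `|h *: v| ^+ 2.
  have c : (h *: v) @[h --> (0 : R)] --> (0 : plane R).
    by rewrite -[X in _ --> X](scale0r v); apply: cvgZr_tmp; exact: cvg_id.
  have H : \forall h \near (0 : R), `|F (h *: v)| <= M * `|h *: v| ^+ 2 := c _ FM.
  exact: cvg_within H.
have hn0 : \forall h \near (0 : R)^', h != 0 by exact: nbhs_dnbhs_neq.
apply: filterS3 small FMh hn0 => h h1 h2 h3.
rewrite sub0r normrN /= addr0 F0 subr0 normrZ normfV.
have hp : 0 < `|h| by rewrite normr_gt0.
rewrite mulrC ler_pdivrMr//; apply: le_trans h2 _; rewrite normrZ.
rewrite ltr_pdivlMr// in h1.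
apply: (@le_trans _ _ (`|M| * (`|h| * `|v|) ^+ 2)).
  by rewrite ler_wpM2r ?sqr_ge0 ?ler_norm.
have -> : `|M| * (`|h| * `|v|) ^+ 2 = `|h| * (k - 1) * `|h| by rewrite /k; ring.
rewrite ler_wpM2r// ; apply: le_trans (ltW h1).
by rewrite ler_wpM2l// gerBl.
Qed.

(** Near 0 the composite [X \o A] is the image of the flat model field under bounded differentials,
    so its derivative at 0 vanishes. Surjectivity of ['d A 0] passes this on to [X] at [A 0]. *)
Lemma flat_conjugate (X A : plane R -> plane R) :
  loc_diffeo A 0 -> C1_at X (A 0) -> X (A 0) = 0 ->
  (\forall u \near (0 : plane R), u != 0 -> 'd A u (ham (model_hamiltonian 2) u) = X (A u)) ->
  forall v, 'D_v X (A 0) = 0.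
Proof.
move=> Ad CX XA0 conj v.
have nb w : exists2 m : R, 0 <= m & \forall u \near (0 : plane R), `|'D_w A u| <= m.
  have c : {for 0, continuous (fun u => `|'D_w A u|)}.
    exact: (continuous_cvg _ (@norm_continuous _ _ _) (Ad.1.2 w)).
  have h : `|'D_w A 0| < `|'D_w A 0| + 1 by rewrite ltrDl.
  exists (`|'D_w A 0| + 1); first by rewrite addr_ge0.
  have H : \forall u \near (0 : plane R), `|'D_w A u| < `|'D_w A 0| + 1 := c _ (lt_nbhsl h).
  by apply: filterS H => u /ltW.
have [m0 m00 H0] := nb (vec2 1 0); have [m1 m10 H1] := nb (vec2 0 1).
have small : \forall u \near (0 : plane R), `|u| < 1 by exact: nbhs0_lt.
have FM : \forall u \near (0 : plane R), `|(X \o A) u| <= ((m0 + m1) * 918) * `|u| ^+ 2.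
  have H01 := filterI H0 H1; have H2 := filterI Ad.1.1 small.
  apply: filterS3 conj (H01 _) (H2 _) => u cj [h0 h1] [dA u1] /=.
  have B : 0 <= (m0 + m1) * 918 * `|u| ^+ 2 by exact: mulr_ge0 (mulr_ge0 (addr_ge0 m00 m10) (ler0n _ _)) (sqr_ge0 _).
  have [u00|u0] := eqVneq u 0; first by apply: le_trans B; rewrite u00 XA0 normr0.
  rewrite -(cj u0) diff_plane//.
  exact: comb_le (ham_model_le2 u0 u1) h0 h1.
have [w <-] := loc_diffeo_surj v Ad.
have dA := loc_diffeo_diff Ad; have dX := C1_at_diff CX.
have := derive_flat w (XA0 : (X \o A) 0 = 0) FM.
by rewrite derive_comp// (deriveE _ dA) => E; rewrite (deriveE _ dX).
Qed.

End Flat.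

(** * Accumulating flat zeros contradict the bounded periods *)

Section AccumulationPoint.
Context {R : realType}.
Implicit Types (u v w p q : plane R).
Variables (X : plane R -> plane R) (A : nat -> plane R -> plane R) (c : R) (K : set (plane R)).
Hypothesis c_gt0 : 0 < c.
Hypothesis compactK : compact K.
Hypothesis XC1 : forall p, K p -> C1_at X p.
Let y k := A k 0.
Hypothesis yK : forall k, K (y k).
Hypothesis Xy : forall k, X (y k) = 0.
Hypothesis A_diffeo : forall k u, quad 2 u <= c -> loc_diffeo (A k) u.
Hypothesis A_conj : forall k u, quad 2 u <= c -> u != 0 ->
  'd (A k) u (ham (model_hamiltonian 2) u) = X (A k u).
Hypothesis y_outside : forall j k u, (k < j)%N -> quad 2 u < c -> A k u <> y j.

Let quad_continuous : continuous (quad 2 : plane R -> R).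
Proof. by move=> u; exact: C1_at_continuous (quad_C1_at 2 u). Qed.

Let cluster_point : exists2 z, K z &
  forall e : R, 0 < e -> exists k j, [/\ (k < j)%N, ball z e (y k) & ball z e (y j)].
Proof.
have Ky : (y @ \oo) K by exists 0%N => // k _; exact: yK.
have [z [Kz zy]] := @compactK (y @ \oo) _ Ky; exists z => // e e0.
have near_after n : exists2 k, (n <= k)%N & ball z e (y k).
  have Y : (y @ \oo) [set y k | k in [set k | (n <= k)%N]].
    by exists n => // k /= nk; exists k.
  by have [_ [[k /= nk <-] zk]] := zy _ _ Y (nbhsx_ballx z e e0); exists k.
have [k _ zk] := near_after 0%N; have [j kj zj] := near_after k.+1.
by exists k, j.
Qed.

Let derive_X_y k v : 'D_v X (y k) = 0.
Proof.
have q0 : quad 2 (0 : plane R) <= c by rewrite quad0 ltW.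
apply: (flat_conjugate (A_diffeo k q0) (XC1 (yK k)) (Xy k)).
have : \forall u \near (0 : plane R), quad 2 u < c.
  by have := quad_continuous (x := 0); rewrite /continuous_at quad0 => /(_ _ (lt_nbhsl c_gt0)).
by apply: filterS => u /ltW uc u0; exact: A_conj.
Qed.

Let derive_X_limit z v : K z ->
  (forall e : R, 0 < e -> exists k j, [/\ (k < j)%N, ball z e (y k) & ball z e (y j)]) ->
  'D_v X z = 0.
Proof.
move=> Kz zy; apply/eqP; rewrite -normr_le0 leNgt; apply/negP => D0.
have cD : {for z, continuous (fun u => `|'D_v X u|)}.
  exact: (continuous_cvg _ (@norm_continuous _ _ _) ((XC1 Kz).2 v)).
have : \forall u \near z, 0 < `|'D_v X u| := cD _ (lt_nbhsr D0).
move=> /nbhs_ballP[e /= e0 He]; have [k [_ [_ zk _]]] := zy e e0.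
by have := He _ zk; rewrite /= derive_X_y normr0 ltxx.
Qed.

(* The segment leaves the open set [A k {quad 2 < c}], hence meets its boundary, which lies in [A k {quad 2 = c}]. *)
Let boundary k p : (forall u, quad 2 u < c -> A k u <> p) ->
  exists s v, [/\ 0 <= s, s <= 1, quad 2 v = c & A k v = s *: (p - y k) + y k].
Proof.
move=> pout; apply: contrapT => none.
pose L := (fun s : R => s *: (p - y k) + y k) @` `[0, 1].
have Lc : connected L.
  apply: connected_continuous_connected; first exact: segment_connected.
  apply: continuous_subspaceT => s; apply: cvgD; last exact: cvg_cst.
  by apply: cvgZr_tmp; exact: cvg_id.
pose O := A k @` [set u | quad 2 u < c]; pose D := A k @` [set u | quad 2 u <= c].
have oO : open O.
  apply: loc_diffeo_open => [|u /ltW]; last exact: A_diffeo.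
  rewrite (_ : [set u | _] = quad 2 @^-1` [set x | x < c])//.
  by apply: open_comp => [u _|]; [exact: quad_continuous|exact: open_lt].
have cD : closed D.
  apply: compact_closed; first exact: norm_hausdorff.
  apply: continuous_compact.
    by apply: continuous_in_subspaceT => u; rewrite inE/= => uc; exact: C1_at_continuous (A_diffeo k uc).1.
  apply: bounded_closed_compact.
    exists (4 * c + 1); split; first exact: num_real.
    move=> M cM u /= uc; apply: le_trans (ltW cM).
    have [h0 h1] : u 0 0 ^+ 2 <= 4 * c /\ u 0 1 ^+ 2 <= 4 * c.
      have := uc; have -> : quad 2 u = 4 * u 0 0 ^+ 2 + u 0 1 ^+ 2 / 4 by rewrite /quad; field.
      by move: (sqr_ge0 (u 0 0)) (sqr_ge0 (u 0 1)) c_gt0; move: (u 0 0 ^+ 2) (u 0 1 ^+ 2) => a b; split; lra.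
    have sq i : u 0 i ^+ 2 <= 4 * c -> `|u 0 i| <= 4 * c + 1.
      move=> h; rewrite -(@ler_pXn2r _ 2) ?nnegrE ?addr_ge0 ?mulr_ge0 ?(ltW c_gt0)//.
      rewrite real_normK ?num_real//; apply: le_trans h _.
      have : 0 <= 4 * c by rewrite mulr_ge0 ?(ltW c_gt0).
      by move: (4 * c) => b b0; nra.
    by apply: plane_norm_le; [rewrite addr_ge0 ?mulr_ge0 ?(ltW c_gt0)|exact: sq|exact: sq].
  rewrite (_ : [set u | _] = quad 2 @^-1` [set x | x <= c])//.
  by apply: closed_comp => [u _|]; [exact: quad_continuous|exact: closed_le].
(* If the segment avoids the image of the ellipse, it meets the open set [O] exactly where it meets
   the closed set [D]; this part is then open and closed in the connected [L], and it contains
   [y k]. *)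
have LO : L `&` O = L.
  apply: Lc.
  - exists (y k); split; first by exists 0; rewrite ?scale0r ?add0r//= in_itv/= lexx ler01.
    by exists 0 => //=; rewrite quad0.
  - by exists O.
  - exists D => //; apply/seteqP; split=> q [Lq]; first by move=> [u uc Au]; split=> //; exists u => //=; exact: ltW uc.
    move=> [u uc Au]; split=> //; exists u => //=; rewrite lt_neqAle [quad 2 u <= c]uc andbT.
    apply/eqP => uE; apply: none; case: Lq => s; rewrite /= in_itv/= => /andP[s0 s1] sq.
    by exists s, u; rewrite sq.
have : L p by exists 1; rewrite ?scale1r ?subrK//= in_itv/= ler01 lexx.
by rewrite -LO => -[_ [u /pout]].
Qed.

(** Near [z] both partial derivatives are smaller than [d / 2]; the factor 2 of [lipschitz_ball]
    restores [d], one coordinate at a time. *)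
Let coordX_lipschitz z (d : R) : K z -> 0 < d -> (forall v, 'D_v X z = 0) ->
  exists2 r : R, 0 < r & forall p q, ball z r p -> ball z r q -> `|X p - X q| <= d * `|p - q|.
Proof.
move=> Kz d0 DX.
have small v : \forall u \near z, `|'D_v X u| < d / 2.
  have cD : {for z, continuous (fun u => `|'D_v X u|)}.
    exact: (continuous_cvg _ (@norm_continuous _ _ _) ((XC1 Kz).2 v)).
  have h : `|'D_v X z| < d / 2 by rewrite DX normr0 divr_gt0.
  exact: cD _ (lt_nbhsl h).
have : \forall u \near z, [/\ differentiable X u, `|'D_(vec2 1 0) X u| < d / 2 & `|'D_(vec2 0 1) X u| < d / 2].
  by apply: filterS3 (XC1 Kz).1 (small (vec2 1 0)) (small (vec2 0 1)) => u.
move=> /nbhs_ballP[r /= r0 Hr].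
exists r => // p q zp zq.
have comp i : `|X p 0 i - X q 0 i| <= 2 * (d / 2) * `|p - q|.
  apply: (@lipschitz_ball R (fun u => X u 0 i : R^o) z r) => // u /Hr[/= du h1 h2].
  have dXi : differentiable (fun u => X u 0 i : R^o) u.
    by apply: (@differentiable_comp _ _ _ _ X (fun M : plane R => M 0 i : R^o)) => //; exact: differentiable_coord.
  have e v : 'D_v (fun u => X u 0 i : R^o) u = ('D_v X u) 0 i.
    by rewrite derive_mx ?mxE//; exact: diff_derivable.
  have b v : `|'D_v X u| < d / 2 -> `|'D_v (fun u => X u 0 i : R^o) u| <= d / 2.
    by move=> /ltW h; rewrite e; exact: le_trans (coord_le _ _) h.
  by split; [exact: dXi|split; [exact: b h1|exact: b h2]].
have -> : d = 2 * (d / 2) by field.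
apply: plane_norm_le; rewrite ?mulr_ge0 ?divr_ge0 ?(ltW d0)//.
  by have := comp 0; rewrite !mxE.
by have := comp 1; rewrite !mxE.
Qed.

Theorem no_accumulation : False.
Proof.
(* The scalar factor of the model field on the level [quad 2 = c]. There the motion has angular
   speed [2 * m] and period [pi / m], and [d] is chosen so that [d * P = 2^-1] meets the
   requirements of both [short_time_bound] and [short_orbit_constant]. *)
pose m := expR (- c^-1) / c ^+ 2.
have m0 : 0 < m by rewrite divr_gt0 ?expR_gt0 ?exprn_gt0.
pose P := pi / m; have P0 : 0 < P by rewrite divr_gt0 ?pi_gt0.
pose d := (2 * P)^-1; have d0 : 0 < d by rewrite invr_gt0 mulr_gt0.
have dP : d * P = 2^-1 by rewrite /d; field; rewrite gt_eqF.
have [z Kz zy] := cluster_point.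
have [r r0 LX] := coordX_lipschitz Kz d0 (fun v => derive_X_limit v Kz zy).
(* Points within [r / 8] of [z] are less than [r / 4] apart. The orbit starts on the segment between
   them and at most doubles its distance to [y k], so it stays within [r / 2 + r / 8] of [z]. *)
have r8 : 0 < r / 8 by rewrite divr_gt0.
have [k [j [kj zk zj]]] := zy _ r8.
have [s [v [s0 s1 vc Av]]] := @boundary k (y j) (fun u => @y_outside j k u kj).
have vn0 (u : plane R) : quad 2 u = c -> u != 0.
  by move=> uc; apply: contraTneq c_gt0 => u0; rewrite -uc u0 quad0 ltxx.
pose g := model_flow m v; pose x t := A k (g t).
have gc t : quad 2 (g t) = c by rewrite quad_model_flow.
have Xd (t : R) : differentiable (x : R^o -> plane R) (t : R^o) /\ 'D_1 (x : R^o -> plane R) (t : R^o) = X (x t).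
  have [dg Dg] := model_flow_diff m v t.
  have gc' : quad 2 (g t) <= c by rewrite gc.
  have dA := loc_diffeo_diff (A_diffeo k gc').
  split; first exact: (differentiable_comp dg dA).
  have := @derive_comp R R^o (plane R) (plane R) g (A k) (t : R^o) (1 : R^o) dg dA.
  move=> E; rewrite [LHS]E [X in 'd _ _ X]Dg -(A_conj k gc' (vn0 _ (gc t))); congr ('d _ _ _).
  by rewrite ham_model ?vn0// modelE ?vn0// gc.
have xc : continuous x by move=> t; exact: differentiable_continuous (Xd t).1.
have xi (t : R) i : is_derive t 1 (fun s => x s 0 i) (X (x t) 0 i).
  have [dx Dx] := Xd t.
  have dX := @diff_derivable _ _ _ _ _ (1 : R^o) dx.
  split; first by have /derivable_mxP := dX; apply.
  by rewrite -Dx derive_mx ?mxE.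
have near_k t : `|x t - y k| <= r / 2 -> ball z r (x t).
  move=> h; rewrite -ball_normE /= in zk *.
  rewrite -[z - x t](subrKA (y k)) (le_lt_trans (ler_normD _ _))// [`|y k - _|]distrC.
  by move: zk h; lra.
have x0 : `|x 0 - y k| < r / 4.
  rewrite /x /g model_flow0 Av addrK normrZ ger0_norm//.
  apply: (@le_lt_trans _ _ `|y j - y k|); first by rewrite ler_piMl.
  rewrite -ball_normE /= in zk zj.
  rewrite -[y j - y k](subrKA z) (le_lt_trans (ler_normD _ _))// [`|y j - _|]distrC.
  by move: zk zj; lra.
(* The Lipschitz bound is available only inside the ball, so the estimate is run up to the first
   exit time, where it contradicts the exit. The zero [y k] of the field serves as the reference
   point. *)
have stays t : 0 <= t -> t <= P -> ball z r (x t).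
  have xw : {within `[0, P], continuous x} by exact: continuous_subspaceT.
  have bx0 : ball z r (x 0) by apply: near_k; move: x0; lra.
  have [H|[t1 [t10 t1P nb before]]] := first_exit (ltW P0) xw (ball_open z r) bx0; first exact: H.
  case: nb; apply: near_k.
  have h : `|x t1 - y k| <= 2 * `|x 0 - y k|.
    apply: (@short_time_bound R x (X \o x) (y k) 0 t1 d) => //; try exact: ltW.
    - by rewrite subr0 -dP ler_wpM2l// ltW.
    - exact: continuous_subspaceT.
    - move=> t0 t00 t01; split; first by move=> i; exact: xi.
      rewrite /= -[X (x t0)]subr0 -(Xy k); apply: LX; first exact: before (ltW t00) t01.
      by move: zk; rewrite -!ball_normE /=; move: r0; lra.
  by move: x0 h; lra.
have xP : x P = x 0 by rewrite /x /g /P model_flow_period// model_flow0.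
have dP1 : d * P < 1 by rewrite dP; lra.
have := short_orbit_constant P0 (ltW d0) dP1 LX stays xc xi xP.
have vc' : quad 2 v <= c by rewrite vc.
rewrite /x /g model_flow0 -(A_conj k vc' (vn0 _ vc)) => /(loc_diffeo_inj (A_diffeo k vc')).
rewrite ham_model ?vn0// modelE ?vn0// vc -/m => h.
have : v = 0.
  apply: plane_eq; rewrite !mxE.
    have := congr1 (fun M : plane R => M 0 1) h; rewrite !mxE /= => /eqP.
    by rewrite mulf_eq0 gt_eqF//= oppr_eq0 mulf_eq0 pnatr_eq0/= => /eqP.
  have := congr1 (fun M : plane R => M 0 0) h; rewrite !mxE /= => /eqP.
  by rewrite mulf_eq0 gt_eqF//= mulf_eq0 invr_eq0 pnatr_eq0 orbF => /eqP.
by apply/eqP; exact: vn0.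
Qed.

End AccumulationPoint.

(** * Hamiltonian fields and isotopies in a chart *)

Section Slices.
Context {R : realType}.
Local Notation spacetime := (R^o * plane R)%type.
Implicit Types (u v w p q : plane R).

Lemma derive_slice (W : normedModType R) (g : spacetime -> W) (t : R) u v :
  'D_v (fun x => g (t, x)) u = 'D_((0, v) : spacetime) g (t, u).
Proof.
rewrite /derive.
have -> : (fun h => h^-1 *: (((fun x => g (t, x)) \o shift u) (h *: v) - g (t, u))) =
    (fun h => h^-1 *: ((g \o shift ((t, u) : spacetime)) (h *: ((0, v) : spacetime)) - g (t, u))).
  apply/funext => h /=; congr (_ *: (g _ - _)).
  by congr (_, _); rewrite /= scaler0 add0r.
by [].
Qed.

Lemma slice_C1_at (W : normedModType R) (g : spacetime -> W) (U : set spacetime) (t : R) u :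
  open U -> U (t, u) -> Ck_on 1 U g -> C1_at (fun x => g (t, x)) u.
Proof.
move=> oU Utu [dg cg].
have di x : differentiable (fun x : plane R => (t, x) : spacetime) x.
  exact: (@differentiable_pair R (plane R) R^o (plane R) (cst (t : R^o)) id x
    (@differentiable_cst _ _ _ _ _) (loc_diffeo_diff (loc_diffeo_id x))).
have ci x : {for x, continuous (fun x : plane R => (t, x) : spacetime)}.
  exact: differentiable_continuous (di x).
have Ux : \forall x \near u, U (t, x) := ci u _ (open_nbhs_nbhs (conj oU Utu)).
split.
  apply: filterS Ux => x Utx.
  exact: (@differentiable_comp R (plane R) _ _ (fun x => (t, x) : spacetime) g x (di x) (dg _ Utx)).
move=> v; have -> : (fun x => 'D_v (fun x => g (t, x)) x) = (fun x => 'D_((0, v) : spacetime) g (t, x)).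
  by apply/funext => x; exact: derive_slice.
exact: (continuous_cvg _ (cg (0, v) (t, u) Utu) (ci u)).
Qed.

Lemma slice_ham_C1_at (g : spacetime -> R^o) (U : set spacetime) (t : R) u :
  open U -> U (t, u) -> (forall k, Ck_on k U g) -> C1_at (ham (fun x => g (t, x))) u.
Proof.
move=> oU Utu Cg.
have C v : C1_at (fun x => 'D_v (fun x => g (t, x)) x) u.
  have -> : (fun x => 'D_v (fun x => g (t, x)) x) = (fun x => 'D_((0, v) : spacetime) g (t, x)).
    by apply/funext => x; exact: derive_slice.
  exact: (@slice_C1_at R^o (fun z => 'D_((0, v) : spacetime) g z) U t u oU Utu ((Cg 2%N).2 (0, v))).
apply: C1_at_vec2; first exact: C.
apply: (@C1_at_ext _ _ _ (fun x => (- 1 : R) * 'D_(vec2 1 0) (fun x => g (t, x)) x : R^o)).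
  by apply: filterE => x; rewrite mulN1r.
exact: (C1_at_mul (C1_at_cst (-1 : R^o) u) (C _)).
Qed.

Let four_le (a b c d : R) : 0 <= a -> 0 <= b -> 0 <= c -> 0 <= d ->
  [/\ a <= a + b + c + d, b <= a + b + c + d, c <= a + b + c + d & d <= a + b + c + d].
Proof. by move=> *; split; lra. Qed.

(** The second spatial derivatives are jointly continuous in time and space, hence bounded near
    [(t, u)]; a single constant serves all nearby times. *)
Lemma slice_ham_lipschitz (g : spacetime -> R^o) (U : set spacetime) (t : R) u :
  open U -> U (t, u) -> (forall k, Ck_on k U g) ->
  exists L e : R, [/\ 0 < L, 0 < e & forall s, `|t - s| < e -> forall p q, ball u e p -> ball u e q ->
    `|ham (fun x => g (s, x)) p - ham (fun x => g (s, x)) q| <= L * `|p - q|].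
Proof.
move=> oU Utu Cg.
pose D2 (v w : plane R) : spacetime -> R^o := fun z => 'D_((0, w) : spacetime) ('D_((0, v) : spacetime) g) z.
have cD v w : {for (t, u) : spacetime, continuous (D2 v w)}.
  by have [_ /(_ (0, v))[_ /(_ (0, w))]] := Cg 2%N; apply.
have bD v w : exists2 N : R, 0 <= N & \forall z \near ((t, u) : spacetime), `|D2 v w z| < N.
  have c : {for (t, u) : spacetime, continuous (fun z => `|D2 v w z|)}.
    exact: (continuous_cvg _ (@norm_continuous _ _ _) (cD v w)).
  have h : `|D2 v w (t, u)| < `|D2 v w (t, u)| + 1 by rewrite ltrDl.
  exists (`|D2 v w (t, u)| + 1); first by rewrite addr_ge0.
  exact: c _ (lt_nbhsl h).
pose a : plane R := vec2 1 0; pose b : plane R := vec2 0 1.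
have [n1 n10 H1] := bD a a; have [n2 n20 H2] := bD a b.
have [n3 n30 H3] := bD b a; have [n4 n40 H4] := bD b b.
pose N := n1 + n2 + n3 + n4.
have : \forall z \near ((t, u) : spacetime), U z /\
    [/\ `|D2 a a z| <= N, `|D2 a b z| <= N, `|D2 b a z| <= N & `|D2 b b z| <= N].
  have UH := open_nbhs_nbhs (conj oU Utu).
  near=> z; split; first by near: z.
  have h1 : `|D2 a a z| < n1 by near: z.
  have h2 : `|D2 a b z| < n2 by near: z.
  have h3 : `|D2 b a z| < n3 by near: z.
  have h4 : `|D2 b b z| < n4 by near: z.
  have [N1 N2 N3 N4] := four_le n10 n20 n30 n40.
  split; [exact: ltW (lt_le_trans h1 N1)|exact: ltW (lt_le_trans h2 N2)|
          exact: ltW (lt_le_trans h3 N3)|exact: ltW (lt_le_trans h4 N4)].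
move=> /nbhs_ballP[e /= e0 He].
(* The added 1 makes the constant positive even when [N] is 0. *)
exists (2 * N + 1), e; split=> //; first by rewrite ltr_wpDl ?mulr_ge0 ?addr_ge0.
move=> s ts p q up uq.
have inb x : ball u e x -> U (s, x) /\ [/\ `|D2 a a (s, x)| <= N, `|D2 a b (s, x)| <= N, `|D2 b a (s, x)| <= N & `|D2 b b (s, x)| <= N].
  by move=> ux; apply: He; split=> //; rewrite -ball_normE.
have slC v x : ball u e x -> differentiable (fun x => 'D_v (fun x => g (s, x)) x) x /\
    forall w, 'D_w (fun x => 'D_v (fun x => g (s, x)) x) x = D2 v w (s, x).
  move=> /inb[Usx _].
  have E : (fun x => 'D_v (fun x => g (s, x)) x) = (fun x => 'D_((0, v) : spacetime) g (s, x)).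
    by apply/funext => y; exact: derive_slice.
  rewrite E; split; last by move=> w; exact: derive_slice.
  exact: C1_at_diff (@slice_C1_at R^o (fun z => 'D_((0, v) : spacetime) g z) U s x oU Usx ((Cg 2%N).2 (0, v))).
have lip v : (forall x, ball u e x -> `|D2 v a (s, x)| <= N /\ `|D2 v b (s, x)| <= N) ->
    `|'D_v (fun x => g (s, x)) p - 'D_v (fun x => g (s, x)) q| <= 2 * N * `|p - q|.
  move=> H; apply: (@lipschitz_ball R (fun x => 'D_v (fun x => g (s, x)) x) u e N) => // x ux.
  have [d E] := slC v x ux; have [h1 h2] := H x ux; split; first exact: d.
  by rewrite (E (vec2 1 0)) (E (vec2 0 1)); split; [exact: h1|exact: h2].
have la : `|'D_a (fun x => g (s, x)) p - 'D_a (fun x => g (s, x)) q| <= 2 * N * `|p - q|.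
  by apply: lip => x /inb[_ []].
have lb : `|'D_b (fun x => g (s, x)) p - 'D_b (fun x => g (s, x)) q| <= 2 * N * `|p - q|.
  by apply: lip => x /inb[_ []].
have N0 : 0 <= 2 * N * `|p - q| by rewrite !mulr_ge0 ?addr_ge0.
apply: (@le_trans _ _ (2 * N * `|p - q|)); last by rewrite ler_wpM2r// lerDl.
apply: plane_norm_le => //; rewrite !mxE /=; first exact: lb.
by rewrite -opprD normrN.
Unshelve. all: by end_near. Qed.

End Slices.

Section ChartFacts.
Context {R : realType} {T : topologicalType} (c : chart R T).

Lemma chart_imgP p : chart_dom c p -> chart_img c (c p).
Proof. by move=> cp; exists p. Qed.

Lemma chart_invK u : chart_img c u -> c (chart_inv c u) = u.
Proof. by move=> [p cp <-]; rewrite chart_mapK. Qed.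

Lemma chart_inv_dom u : chart_img c u -> chart_dom c (chart_inv c u).
Proof. by move=> [p cp <-]; rewrite chart_mapK. Qed.

Lemma chart_continuous_at p : chart_dom c p -> {for p, continuous c}.
Proof.
move=> cp; have := @chart_map_continuous _ _ c.
by rewrite (continuous_open_subspace _ (@chart_dom_open _ _ c)) => /(_ p); apply; rewrite inE.
Qed.

Lemma chart_inv_continuous_at u : chart_img c u -> {for u, continuous (chart_inv c)}.
Proof.
move=> cu; have := @chart_inv_continuous _ _ c.
by rewrite (continuous_open_subspace _ (@chart_img_open _ _ c)) => /(_ u); apply; rewrite inE.
Qed.

Lemma near_chart_img u : chart_img c u -> \forall x \near u, chart_img c x.
Proof. by move=> cu; apply: open_nbhs_nbhs; split=> //; exact: chart_img_open. Qed.

Lemma open_chart_preimage (O : set T) : open O ->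
  open [set u | chart_img c u /\ O (chart_inv c u)].
Proof.
move=> oO; rewrite openE => u [cu Ou]; rewrite /interior.
have H : \forall x \near u, O (chart_inv c x) := chart_inv_continuous_at cu (open_nbhs_nbhs (conj oO Ou)).
by apply: filterS2 (near_chart_img cu) H => x.
Qed.

Lemma chart_preimageE (O : set T) :
  c @` (chart_dom c `&` O) = [set u | chart_img c u /\ O (chart_inv c u)].
Proof.
apply/seteqP; split=> u.
  by move=> [p [cp Op] <-] /=; rewrite chart_mapK//; split=> //; exact: chart_imgP.
by move=> [cu Ou]; exists (chart_inv c u); [split=> //; exact: chart_inv_dom|exact: chart_invK].
Qed.

End ChartFacts.

Section HamiltonianChart.
Context {R : realType} (M : symplectic_surface R) (c : chart R M).
Hypothesis cM : atlas c.
Variable G : R -> M -> R.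
Hypothesis G_smooth : smooth_hamiltonian G.
Local Notation Gc t := (fun x : plane R => G t (chart_inv c x) : R^o).
Local Notation spacetime := (R^o * plane R)%type.

(** Smoothness on the closed time interval provides an extension to an open set of spacetime. It
    agrees with [G] on full spatial neighborhoods at every admissible time, so spatial derivatives
    may be computed with it, including at times 0 and 1. *)
Let local_extension (t : R) u : t \in `[0, 1] -> chart_img c u ->
  exists (U : set spacetime) (g : spacetime -> R^o), [/\ open U, U (t, u), forall k, Ck_on k U g &
    forall s x, s \in `[0, 1] -> U (s, x) ->  chart_img c x -> ham (Gc s) x = ham (fun x => g (s, x)) x /\
      \forall y \near x, g (s, y) = Gc s y].
Proof.
move=> t01 cu.
have [U [g [oU Utu Cg gE]]] := @G_smooth c cM (t, u) (conj t01 cu).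
exists U, g; split=> // s x s01 Usx cx.
have dpair y : differentiable (fun x : plane R => (s, x) : spacetime) y.
  exact: (@differentiable_pair R (plane R) R^o (plane R) (cst (s : R^o)) id y
    (@differentiable_cst _ _ _ _ _) (loc_diffeo_diff (loc_diffeo_id y))).
have Us : \forall y \near x, U (s, y) := differentiable_continuous (dpair x) (open_nbhs_nbhs (conj oU Usx)).
have E : \forall y \near x, g (s, y) = Gc s y.
  by apply: filterS2 Us (near_chart_img cx) => y Usy cy; rewrite -(gE (s, y)).
by split=> //; congr vec2; [|congr (- _)]; apply/esym/near_eq_derive.
Qed.

Lemma hamiltonian_C1_at t u : t \in `[0, 1] -> chart_img c u -> C1_at (Gc t) u.
Proof.
move=> t01 cu; have [U [g [oU Utu Cg gE]]] := local_extension t01 cu.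
have [_ E] := gE t u t01 Utu cu.
exact: C1_at_ext E (slice_C1_at oU Utu (Cg 1%N)).
Qed.

Lemma ham_C1_at t u : t \in `[0, 1] -> chart_img c u -> C1_at (ham (Gc t)) u.
Proof.
move=> t01 cu; have [U [g [oU Utu Cg gE]]] := local_extension t01 cu.
apply: C1_at_ext (slice_ham_C1_at oU Utu Cg).
have [_ E] := gE t u t01 Utu cu.
by apply: filterS (near_join E) => x Ex; congr vec2; [|congr (- _)]; apply/near_eq_derive.
Qed.

(** Compactness of [[0, 1]] makes the local constants and radii uniform in time. *)
Lemma ham_lipschitz u : chart_img c u -> exists L e : R, [/\ 0 < L, 0 < e,
  ball u e `<=` chart_img c &
  forall t, t \in `[0, 1] -> forall p q, ball u e p -> ball u e q ->
    `|ham (Gc t) p - ham (Gc t) q| <= L * `|p - q|].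
Proof.
move=> cu.
have /nbhs_ballP[e1 /= e10 He1] := near_chart_img cu.
(* One integer governs both the radius and the Lipschitz constant, so the covering property of the
   compact interval can be applied along the filter at infinity. *)
pose P (n : nat) (t : R) := t \in `[0, 1] -> forall p q,
  ball u (n.+1%:R)^-1 p -> ball u (n.+1%:R)^-1 q -> `|ham (Gc t) p - ham (Gc t) q| <= n%:R * `|p - q|.
have /compact_near_coveringP/(_ nat \oo P _) cov : compact `[0 : R, 1]%classic by exact: segment_compact.
have : \forall n \near \oo, `[0 : R, 1]%classic `<=` P n.
  apply: cov => t t01; have [U [g [oU Utu Cg gE]]] := local_extension t01 cu.
  have [L [e [L0 e0 Le]]] := slice_ham_lipschitz oU Utu Cg.
  have /nbhs_ballP[d /= d0 Hd] := open_nbhs_nbhs (conj oU Utu).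
  have m0 : 0 < Num.min e d by rewrite lt_min e0 d0.
  have H1 := near_infty_natSinv_lt (PosNum m0).
  have H2 := near_infty_natSinv_lt (PosNum e10).
  have H3 := nbhs_infty_ger L.
  exists ([set s | `|t - s| < Num.min e d], [set n | [/\ (n.+1%:R)^-1 < Num.min e d, (n.+1%:R)^-1 < e1 & L <= n%:R]]).
    split => /=; first by apply/nbhs_ballP; exists (Num.min e d).
    by apply: filterS3 H1 H2 H3 => n.
  move=> [s n] [/= ts [n1 n2 n3]] s01 p q up uq.
  move: ts n1; rewrite !lt_min => /andP[ts1 ts2] /andP[n1 n1'].
  have big x : ball u (n.+1%:R)^-1 x -> [/\ ball u e x, U (s, x) & chart_img c x].
    move=> ux; split; first by apply: le_ball ux; exact: ltW.
      by apply: Hd; split; [rewrite /= -ball_normE|apply: le_ball ux; exact: ltW].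
    by apply: He1; apply: le_ball ux; exact: ltW.
  have [p1 p2 p3] := big p up; have [q1 q2 q3] := big q uq.
  have [-> _] := gE s p s01 p2 p3; have [-> _] := gE s q s01 q2 q3.
  by apply: le_trans (Le s ts1 p q p1 q1) _; rewrite ler_wpM2r.
have H2 := near_infty_natSinv_lt (PosNum e10).
move=> /(filterI H2)/(filterI (nbhs_infty_gt 0)) [N _ HN].
have [N0 [N1 NP]] := HN N (leqnn N).
exists N%:R, (N.+1%:R)^-1; split.
- by rewrite ltr0n.
- by rewrite invr_gt0 ltr0n.
- by apply: subset_trans He1; apply: le_ball; exact: ltW.
- by move=> t t01 p q; apply: NP.
Qed.

End HamiltonianChart.

(** * Velocities of paths, one-sided at the endpoints *)

Section Velocity.
Context {R : realType}.
Implicit Types (t : R).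

Definition punctured t : set_system R := within (`[0, 1]%classic `\ t) (nbhs t).

(** Every time of the closed interval, endpoints included, is a limit of other times of the
    interval; this is what makes a velocity unique. *)
Lemma punctured_proper t : t \in `[0, 1] -> ProperFilter (punctured t).
Proof.
rewrite in_itv/= => /andP[t0 t1]; apply: Build_ProperFilter_ex => P /nbhs_ballP[e /= e0 He].
have inb s : `|t - s| < e -> 0 <= s -> s <= 1 -> s != t -> P s.
  move=> h1 h2 h3 /eqP h4; apply: He; first by rewrite /= -ball_normE.
  by split=> //; rewrite /= in_itv/= h2 h3.
have [t1'|t1'] := ltP t 1.
  have m0 : 0 < Num.min (e / 2) (1 - t) by rewrite lt_min divr_gt0// subr_gt0.
  have me : Num.min (e / 2) (1 - t) < e.
    by apply: (@le_lt_trans _ _ (e / 2)); [rewrite ge_min lexx|rewrite ltr_pdivrMr// ltr_pMr// ltr1n].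
  have mt : Num.min (e / 2) (1 - t) <= 1 - t by rewrite ge_min lexx orbT.
  exists (t + Num.min (e / 2) (1 - t)); move: (Num.min _ _) m0 me mt => m m0 me mt; apply: inb.
  - by rewrite opprD addNKr normrN gtr0_norm.
  - by rewrite addr_ge0// ltW.
  - by rewrite addrC -lerBrDr.
  - by rewrite gt_eqF// ltrDl.
have m0 : 0 < Num.min (e / 2) 1 by rewrite lt_min divr_gt0// ltr01.
have me : Num.min (e / 2) 1 < e.
  by apply: (@le_lt_trans _ _ (e / 2)); [rewrite ge_min lexx|rewrite ltr_pdivrMr// ltr_pMr// ltr1n].
have mt : Num.min (e / 2) 1 <= 1 by rewrite ge_min lexx orbT.
exists (t - Num.min (e / 2) 1); move: (Num.min _ _) m0 me mt => m m0 me mt; apply: inb.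
- by rewrite opprB addrC subrK gtr0_norm.
- by rewrite subr_ge0 (le_trans mt).
- by rewrite lerBlDr (le_trans t1)// lerDl ltW.
- by rewrite lt_eqF// gtrBl.
Qed.

Lemma velocity_unique (T : topologicalType) (c : chart R T) (x : R -> T) t X Y :
  t \in `[0, 1] -> velocity c x t X -> velocity c x t Y -> X = Y.
Proof.
move=> t01 vX vY; have pF := punctured_proper t01.
exact: (cvg_unique (@norm_hausdorff R (plane R)) vX vY).
Qed.

Lemma near_chart_dom (T : topologicalType) (c : chart R T) (x : R -> T) t :
  t \in `[0, 1] -> {within `[0, 1], continuous x} -> chart_dom c (x t) ->
  (\forall s \near punctured t, chart_dom c (x s)) /\ c (x s) @[s --> punctured t] --> c (x t).
Proof.
move=> t01 xc cx.
have tin : `[0, 1]%classic t by [].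
have xt : x s @[s --> punctured t] --> x t.
  move=> U Ux; have /subspace_continuousP/(_ t tin)/(_ U Ux) := xc.
  move=> H; have {}H : \forall s \near t, `[0, 1]%classic s -> U (x s) := H.
  rewrite -[nbhs _ U]/(\forall s \near t, (`[0, 1]%classic `\ t) s -> U (x s)).
  by apply: filterS H => s h1 [/h1].
split; first exact: (xt _ (open_nbhs_nbhs (conj (@chart_dom_open _ _ c) cx))).
exact: (continuous_cvg _ (chart_continuous_at cx) xt).
Qed.

Lemma velocity_comp (T : topologicalType) (c d : chart R T) (f : T -> T) (x : R -> T) t X :
  t \in `[0, 1] -> {within `[0, 1], continuous x} -> chart_dom c (x t) ->
  differentiable (d \o f \o chart_inv c) (c (x t)) ->
  velocity c x t X -> velocity d (f \o x) t ('d (d \o f \o chart_inv c) (c (x t)) X).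
Proof.
move=> t01 xc cx; set P := d \o f \o chart_inv c => dP vX.
have [dom_x x_cvg] := near_chart_dom t01 xc cx.
have pF := punctured_proper t01.
apply/cvgrPdist_le => e e0.
set x0 := c (x t) in dP x_cvg *.
pose Q s := (s - t)^-1 *: (c (x s) - x0).
have N0 : 0 < `|X| + 1 by apply: ltr_wpDl.
have e2 : 0 < e / 2 by rewrite divr_gt0.
have eN : 0 < e / 2 / (`|X| + 1) by rewrite divr_gt0.
(* The remainder in the differentiability of [P] is small relative to the increment, so it has to be
   weighed against difference quotients known to be bounded. *)
have H1 : \forall s \near punctured t, `|Q s| <= `|X| + 1.
  have h : `|X| < `|X| + 1 by rewrite ltrDl.
  have nc : `|Q s| @[s --> punctured t] --> `|X| by exact: (continuous_cvg _ (@norm_continuous _ _ X) vX).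
  have : \forall s \near punctured t, `|Q s| < `|X| + 1 := nc _ (lt_nbhsl h).
  by apply: filterS => s /ltW.
have H2 : \forall s \near punctured t, `|'d P x0 X - 'd P x0 (Q s)| <= e / 2.
  have dc : 'd P x0 (Q s) @[s --> punctured t] --> 'd P x0 X.
    exact: (continuous_cvg _ (@diff_continuous _ _ _ _ _ dP X) vX).
  by have /cvgrPdist_le/(_ _ e2) := dc.
have H3 : \forall s \near punctured t,
    `|P (c (x s)) - P x0 - 'd P x0 (c (x s) - x0)| <= e / 2 / (`|X| + 1) * `|c (x s) - x0|.
  have /eqaddoP/(_ _ eN) := diff_locally dP.
  move=> H0; have {H0} H : \forall h \near (0 : plane R),
      `|(P \o shift x0 - (cst (P x0) + 'd P x0)) h| <= e / 2 / (`|X| + 1) * `|h| := H0.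
  have : \forall y \near x0, `|P y - P x0 - 'd P x0 (y - x0)| <= e / 2 / (`|X| + 1) * `|y - x0|.
    have sc : y - x0 @[y --> x0] --> (0 : plane R).
      by rewrite -[X in _ --> X](subrr x0); exact: (@cvgB _ _ _ (nbhs x0) _ id (cst x0) x0 x0 cvg_id (cvg_cst x0)).
    have {}H : \forall y \near x0, `|(P \o shift x0 - (cst (P x0) + 'd P x0)) (y - x0)| <=
      e / 2 / (`|X| + 1) * `|y - x0| := sc _ H.
    by apply: filterS H => y; rewrite !fctE /= subrK opprD addrA.
  exact: x_cvg.
near=> s.
have cs : chart_dom c (x s) by near: s.
have h1 : `|Q s| <= `|X| + 1 by near: s.
have h2 : `|'d P x0 X - 'd P x0 (Q s)| <= e / 2 by near: s.
have h3 : `|P (c (x s)) - P x0 - 'd P x0 (c (x s) - x0)| <= e / 2 / (`|X| + 1) * `|c (x s) - x0| by near: s.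
have -> : d ((f \o x) s) = P (c (x s)) by rewrite /P /= chart_mapK.
have -> : d ((f \o x) t) = P x0 by rewrite /P /x0 /= chart_mapK.
rewrite -['d P x0 X - _](subrKA ('d P x0 (Q s))) (splitr e).
apply: le_trans (ler_normD _ _) _; apply: lerD => //.
have -> : 'd P x0 (Q s) - (s - t)^-1 *: (P (c (x s)) - P x0) =
    - ((s - t)^-1 *: (P (c (x s)) - P x0 - 'd P x0 (c (x s) - x0))).
  by rewrite /Q linearZ [in RHS]scalerBr opprB.
rewrite normrN normrZ.
have -> : e / 2 = e / 2 / (`|X| + 1) * (`|X| + 1) by rewrite divfK ?gt_eqF.
apply: (@le_trans _ _ (e / 2 / (`|X| + 1) * `|Q s|)); last by rewrite ler_wpM2l// ltW.
rewrite normrZ mulrCA ler_wpM2l//.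
Unshelve. all: by end_near. Qed.

Lemma velocity_is_derive (T : topologicalType) (c : chart R T) (x : R -> T) t X i :
  0 < t -> t < 1 -> velocity c x t X -> is_derive t 1 (fun s => c (x s) 0 i) (X 0 i).
Proof.
move=> t0 t1 vX.
have vi : h^-1 *: ((fun s => c (x s) 0 i) (h *: 1 + t) - c (x t) 0 i) @[h --> 0^'] --> X 0 i.
  have ci : (s - t)^-1 * (c (x s) 0 i - c (x t) 0 i) @[s --> punctured t] --> X 0 i.
    have pF : ProperFilter (punctured t) by apply: punctured_proper; rewrite in_itv/= !ltW.
    have -> : (fun s => (s - t)^-1 * (c (x s) 0 i - c (x t) 0 i)) =
        (fun s => ((s - t)^-1 *: (c (x s) - c (x t))) 0 i).
      by apply/funext => s; rewrite !mxE.
    exact: (@coord_cvg _ _ (punctured t) _ _ _ i vX).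
  move=> U /ci; rewrite /= /punctured => /nbhs_ballP[e /= e0 He].
  have m0 : 0 < Num.min e (Num.min t (1 - t)) by rewrite !lt_min e0 t0 subr_gt0.
  apply/nbhs_ballP; exists (Num.min e (Num.min t (1 - t))) => //= h.
  rewrite -ball_normE /= sub0r normrN !lt_min => /and3P[h1 h2 h3] h0.
  have := He (h + t); rewrite /= addrK [h *: 1]mulr1; apply.
    by rewrite -ball_normE /= opprD addrCA addrN addr0 normrN.
  split; last by apply/eqP; rewrite -subr_eq0 addrK.
  by rewrite /= in_itv/=; move: h2 h3; rewrite !ltr_norml => /andP[a1 a2] /andP[b1 b2]; apply/andP; split; lra.
split; first by apply/cvg_ex; exists (X 0 i).
exact: cvg_lim.
Qed.

End Velocity.

(** * Isotopies near a common zero of the fields *)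

Lemma subr_subl (V : zmodType) (x y z : V) : x - y - (x - z) = - (y - z).
Proof. by rewrite [in LHS]opprB addrC subrKA opprB. Qed.

Lemma subr_exchange (V : zmodType) (x y z w : V) : x - y - (z - w) = (x - z) - (y - w).
Proof. by rewrite !opprB !addrA (addrC _ w) (addrC (_ - _) w) -!addrA; congr (_ + (_ + _)); rewrite addrC. Qed.

Section Isotopy.
Context {R : realType} (M : symplectic_surface R) (D : chart R M).
Hypothesis darbouxD : darboux_chart D.
Variables (G : R -> M -> R) (phi : R -> M -> M).
Hypothesis phi_isotopy : hamiltonian_isotopy G phi.
Local Notation Gc t := (fun x : plane R => G t (chart_inv D x) : R^o).

Let phi0 p : phi 0 p = p. Proof. by case: phi_isotopy => h _ _; exact: h. Qed.

Lemma isotopy_continuous p : {within `[0, 1], continuous (fun t => phi t p)}.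
Proof. by case: phi_isotopy => _ h _; exact: h. Qed.

Lemma isotopy_velocity p t : t \in `[0, 1] -> chart_dom D (phi t p) ->
  velocity D (fun s => phi s p) t (ham (Gc t) (D (phi t p))).
Proof.
move=> t01 Dp; have [_ _ H] := phi_isotopy.
have [aD dens1] := darbouxD.
have [X HX vX] := H p t D t01 aD Dp.
suff <- : X = ham (Gc t) (D (phi t p)) by [].
apply: ham_unique => v; have := HX v; rewrite /area_form dens1 ?mul1r//.
exact: chart_imgP.
Qed.

(** A constant path has velocity 0, and velocities are unique. *)
Lemma fixed_ham_eq0 p : (forall t, t \in `[0, 1] -> phi t p = p) -> chart_dom D p ->
  forall t, t \in `[0, 1] -> ham (Gc t) (D p) = 0.
Proof.
move=> fixp Dp t t01; have Dp' : chart_dom D (phi t p) by rewrite fixp.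
have := isotopy_velocity t01 Dp'; rewrite fixp// => v1.
apply: (velocity_unique t01 v1).
have E : \forall s \near punctured t, (0 : plane R) = (s - t)^-1 *: (D (phi s p) - D (phi t p)).
  have : \forall s \near t, (`[0, 1]%classic `\ t) s -> (0 : plane R) = (s - t)^-1 *: (D (phi s p) - D (phi t p)).
    by apply: filterE => s [s01 _]; rewrite (fixp s s01) (fixp t t01) subrr scaler0.
  exact.
exact: cvg_trans (near_eq_cvg E) (cvg_cst _).
Qed.

Let sub01 (a b : R) : 0 <= a -> b <= 1 -> `[a, b]%classic `<=` `[0, 1]%classic.
Proof.
move=> a0 b1 t; rewrite /= !in_itv/= => /andP[h1 h2].
by rewrite (le_trans a0 h1) (le_trans h2 b1).
Qed.

Let chart_path_continuous p (a b : R) : 0 <= a -> b <= 1 ->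
  (forall t, a <= t -> t <= b -> chart_dom D (phi t p)) ->
  {within `[a, b], continuous (fun t => D (phi t p))}.
Proof.
move=> a0 b1 Hd; apply/subspace_continuousP => t tab.
have xc := continuous_subspaceW (sub01 a0 b1) (@isotopy_continuous p).
have /subspace_continuousP/(_ t tab) H := xc.
have := tab; rewrite /= in_itv/= => /andP[h1 h2].
exact: (continuous_cvg _ (chart_continuous_at (Hd t h1 h2)) H).
Qed.

Let chart_path_derive p (t : R) i : 0 < t -> t < 1 -> chart_dom D (phi t p) ->
  is_derive t 1 (fun s => D (phi s p) 0 i) (ham (Gc t) (D (phi t p)) 0 i).
Proof.
move=> t0 t1 Dp; apply: (velocity_is_derive i t0 t1 (isotopy_velocity _ Dp)).
by rewrite in_itv/= !ltW.
Qed.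

Section NearZero.
Variables (z : plane R) (L e : R).
Hypothesis L_gt0 : 0 < L.
Hypothesis e_gt0 : 0 < e.
Hypothesis ball_img : ball z e `<=` chart_img D.
Hypothesis lipL : forall t, t \in `[0, 1] -> forall p q, ball z e p -> ball z e q ->
    `|ham (Gc t) p - ham (Gc t) q| <= L * `|p - q|.
Hypothesis zeroz : forall t, t \in `[0, 1] -> ham (Gc t) z = 0.

Let U : set M := [set p | chart_dom D p /\ ball z e (D p)].

Let oU : open U.
Proof.
rewrite openE => p [Dp zp]; rewrite /interior.
have H1 : \forall q \near p, chart_dom D q.
  exact: open_nbhs_nbhs (conj (@chart_dom_open _ _ D) Dp).
have H2 : \forall q \near p, ball z e (D q).
  exact: (chart_continuous_at Dp (open_nbhs_nbhs (conj (ball_open z e) zp))).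
by apply: filterS2 H1 H2 => q.
Qed.

Let bound_before p (a b : R) : 0 <= a -> a <= b -> b <= 1 -> L * (b - a) <= 2^-1 ->
  (forall t, a <= t -> t <= b -> U (phi t p)) ->
  forall t, a <= t -> t <= b -> `|D (phi t p) - z| <= 2 * `|D (phi a p) - z|.
Proof.
move=> a0 ab b1 Lab inU.
apply: (@short_time_bound R (fun t => D (phi t p)) (fun t => ham (Gc t) (D (phi t p))) z a b L) => //.
- exact: ltW.
- by apply: chart_path_continuous => // t h1 h2; have [] := inU t h1 h2.
move=> t at_ tb.
have t0 : 0 < t by exact: le_lt_trans at_.
have t1 : t < 1 by exact: lt_le_trans b1.
have t01 : t \in `[0, 1] by rewrite in_itv/= !ltW.
have [Dp zp] := inU t (ltW at_) (ltW tb).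
split; first by move=> i; exact: chart_path_derive.
rewrite -[ham _ (D _)]subr0 -(zeroz t01); apply: lipL => //.
exact: ballxx.
Qed.

(** [short_time_bound] applies only while the path stays in the chart. Up to a first exit it keeps
    the path in the image of a closed ball strictly inside [ball z e]. This image is compact, hence
    closed in the Hausdorff surface, so it also contains the exit point, which thus has not left. *)
Lemma isotopy_stays p (a b : R) : 0 <= a -> a <= b -> b <= 1 -> L * (b - a) <= 2^-1 ->
  chart_dom D (phi a p) -> 2 * `|D (phi a p) - z| < e ->
  forall t, a <= t -> t <= b ->
    [/\ chart_dom D (phi t p), ball z e (D (phi t p)) & `|D (phi t p) - z| <= 2 * `|D (phi a p) - z|].
Proof.
move=> a0 ab b1 Lab Dp close.
have Ua : U (phi a p).
  split=> //; rewrite -ball_normE /= distrC; apply: le_lt_trans close.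
  by rewrite ler_peMl// ler1n.
have xc := continuous_subspaceW (sub01 a0 b1) (@isotopy_continuous p).
have allU : forall t, a <= t -> t <= b -> U (phi t p).
  have [//|[t1 [at1 t1b nU before]]] := first_exit ab xc oU Ua.
  exfalso; apply: nU.
  pose C0 : set (plane R) := [set u | `|u - z| <= 2 * `|D (phi a p) - z|].
  have C0e u : C0 u -> ball z e u.
    by move=> Cu; rewrite -ball_normE /= distrC; exact: le_lt_trans Cu close.
  have nc : continuous (fun u : plane R => `|u - z|).
    move=> u; have sc := @cvgB _ _ _ (nbhs u) _ id (cst z) u z cvg_id (cvg_cst z).
    exact: (continuous_cvg _ (@norm_continuous _ _ (u - z)) (sc _ _)).
  have cC0 : compact C0.
    apply: bounded_closed_compact.
      exists (`|z| + 2 * `|D (phi a p) - z|); split; first exact: num_real.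
      move=> N hN u /= Cu; apply: le_trans (ltW hN).
      by rewrite -[u](subrK z) addrC (le_trans (ler_normD _ _))// lerD2l.
    rewrite (_ : C0 = (fun u : plane R => `|u - z|) @^-1` [set x | x <= 2 * `|D (phi a p) - z|])//.
    by apply: closed_comp => [u _|]; [exact: nc|exact: closed_le].
  have cC : closed (chart_inv D @` C0).
    apply: compact_closed; first exact: surface_hausdorff.
    apply: continuous_compact => //; apply: continuous_in_subspaceT => u; rewrite inE => /C0e zu.
    exact: chart_inv_continuous_at (ball_img zu).
  have inC s : a <= s -> s < t1 -> (chart_inv D @` C0) (phi s p).
    move=> h1 h2; have [Ds zs] := before s h1 h2.
    exists (D (phi s p)); last exact: chart_mapK.
    have s1 : s <= 1 by apply: le_trans b1; apply: le_trans (ltW h2) t1b.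
    have Ls : L * (s - a) <= 2^-1.
      apply: le_trans Lab; rewrite ler_wpM2l ?(ltW L_gt0)// lerB//.
      exact: le_trans (ltW h2) t1b.
    apply: (bound_before a0 h1 s1 Ls) => // t k1 k2; apply: before => //.
    exact: le_lt_trans k2 h2.
  have [u Cu uE] : (chart_inv D @` C0) (phi t1 p).
    apply: contrapT => nC.
    have tab : `[a, b]%classic t1 by rewrite /= in_itv/= t1b ltW.
    have /subspace_continuousP/(_ t1 tab) H := xc.
    have oC := open_nbhs_nbhs (conj (closed_openC cC) nC).
    have {}H : \forall s \near t1, `[a, b]%classic s -> (~` (chart_inv D @` C0)) (phi s p) := H _ oC.
    move: H => /nbhs_ballP[d /= d0 Hd].
    pose s := Num.max a (t1 - d / 2).
    have as_ : a <= s by rewrite le_max lexx.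
    have st : s < t1 by rewrite gt_max at1 gtrBl divr_gt0.
    have ds : t1 - d / 2 <= s by rewrite le_max lexx orbT.
    apply: (Hd s _ _ (inC s as_ st)).
      rewrite -ball_normE /= gtr0_norm ?subr_gt0//.
      apply: (@le_lt_trans _ _ (d / 2)); last by rewrite ltr_pdivrMr// ltr_pMr// ltr1n.
      by rewrite lerBlDr addrC -lerBlDr.
    by rewrite /= in_itv/= as_ (le_trans (ltW st)).
  have zu := C0e u Cu; have Vu := ball_img zu.
  by rewrite -uE; split; [exact: chart_inv_dom|rewrite chart_invK].
move=> t h1 h2; have [Dt zt] := allU t h1 h2; split=> //.
exact: (bound_before a0 ab b1 Lab allU).
Qed.

(** The quarter is dictated by [image_step]: multiplied by the factor 2 of [short_time_bound] it
    must be at most one half. *)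
Let step_count : exists2 N : nat, 0 < N%:R :> R & L * N%:R^-1 <= 4^-1.
Proof.
have [N _ HN] := nbhs_infty_ger (4 * L).
have N1 : 0 < N.+1%:R :> R by rewrite ltr0n.
exists N.+1 => //; have /= h := HN N.+1 (leqnSn N).
by rewrite ler_pdivrMr// mulrC ler_pdivlMr// mulrC.
Qed.

(** Uniqueness of the constant solution: on each of [N] short intervals the distance to [z] is at
    most twice its initial value, which is 0. *)
Lemma isotopy_fixed t : t \in `[0, 1] -> phi t (chart_inv D z) = chart_inv D z.
Proof.
have Vz : chart_img D z by apply: ball_img; exact: ballxx.
set p := chart_inv D z.
have Dp : chart_dom D p by exact: chart_inv_dom.
have Dpz : D p = z by exact: chart_invK.
have [N N0 LN] := step_count.
have {}LN : L * N%:R^-1 <= 2^-1 by apply: le_trans LN _; rewrite lef_pV2 ?posrE// ler_nat.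
have step n : (n <= N)%N -> forall t, 0 <= t -> t <= n%:R / N%:R -> phi t p = p.
  elim: n => [|n IH] nN s s0 sn.
    by rewrite mul0r in sn; have -> : s = 0 by apply/eqP; rewrite eq_le s0 sn.
  have nN' := ltnW nN.
  have a0 : 0 <= n%:R / N%:R :> R by rewrite divr_ge0.
  have fa : phi (n%:R / N%:R) p = p by exact: IH.
  have [h|h] := leP s (n%:R / N%:R); first exact: IH.
  have b1 : n.+1%:R / N%:R <= 1 :> R by rewrite ler_pdivrMr// mul1r ler_nat.
  have ab : n%:R / N%:R <= n.+1%:R / N%:R :> R by rewrite ler_pM2r ?invr_gt0// ler_nat.
  have Lab : L * (n.+1%:R / N%:R - n%:R / N%:R) <= 2^-1.
    by rewrite -mulrBl -natrB// subSnn mul1r.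
  have close : 2 * `|D (phi (n%:R / N%:R) p) - z| < e by rewrite fa Dpz subrr normr0 mulr0.
  have Da : chart_dom D (phi (n%:R / N%:R) p) by rewrite fa.
  have [Ds _] := isotopy_stays a0 ab b1 Lab Da close (ltW h) sn.
  rewrite fa Dpz subrr normr0 mulr0 normr_le0 subr_eq0 => /eqP Dsz.
  by rewrite -(chart_mapK Ds) Dsz.
rewrite in_itv/= => /andP[t0 t1]; apply: (step N) => //.
by rewrite divff// gt_eqF.
Qed.

(** Choose a point reaching each [w] at time [a] and follow it until time [b]. The displacement [K]
    is Lipschitz with constant one half by the differential equation alone, so [w + K w] is a
    perturbation of the identity and covers a smaller ball around its fixed point [z]. *)
Let image_step (a b r : R) : 0 <= a -> a <= b -> b <= 1 -> L * (b - a) <= 4^-1 -> 0 < r ->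
  (forall w, ball z r w -> exists p, phi a p = chart_inv D w) ->
  exists2 r', 0 < r' & forall w, ball z r' w -> exists p, phi b p = chart_inv D w.
Proof.
move=> a0 ab b1 Lab r0 Ha.
have [pt Hpt] : {pt : plane R -> M & forall w, ball z r w -> phi a (pt w) = chart_inv D w}.
  have /choice[f Hf] : forall w, exists p, ball z r w -> phi a p = chart_inv D w.
    move=> w; have [/Ha[p Hp]|nw] := pselect (ball z r w); first by exists p.
    by exists (chart_inv D w).
  by exists f.
(* Below [r] for the chosen starting points to exist, and at most [e / 4] so that a doubled distance
   to [z] stays below [e]. *)
pose r1 := Num.min (r / 2) (e / 4).
have r10 : 0 < r1 by rewrite lt_min !divr_gt0.
have r1r : r1 < r.
  by apply: (@le_lt_trans _ _ (r / 2)); [rewrite ge_min lexx|rewrite ltr_pdivrMr// ltr_pMr// ltr1n].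
have r1e : 4 * r1 <= e.
  have : r1 <= e / 4 by rewrite ge_min lexx orbT.
  by rewrite ler_pdivlMr// mulrC.
have Lab2 : L * (b - a) <= 2^-1 by apply: le_trans Lab _; rewrite lef_pV2 ?posrE// ler_nat.
have start w : `|w - z| <= r1 -> [/\ chart_img D w, phi a (pt w) = chart_inv D w & 2 * `|w - z| < e].
  move=> h; have zw : ball z r w by rewrite -ball_normE /= distrC; exact: le_lt_trans h r1r.
  have we : 2 * `|w - z| < e by move: h r1e r10; lra.
  split=> //; last exact: Hpt.
  by apply: ball_img; rewrite -ball_normE /= distrC; apply: le_lt_trans we; rewrite ler_peMl// ler1n.
have path w t : `|w - z| <= r1 -> a <= t -> t <= b ->
    [/\ chart_dom D (phi t (pt w)), ball z e (D (phi t (pt w))) & `|D (phi t (pt w)) - z| <= 2 * `|w - z|].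
  move=> h h1 h2; have [Vw aw we] := start w h.
  have Dw : D (phi a (pt w)) = w by rewrite aw chart_invK.
  have Da : chart_dom D (phi a (pt w)) by rewrite aw; exact: chart_inv_dom.
  have close : 2 * `|D (phi a (pt w)) - z| < e by rewrite Dw.
  by have := isotopy_stays a0 ab b1 Lab2 Da close h1 h2; rewrite Dw.
have Dstart w : `|w - z| <= r1 -> D (phi a (pt w)) = w.
  by move=> h; have [Vw -> _] := start w h; rewrite chart_invK.
pose K w := D (phi b (pt w)) - w.
have Klip w w' : `|w - z| <= r1 -> `|w' - z| <= r1 -> `|K w - K w'| <= 2^-1 * `|w - w'|.
  move=> hw hw'.
  pose x t := D (phi t (pt w)) - D (phi t (pt w')).
  pose V t := ham (Gc t) (D (phi t (pt w))) - ham (Gc t) (D (phi t (pt w'))).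
  have cx : {within `[a, b], continuous x}.
    have c1 := @chart_path_continuous (pt w) a b a0 b1 (fun t h1 h2 => let: And3 d _ _ := path w t hw h1 h2 in d).
    have c2 := @chart_path_continuous (pt w') a b a0 b1 (fun t h1 h2 => let: And3 d _ _ := path w' t hw' h1 h2 in d).
    by move=> t; apply: cvgB; [exact: c1|exact: c2].
  have dx t : a < t -> t < b -> (forall i, is_derive t 1 (fun s => x s 0 i) (V t 0 i)) /\ `|V t| <= L * `|x t - 0|.
    move=> at_ tb; have t0 : 0 < t by exact: le_lt_trans at_.
    have t1 : t < 1 by exact: lt_le_trans b1.
    have [d1 e1 _] := path w t hw (ltW at_) (ltW tb).
    have [d2 e2 _] := path w' t hw' (ltW at_) (ltW tb).
    split; last by rewrite subr0; apply: lipL => //; rewrite in_itv/= !ltW.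
    move=> i; have [da ea] := is_deriveB (chart_path_derive i t0 t1 d1) (chart_path_derive i t0 t1 d2).
    have E : (fun s => x s 0 i) = (fun s => D (phi s (pt w)) 0 i) - (fun s => D (phi s (pt w')) 0 i).
      by apply/funext => s; rewrite /x !mxE.
    by rewrite E; split=> //; rewrite [LHS]ea /V !mxE.
  have xa : x a = w - w' by rewrite /x !Dstart.
  have bound := short_time_bound ab (ltW L_gt0) Lab2 cx dx.
  have -> : K w - K w' = x b - x a.
    by rewrite xa /K /x; apply: plane_eq; rewrite !mxE; ring.
  have coord i : `|x b 0 i - x a 0 i| <= L * (2 * `|w - w'|) * (b - a).
    apply: (@norm_increment_le R (fun s => x s 0 i) (fun s => V s 0 i)) => //.
      move=> t h1 h2; have [dd Vd] := dx t h1 h2; split=> //.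
      apply: le_trans (coord_le _ _) _; apply: le_trans Vd _; rewrite ler_wpM2l ?(ltW L_gt0)//.
      by have := bound t (ltW h1) (ltW h2); rewrite !subr0 xa.
    exact: within_continuous_coord.
  have B : L * (2 * `|w - w'|) * (b - a) <= 2^-1 * `|w - w'|.
    have -> : L * (2 * `|w - w'|) * (b - a) = L * (b - a) * 2 * `|w - w'| by ring.
    rewrite ler_wpM2r//; move: Lab; lra.
  have cB i : `|(x b - x a) 0 i| <= 2^-1 * `|w - w'|.
    have -> : (x b - x a) 0 i = x b 0 i - x a 0 i by rewrite [LHS]mxE [X in _ + X]mxE.
    exact: le_trans B.
  by apply: plane_norm_le; rewrite ?mulr_ge0 ?invr_ge0.
have zz : `|z - z| <= r1 by rewrite subrr normr0 ltW.
have Kz : K z = 0.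
  have [_ _] := path z b zz ab (lexx b); rewrite subrr normr0 mulr0 normr_le0 subr_eq0 => /eqP h.
  by rewrite /K h subrr.
(* The other half of [r1] is left for the displacement, so that [Phi] maps the ball [B] into
   itself. *)
exists (r1 / 2); first by rewrite divr_gt0.
move=> w1; rewrite -ball_normE /= distrC => /ltW w1z.
pose B := [set w | `|w - z| <= r1].
pose Phi w := w1 - K w.
have PhiB : set_fun B B Phi.
  move=> w Bw; rewrite /B /Phi /=.
  have -> : w1 - K w - z = (w1 - z) - (K w - K z) by rewrite Kz subr0 addrAC.
  apply: le_trans (ler_normB _ _) _.
  have h := Klip w z Bw zz; rewrite (splitr r1); apply: lerD => //.
  apply: le_trans h _; rewrite [leRHS]mulrC; exact: ler_wpM2l.
have nc : continuous (fun u : plane R => `|u - z|).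
  move=> u; have sc := @cvgB _ _ _ (nbhs u) _ id (cst z) u z cvg_id (cvg_cst z).
  exact: (continuous_cvg _ (@norm_continuous _ _ (u - z)) (sc _ _)).
have cB : closed B.
  rewrite (_ : B = (fun u : plane R => `|u - z|) @^-1` [set x | x <= r1])//.
  by apply: closed_comp => [u _|]; [exact: nc|exact: closed_le].
have compB : compact B.
  apply: bounded_closed_compact => //.
  exists (`|z| + r1); split; first exact: num_real.
  move=> N hN u /= Cu; apply: le_trans (ltW hN).
  by rewrite -[u](subrK z) addrC (le_trans (ler_normD _ _))// lerD2l.
have Phi_dist x y' : B x -> B y' -> `|Phi x - Phi y'| <= 2^-1 * `|x - y'|.
  by move=> Bx By; rewrite [Phi x - _]subr_subl normrN; exact: Klip.
have fc : {within B, continuous (fun w => `|Phi w - w|)}.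
  apply/subspace_continuousP => w Bw; apply/cvgrPdist_le => d d0.
  have d2 : 0 < d / 2 by rewrite divr_gt0.
  have : \forall w' \near w, B w' -> `|(`|Phi w - w| - `|Phi w' - w'|)| <= d.
    have : \forall w' \near w, `|w - w'| < d / 2.
      by apply/nbhs_ballP; exists (d / 2) => // w'; rewrite -ball_normE.
    apply: filterS => w' ww' Bw'; apply: le_trans (ler_dist_dist _ _) _.
    have -> : Phi w - w - (Phi w' - w') = (Phi w - Phi w') - (w - w') by exact: subr_exchange.
    apply: le_trans (ler_normB _ _) _; have h := Phi_dist w w' Bw Bw'.
    rewrite (splitr d); apply: lerD; last exact: ltW.
    apply: le_trans h _; apply: le_trans (ltW ww').
    by rewrite ler_piMl// invf_le1// ler1n.
  exact.
(* A fixed point of the contraction [Phi]: the length of [Phi w - w] attains its minimum on the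
   compact ball, and applying [Phi] at least halves this length, so the minimum is 0. *)
have [w /[!inE] Bw wmin] := EVT_min_rV (ex_intro _ z zz) compB fc.
have wE : Phi w = w.
  apply/eqP; rewrite -subr_eq0 -normr_le0 leNgt; apply/negP => pos.
  have := wmin (Phi w); rewrite inE => /(_ (PhiB _ Bw)).
  have := Phi_dist _ _ (PhiB _ Bw) Bw.
  by move: pos; move: `|Phi (Phi w) - Phi w| `|Phi w - w| => p q; lra.
exists (pt w).
have [Db _ _] := path w b Bw ab (lexx b).
rewrite -(chart_mapK Db); congr (chart_inv D _).
have : w = w1 - K w by rewrite -[LHS]wE.
rewrite /K => h; apply/esym/eqP; rewrite -subr_eq0; apply/eqP/(addIr w).
by rewrite add0r [RHS]h opprB addrA addrAC.
Qed.

(** The conjugacy relates the fields at time 1 only at points of the form [phi 1 p]; this shows that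
    near a stationary point every point has that form. *)
Lemma isotopy_surjective_near : exists2 r, 0 < r &
  forall w, ball z r w -> exists p, phi 1 p = chart_inv D w.
Proof.
have [N N0 LN] := step_count.
suff step n : (n <= N)%N -> exists2 r, 0 < r &
    forall w, ball z r w -> exists p, phi (n%:R / N%:R) p = chart_inv D w.
  by have := step N (leqnn N); rewrite divff// gt_eqF.
elim: n => [|n IH] nN.
  by exists 1 => // w _; exists (chart_inv D w); rewrite mul0r phi0.
have [r r0 Hr] := IH (ltnW nN).
apply: (@image_step (n%:R / N%:R) (n.+1%:R / N%:R) r) => //.
- by rewrite ler_pM2r ?invr_gt0// ler_nat.
- by rewrite ler_pdivrMr// mul1r ler_nat.
- by rewrite -mulrBl -natrB// subSnn mul1r.
Qed.

End NearZero.

End Isotopy.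

(** * Transport of the Hamiltonian fields by the conjugacy *)

Lemma diff_left_inverse_inj (R : realType) (f g : plane R -> plane R) (x v : plane R) :
  differentiable f x -> differentiable g (f x) -> (\forall y \near x, g (f y) = y) ->
  'd f x v = 0 -> v = 0.
Proof.
move=> df dg gf fv0.
suff LK : cancel ('d f x) ('d g (f x)) by apply: (can_inj LK); rewrite fv0 linear0.
move=> w; have := @diff_comp _ _ _ _ f g x df dg => /(congr1 (@^~ w)) /= <-.
have E : \forall y \near x, id y = (g \o f) y by apply: filterS gf => y /= ->.
have [_ ->] := near_eq_differentiable E (@ex_diff _ _ _ _ _ _ _ (is_diff_id x)).
by rewrite diff_val.
Qed.

Section Conjugacy.
Context {R : realType} (M : symplectic_surface R) (D : chart R M).
Hypothesis darbouxD : darboux_chart D.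
Variable psi : M -> M.
Variable psi_inv : M -> M.
Hypothesis psiK : cancel psi psi_inv.
Hypothesis psi_invK : cancel psi_inv psi.
Hypothesis psi_C1 : C1_map psi.
Hypothesis psi_inv_C1 : C1_map psi_inv.
Implicit Types (u v w : plane R) (c : chart R M).

Definition in_chart c (f : M -> M) : plane R -> plane R := c \o f \o chart_inv D.

(** The coordinates at which [in_chart c f] is meaningful, chart maps and their inverses being total
    functions. *)
Definition chart_good c (f : M -> M) u : Prop :=
  chart_img D u /\ chart_dom c (f (chart_inv D u)).

Let aD : atlas D. Proof. by case: darbouxD. Qed.

Lemma chart_good_open c (f : M -> M) u : continuous f -> chart_good c f u ->
  \forall x \near u, chart_good c f x.
Proof.
move=> fc gu; apply: open_nbhs_nbhs; split=> //.
have -> : chart_good c f = [set u | chart_img D u /\ (f @^-1` chart_dom c) (chart_inv D u)] by [].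
apply: open_chart_preimage; apply: open_comp => [p _|]; [exact: fc|exact: chart_dom_open].
Qed.

Lemma in_chart_C1_at c u : atlas c -> chart_good c psi u -> C1_at (in_chart c psi) u.
Proof.
move=> ac gu; have [pc H] := psi_C1.
apply: (@Ck_on1_C1_at _ _ _ [set u | chart_good c psi u]) => //.
  by rewrite openE => x; exact: chart_good_open.
have := H D c aD ac; rewrite chart_preimageE.
exact.
Qed.

(** The target chart is arbitrary because this is applied before the image under [psi] is known to
    lie in the domain of [D]. *)
Lemma in_chart_diff_inj c u v : atlas c -> chart_good c psi u ->
  'd (in_chart c psi) u v = 0 -> v = 0.
Proof.
move=> ac gu; have dP := C1_at_diff (in_chart_C1_at ac gu).
have [pc H] := psi_C1; have [qc Hq] := psi_inv_C1.
pose Q : plane R -> plane R := D \o psi_inv \o chart_inv c.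
have cP : chart_img c (in_chart c psi u) by apply: chart_imgP; case: gu.
have dQ : differentiable Q (in_chart c psi u).
  have := Hq c D ac aD; rewrite chart_preimageE => -[dQ _]; apply: dQ; split=> //.
  rewrite /= /in_chart /= chart_mapK; last by case: gu.
  by rewrite psiK; apply: chart_inv_dom; case: gu.
apply: (diff_left_inverse_inj dP dQ).
apply: filterS (chart_good_open pc gu) => x [Vx gx].
by rewrite /Q /in_chart /= chart_mapK// psiK chart_invK.
Qed.

Lemma in_chart_loc_diffeo u : chart_good D psi u -> loc_diffeo (in_chart D psi) u.
Proof.
move=> gu; split; first exact: in_chart_C1_at.
have [Vu gu'] := gu; have [pc _] := psi_C1; have [qc Hq] := psi_inv_C1.
have VP : chart_img D (in_chart D psi u) by exact: chart_imgP.
have gQ : chart_good D psi_inv (in_chart D psi u).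
  by split=> //; rewrite /in_chart /= chart_mapK// psiK; exact: chart_inv_dom.
exists (in_chart D psi_inv); split.
- by have := Hq D D aD aD; rewrite chart_preimageE => -[dQ _]; apply: dQ.
- apply: filterS (chart_good_open pc gu) => x [Vx gx].
  by rewrite /in_chart /= chart_mapK// psiK chart_invK.
- apply: filterS (chart_good_open qc gQ) => x [Vx gx].
  by rewrite /in_chart /= chart_mapK// psi_invK chart_invK.
Qed.

Variables (F H : R -> M -> R) (phiF phiH : R -> M -> M).
Hypothesis phiF_isotopy : hamiltonian_isotopy F phiF.
Hypothesis phiH_isotopy : hamiltonian_isotopy H phiH.
Hypothesis conj : forall t, t \in `[0, 1] -> psi \o phiF t = phiH t \o psi.
Local Notation f t := (fun x : plane R => F t (chart_inv D x) : R^o).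
Local Notation h t := (fun x : plane R => H t (chart_inv D x) : R^o).

(** The path of [psi p] under the flow of [H] is the image of the path of [p]. Its velocity is given
    both by the field of [H] and by the chain rule, and velocities are unique. The relation is
    obtained at the point [phiF t p], not at a prescribed point. *)
Lemma conj_hamiltonian_vector t p c : t \in `[0, 1] -> atlas c ->
  chart_dom D (phiF t p) -> chart_dom c (psi (phiF t p)) ->
  hamiltonian_vector (H t) c (c (psi (phiF t p)))
    ('d (in_chart c psi) (D (phiF t p)) (ham (f t) (D (phiF t p)))).
Proof.
move=> t01 ac Dp cp.
have pE s : s \in `[0, 1] -> psi (phiF s p) = phiH s (psi p).
  by move=> s01; have := congr1 (@^~ p) (conj s01).
have gp : chart_good c psi (D (phiF t p)).
  by split; [exact: chart_imgP|rewrite chart_mapK].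
have dP := C1_at_diff (in_chart_C1_at ac gp).
have v1 := isotopy_velocity darbouxD phiF_isotopy t01 Dp.
have v2 := velocity_comp t01 (isotopy_continuous phiF_isotopy (p := p)) Dp dP v1.
have [_ _ HH] := phiH_isotopy.
have cp' : chart_dom c (phiH t (psi p)) by rewrite -pE.
have [X HX vX] := HH (psi p) t c t01 ac cp'.
rewrite -pE// in HX.
suff <- : X = 'd (in_chart c psi) (D (phiF t p)) (ham (f t) (D (phiF t p))) by [].
apply: (velocity_unique t01 vX).
have E : \forall s \near punctured t,
    (s - t)^-1 *: (c ((psi \o (fun s => phiF s p)) s) - c ((psi \o (fun s => phiF s p)) t)) =
    (s - t)^-1 *: (c (phiH s (psi p)) - c (phiH t (psi p))).
  have : \forall s \near t, (`[0, 1]%classic `\ t) s ->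
      (s - t)^-1 *: (c ((psi \o (fun s => phiF s p)) s) - c ((psi \o (fun s => phiF s p)) t)) =
      (s - t)^-1 *: (c (phiH s (psi p)) - c (phiH t (psi p))).
    by apply: filterE => s [s01 _] /=; rewrite (pE s s01) (pE t t01).
  exact.
exact: cvg_trans (near_eq_cvg E) v2.
Qed.

Lemma conj_ham t p : t \in `[0, 1] -> chart_dom D (phiF t p) -> chart_dom D (psi (phiF t p)) ->
  'd (in_chart D psi) (D (phiF t p)) (ham (f t) (D (phiF t p))) =
  ham (h t) (in_chart D psi (D (phiF t p))).
Proof.
move=> t01 Dp Dpsi; apply: ham_unique => v.
have := conj_hamiltonian_vector t01 aD Dp Dpsi v.
rewrite /area_form; have [_ ->] := darbouxD; last exact: chart_imgP.
by rewrite mul1r /in_chart /= chart_mapK.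
Qed.

End Conjugacy.

(** * The twist on the surface and its inverse *)

Section SurfaceTwist.
Context {R : realType}.
Implicit Types (u v : plane R).

(** A Hamiltonian vector is characterized by its determinants with all vectors. These are preserved
    by ['d B u], whose surjectivity lets every test vector be written as an image. *)
Lemma ham_symplectic (B : plane R -> plane R) (f : plane R -> R^o) u :
  loc_diffeo B u -> (forall v w, det2 ('D_v B u) ('D_w B u) = det2 v w) ->
  differentiable f (B u) -> 'd B u (ham (f \o B) u) = ham f (B u).
Proof.
move=> Bd Bdet df; have dB := loc_diffeo_diff Bd.
apply: ham_unique => z; have [w <-] := loc_diffeo_surj z Bd.
have dfB : differentiable (f \o B) u := differentiable_comp dB df.
have e1 := Bdet (ham (f \o B) u) w.
have e2 := det2_ham w dfB.
have e3 := @derive_comp _ _ _ _ B f u w dB df.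
move: e1 e3; rewrite !deriveE// => e1 e3.
by rewrite e1 e2 deriveE// e3.
Qed.

(* [rho] is only controlled on [`]0, 1]]; with [0] beyond [1] the plane twist is globally defined and is the identity off the disk. *)
Definition cutoff (rho : R -> R) (r : R) : R := if r <= 1 then rho r else 0.

Lemma cutoff_C1_at (rho : R -> R) : smooth_on (`]0, 1] : set R^o) (rho : R^o -> R^o) ->
  (exists2 e : R, 0 < e & forall r : R, r \in `]0, 1] -> 1 - e < r -> rho r = 0) ->
  forall r : R, 0 < r -> C1_at (cutoff rho : R^o -> R^o) r.
Proof.
move=> rho_smooth [e e0 rho1] r r0; have [r1|r1] := ltP r 1.
  have r01 : `]0, 1]%classic r by rewrite /= in_itv/= r0 ltW.
  have [U [g [oU Ur Cg gE]]] := rho_smooth r r01.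
  apply: C1_at_ext (Ck_on1_C1_at oU Ur (Cg 1%N)).
  have HU : \forall x \near (r : R^o), U x by exact: open_nbhs_nbhs.
  have H0 : \forall x \near (r : R^o), (0 : R) < x by exact: (lt_nbhsr r0).
  have H1 : \forall x \near (r : R^o), (x : R) < 1 by exact: (lt_nbhsl r1).
  apply: filterS3 HU H0 H1 => x Ux x0 x1; rewrite /cutoff (ltW x1); apply/esym/gE => //.
  by rewrite /= in_itv/= x0 ltW.
apply: C1_at_ext (C1_at_cst (0 : R^o) (r : R^o)).
have H0 : \forall x \near (r : R^o), (0 : R) < x by exact: (lt_nbhsr r0).
have r1e : 1 - e < r by rewrite (lt_le_trans _ r1)// gtrBl.
have H1 : \forall x \near (r : R^o), 1 - e < (x : R) by exact: (lt_nbhsr r1e).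
apply: filterS2 H0 H1 => x x0 x1; rewrite /cutoff; case: ifPn => // xle.
by rewrite rho1// in_itv/= x0.
Qed.

Lemma twist_cutoff (a : R) (rho : R -> R) u : 0 < a -> edisk a u ->
  twist a (cutoff rho) u = twist a rho u.
Proof. by move=> a0 ua; rewrite /twist /cutoff ler_pdivrMr// mul1r ua. Qed.

Lemma rotation_id u : rotation 0 u = u.
Proof. by apply: plane_eq; rewrite /rotation ?vec2E0 ?vec2E1 cos0 sin0; ring. Qed.

Lemma twist_id (a : R) (rho : R -> R) u : 0 < a -> (forall r, 1 < r -> rho r = 0) ->
  ~ edisk a u -> twist a rho u = u.
Proof.
move=> a0 rho1 /negP; rewrite -ltNge => ua; rewrite twistE rho1 ?rotation_id//.
by rewrite ltr_pdivlMr// mul1r.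
Qed.

Variables (M : topologicalType) (D : chart R M) (a : R) (rho : R -> R).
Hypothesis a_gt0 : 0 < a.
Hypothesis diskD : edisk a `<=` chart_img D.
Variable phi_rho_inv : M -> M.
Hypothesis phi_rhoK : cancel (surface_twist D a rho) phi_rho_inv.
Hypothesis phi_rhoVK : cancel phi_rho_inv (surface_twist D a rho).
Let untwist := twist a (fun r => - cutoff rho r).

Lemma twist_img (rho' : R -> R) u : (forall r, 1 < r -> rho' r = 0) -> chart_img D u ->
  chart_img D (twist a rho' u).
Proof.
move=> rho1 Du; have [ua|ua] := pselect (edisk a u); last by rewrite twist_id.
by apply: diskD; rewrite /edisk /= twist_enorm.
Qed.

Lemma cutoff_gt1 (r : R) : 1 < r -> cutoff rho r = 0.
Proof. by move=> r1; rewrite /cutoff leNgt r1. Qed.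

Lemma cutoffN_gt1 (r : R) : 1 < r -> - cutoff rho r = 0.
Proof. by move=> r1; rewrite cutoff_gt1 ?oppr0. Qed.

Lemma surface_twistE u : chart_img D u ->
  surface_twist D a rho (chart_inv D u) = chart_inv D (twist a (cutoff rho) u).
Proof.
move=> Du; rewrite /surface_twist chart_invK//; case: asboolP => [[_ ua]|nu].
  by rewrite twist_cutoff.
have ua : ~ edisk a u by move=> ua; apply: nu; split=> //; exact: chart_inv_dom.
by rewrite twist_id//; exact: cutoff_gt1.
Qed.

(** The inverse is given abstractly; injectivity of the twist identifies it with the opposite twist
    in the chart. *)
Lemma phi_rho_invE u : chart_img D u ->
  phi_rho_inv (chart_inv D u) = chart_inv D (untwist u).
Proof.
move=> Du; apply: (can_inj phi_rhoK); rewrite phi_rhoVK surface_twistE ?twistNK//.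
by apply: twist_img => // r; exact: cutoffN_gt1.
Qed.

Lemma phi_rho_inv_out p : ~ chart_dom D p -> phi_rho_inv p = p.
Proof.
move=> np; apply: (can_inj phi_rhoK); rewrite phi_rhoVK /surface_twist.
by case: asboolP => // -[].
Qed.

End SurfaceTwist.

(** * Auxiliary facts in the plane *)

Lemma lipschitz_eq (R : realType) (A : set (plane R)) (f g : plane R -> plane R) :
  (forall u, A u -> f u = g u) -> [lipschitz f u | u in A] -> [lipschitz g u | u in A].
Proof.
move=> fg; rewrite /lipschitz_on; apply: filterS => N HN [u v] [/= Au Av].
by have := HN (u, v) (conj Au Av); rewrite /= !fg.
Qed.

Section PlaneFacts.
Context {R : realType}.
Implicit Types (u v : plane R).

Lemma diff_comp_chain (f g : plane R -> plane R) u v w z :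
  differentiable f u -> differentiable g (f u) -> 'd f u v = w -> 'd g (f u) w = z ->
  'd (g \o f) u v = z.
Proof. by move=> df dg <- <-; have := @diff_comp _ _ _ _ f g u df dg => /(congr1 (@^~ v)). Qed.

Lemma near_preimage (T U : topologicalType) (f : T -> U) x (Q : U -> Prop) :
  {for x, continuous f} -> (\forall y \near f x, Q y) -> \forall z \near x, Q (f z).
Proof. by move=> fc nQ; exact: fc _ nQ. Qed.

Lemma diff0E (f : plane R -> plane R) u v : v = 0 -> 'd f u v = 0.
Proof. by move=> ->; exact: linear0. Qed.

Lemma ham_near_eq (f g : plane R -> R^o) u : (\forall x \near u, f x = g x) -> ham f u = ham g u.
Proof. by move=> E; congr vec2; [|congr (- _)]; exact: near_eq_derive. Qed.

Lemma quad_le_norm (s : R) u : quad s u <= (s ^+ 2 + (s ^+ 2)^-1) * `|u| ^+ 2.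
Proof.
rewrite /quad mulrDl; apply: lerD.
  by rewrite ler_wpM2l ?sqr_ge0// -[leLHS]real_normK ?num_real// ler_sqr ?nnegrE// coord_le.
rewrite mulrC ler_wpM2l ?invr_ge0 ?sqr_ge0//.
by rewrite -[leLHS]real_normK ?num_real// ler_sqr ?nnegrE// coord_le.
Qed.

Lemma norm_le_quad2 u : `|u| ^+ 2 <= 4 * quad 2 u.
Proof.
have : `|u| ^+ 2 <= sqnorm u by rewrite -enorm_sqr ler_sqr ?nnegrE ?norm_le_enorm ?enorm_ge0.
move=> h; apply: le_trans h _; rewrite /quad /sqnorm.
have := sqr_ge0 (u 0 0); move: (u 0 0 ^+ 2) (u 0 1 ^+ 2) => x y x0.
by rewrite -natrX; lra.
Qed.

Lemma ham_model_neq0 u : u != 0 -> ham (model_hamiltonian 2) u != 0.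
Proof.
move=> u0; rewrite ham_model// scaler_eq0 negb_or; apply/andP; split.
  have q0 : 0 < quad 2 u by rewrite quad_gt0// pnatr_eq0.
  by rewrite mulf_neq0 ?invr_eq0 ?expf_neq0 ?gt_eqF// model_gt0.
apply: contra u0 => /eqP E; apply/eqP/plane_eq; rewrite mxE.
  have /(congr1 (fun w : plane R => w 0 1)) := E; rewrite vec2E1 mxE; lra.
have /(congr1 (fun w : plane R => w 0 0)) := E; rewrite vec2E0 mxE; lra.
Qed.

(** No derivative of [B] enters: a radius preserving [B] leaves a quadratic bound on [g], which
    forces its derivatives at 0 to vanish. The case of the inverse twist treats [H] at the center,
    where the twist itself is not smooth. *)
Lemma ham_model_isometry (g : plane R -> R^o) (B : plane R -> plane R) (s : R) : s != 0 ->
  (forall u, enorm (B u) = enorm u) ->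
  (\forall u \near (0 : plane R), g u = model_hamiltonian s (B u)) -> ham g 0 = 0.
Proof.
move=> s0 Be gE.
have B0 : B 0 = 0.
  by apply/eqP; rewrite -[_ == _]negbK -enorm_gt0 Be enorm0 ltxx.
have g0 : g 0 = 0 by have := nbhs_singleton gE; rewrite B0 model0.
have bound : \forall u \near (0 : plane R),
    `|g u| <= (s ^+ 2 + (s ^+ 2)^-1) * 4 * `|u| ^+ 2.
  apply: filterS gE => u ->; rewrite ger0_norm ?model_ge0//.
  apply: le_trans (model_le_quad (B u) s0) _; apply: le_trans (quad_le_norm s (B u)) _.
  rewrite -mulrA; apply: ler_wpM2l; first by rewrite addr_ge0 ?invr_ge0 ?sqr_ge0.
  have -> : 4 * `|u| ^+ 2 = (2 * `|u|) ^+ 2 by ring.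
  rewrite ler_sqr ?nnegrE ?mulr_ge0//.
  by apply: le_trans (enorm_le_norm u); rewrite -Be; exact: norm_le_enorm.
have d v : 'D_v g 0 = 0 := derive_flat v g0 bound.
by rewrite /ham !d; apply: plane_eq; rewrite ?vec2E0 ?vec2E1 ?oppr0 mxE.
Qed.

Lemma near0_neq0 (P : plane R -> Prop) : (\forall u \near (0 : plane R), P u) ->
  exists2 u, u != 0 & P u.
Proof.
move=> /nbhs_ballP[e /= e0 He]; have e2 : 0 < e / 2 by rewrite divr_gt0.
exists (vec2 (e / 2) 0).
  by apply/eqP => /(congr1 (fun w : plane R => w 0 0)); rewrite vec2E0 mxE => h; rewrite h ltxx in e2.
apply: He; rewrite -ball_normE /= sub0r normrN.
apply: (@le_lt_trans _ _ (e / 2)); last by rewrite ltr_pdivrMr// ltr_pMr// ltr1n.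
by apply: plane_norm_le; rewrite ?(ltW e2)// ?vec2E0 ?vec2E1 ?normr0 ?(ltW e2)// gtr0_norm.
Qed.

Lemma closed_edisk (a : R) : closed (edisk a : set (plane R)).
Proof.
rewrite (_ : edisk a = (enorm : plane R -> R) @^-1` [set x | x <= a])//.
by apply: closed_comp => [u _|]; [exact: enorm_continuous|exact: closed_le].
Qed.

Lemma compact_edisk (a : R) : compact (edisk a : set (plane R)).
Proof.
apply: bounded_closed_compact; last exact: closed_edisk.
exists a; split; first exact: num_real.
by move=> N aN u ua; apply: le_trans (ltW aN); apply: le_trans ua; exact: norm_le_enorm.
Qed.

End PlaneFacts.

(** * The orbit of the center *)

Section Rigidity.
Context {R : realType} (M : symplectic_surface R) (D : chart R M).
Hypothesis darbouxD : darboux_chart D.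
Variables (a : R) (rho : R -> R) (phi_rho_inv : M -> M).
Hypothesis a_gt0 : 0 < a.
Hypothesis diskD : edisk a `<=` chart_img D.
Hypothesis rhoC1 : forall r : R, 0 < r -> C1_at (cutoff rho : R^o -> R^o) r.
Hypothesis phi_rhoK : cancel (surface_twist D a rho) phi_rho_inv.
Hypothesis phi_rhoVK : cancel phi_rho_inv (surface_twist D a rho).
Variable sigma : R -> R.
Hypothesis sigma_neq0 : forall t : R, t \in `[0, 1] -> sigma t != 0.
Hypothesis sigma0 : sigma 0 = 2.
Hypothesis sigma1 : sigma 1 = 2^-1.
Variables F H : R -> M -> R.
Hypothesis F_smooth : smooth_hamiltonian F.
Hypothesis F_near0 : \forall u \near (0 : plane R), forall t : R, t \in `[0, 1] ->
  F t (chart_inv D u) = model_hamiltonian (sigma t) u.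
Variable K : set M.
Hypothesis compactK : compact K.
Hypothesis KD : K `<=` chart_dom D.
Hypothesis F_out : forall (t : R) (p : M), t \in `[0, 1] -> ~ K p -> F t p = 0.
Hypothesis H_def : forall (t : R) (p : M), H t p = F t (phi_rho_inv p).
Variables phiF phiH : R -> M -> M.
Hypothesis phiF_isotopy : hamiltonian_isotopy F phiF.
Hypothesis phiH_isotopy : hamiltonian_isotopy H phiH.
Variables psi psi_inv : M -> M.
Hypothesis psiK : cancel psi psi_inv.
Hypothesis psi_invK : cancel psi_inv psi.
Hypothesis psi_C1 : C1_map psi.
Hypothesis psi_inv_C1 : C1_map psi_inv.
Hypothesis psi_conj : forall t, t \in `[0, 1] -> psi \o phiF t = phiH t \o psi.

Local Notation f t := (fun x : plane R => F t (chart_inv D x) : R^o).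
Local Notation h t := (fun x : plane R => H t (chart_inv D x) : R^o).
Local Notation V := (chart_img D).
Local Notation P := (in_chart D D psi).
Let tau : plane R -> plane R := twist a (fun r => - cutoff rho r).
Let twisted : plane R -> plane R := tau \o P.

Let zero01 : (0 : R) \in `[0, 1]. Proof. by rewrite in_itv/= lexx ler01. Qed.
Let one01 : (1 : R) \in `[0, 1]. Proof. by rewrite in_itv/= lexx ler01. Qed.
Let aD : atlas D. Proof. by case: darbouxD. Qed.
Let phiF0 p : phiF 0 p = p. Proof. by case: phiF_isotopy => E _ _; exact: E. Qed.

Let rhoNC1 r : 0 < r -> C1_at ((fun x => - cutoff rho x) : R^o -> R^o) r.
Proof. by move=> r0; apply: C1_at_opp; exact: rhoC1. Qed.

Let tau_img u : V u -> V (tau u).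
Proof. by move=> Vu; apply: twist_img => // r; exact: cutoffN_gt1. Qed.

Let hE t u : V u -> H t (chart_inv D u) = F t (chart_inv D (tau u)).
Proof. by move=> Vu; rewrite H_def (phi_rho_invE a_gt0 diskD phi_rhoK phi_rhoVK Vu). Qed.

Let tau_diffeo u : u != 0 -> loc_diffeo tau u.
Proof. exact: twist_loc_diffeo. Qed.

Let ham_tau t u : t \in `[0, 1] -> V u -> u != 0 ->
  'd tau u (ham (h t) u) = ham (f t) (tau u).
Proof.
move=> t01 Vu u0.
have E : ham (h t) u = ham (f t \o tau) u.
  by apply: ham_near_eq; apply: filterS (near_chart_img Vu) => x Vx; exact: hE.
rewrite E; apply: (@ham_symplectic R tau (f t)).
- exact: tau_diffeo.
- by move=> v w; exact: det2_derive_twist.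
- exact: C1_at_diff (hamiltonian_C1_at aD F_smooth t01 (tau_img Vu)).
Qed.

Let V0 : V 0.
Proof. by apply: diskD; rewrite /edisk /= enorm0 ltW. Qed.

Let ham_f_0 t : t \in `[0, 1] -> ham (f t) 0 = 0.
Proof.
move=> t01; apply: (@ham_model_isometry R _ id (sigma t)) => //; first exact: sigma_neq0.
by apply: filterS F_near0 => u /(_ t t01).
Qed.

Let near_h t : t \in `[0, 1] ->
  \forall u \near (0 : plane R), H t (chart_inv D u) = model_hamiltonian (sigma t) (tau u).
Proof.
move=> t01; have tc : tau x @[x --> (0 : plane R)] --> (0 : plane R).
  by rewrite -[X in _ --> X](twist0 a (fun r => - cutoff rho r)); exact: twist_continuous0.
have E : \forall u \near (0 : plane R), F t (chart_inv D (tau u)) = model_hamiltonian (sigma t) (tau u).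
  have Ft : \forall u \near (0 : plane R), F t (chart_inv D u) = model_hamiltonian (sigma t) u.
    by apply: filterS F_near0 => u /(_ t t01).
  exact: tc _ Ft.
by apply: filterS2 E (near_chart_img V0) => u Eu Vu; rewrite hE.
Qed.

Let ham_h_0 t : t \in `[0, 1] -> ham (h t) 0 = 0.
Proof.
move=> t01; apply: (@ham_model_isometry R _ tau (sigma t)); first exact: sigma_neq0.
  by move=> u; exact: twist_enorm.
exact: near_h.
Qed.

(** The support of [F] need not be invariant under the twist; with the disk added it is, remains
    compact inside the chart domain, and also contains the support of [H]. *)
Let K1 : set M := K `|` chart_inv D @` edisk a.

Let K1D : K1 `<=` chart_dom D.
Proof. by move=> p [/KD//|[u ua <-]]; apply: chart_inv_dom; exact: diskD. Qed.

Let compactK1 : compact K1.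
Proof.
apply: compactU => //; apply: continuous_compact; last exact: compact_edisk.
apply: continuous_in_subspaceT => u; rewrite inE => ua.
exact: chart_inv_continuous_at (diskD ua).
Qed.

Let closedK1 : closed K1.
Proof. by apply: compact_closed => //; exact: surface_hausdorff. Qed.

Let K1_tau u : V u -> K1 (chart_inv D u) -> K1 (chart_inv D (tau u)).
Proof.
move=> Vu Ku; have [ua|ua] := pselect (edisk a u).
  by right; exists (tau u) => //; rewrite /edisk /= twist_enorm.
by rewrite /tau twist_id// => r; exact: cutoffN_gt1.
Qed.

Let H_out t p : t \in `[0, 1] -> ~ K1 p -> H t p = 0.
Proof.
move=> t01 nK; rewrite H_def; apply: F_out => // Kp; apply: nK.
have [Dp|nD] := pselect (chart_dom D p); last by left; rewrite -(phi_rho_inv_out phi_rhoK phi_rhoVK nD).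
have Vp := chart_imgP Dp; move: Kp; rewrite -[p in phi_rho_inv p](chart_mapK Dp).
rewrite (phi_rho_invE a_gt0 diskD phi_rhoK phi_rhoVK Vp).
have [ua|ua] := pselect (edisk a (D p)).
  by move=> _; right; exists (D p) => //; exact: chart_mapK.
rewrite twist_id//; last by move=> r; exact: cutoffN_gt1.
by rewrite chart_mapK// => Kp; left.
Qed.

Let good z : Prop := chart_good D D psi z.

Let good_of_K1 z : V z -> K1 (psi (chart_inv D z)) -> good z.
Proof. by move=> Vz Kz; split=> //; exact: K1D. Qed.

Let P_img z : good z -> V (P z).
Proof. by move=> [_ Dz]; exact: chart_imgP. Qed.

Let chart_inv_P z : good z -> chart_inv D (P z) = psi (chart_inv D z).
Proof. by move=> [_ Dz]; exact: chart_mapK. Qed.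

Let P_diffeo z : good z -> loc_diffeo P z.
Proof. exact: (in_chart_loc_diffeo darbouxD psiK psi_invK psi_C1 psi_inv_C1). Qed.

Let twisted_diffeo z : good z -> P z != 0 -> loc_diffeo twisted z.
Proof. by move=> gz Pz; apply: loc_diffeo_comp; [exact: P_diffeo|exact: tau_diffeo]. Qed.

Let twisted_img z : good z -> V (twisted z).
Proof. by move=> gz; apply: tau_img; exact: P_img. Qed.

Let twisted_K1 z : good z -> K1 (psi (chart_inv D z)) -> K1 (chart_inv D (twisted z)).
Proof. by move=> gz Kz; apply: K1_tau; [exact: P_img|rewrite chart_inv_P]. Qed.

Let related t z : Prop := 'd P z (ham (f t) z) = ham (h t) (P z).

Let related_image t p z : t \in `[0, 1] -> phiF t p = chart_inv D z -> good z -> related t z.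
Proof.
move=> t01 pz [Vz Dz]; have Dp : chart_dom D (phiF t p) by rewrite pz; exact: chart_inv_dom.
have Dq : chart_dom D (psi (phiF t p)) by rewrite pz.
have := conj_ham darbouxD psi_C1 phiF_isotopy phiH_isotopy psi_conj t01 Dp Dq.
by rewrite /related pz chart_invK.
Qed.

Let related0 z : good z -> related 0 z.
Proof. exact: related_image (phiF0 _). Qed.

Let twisted_conj t z : t \in `[0, 1] -> good z -> P z != 0 -> related t z ->
  'd twisted z (ham (f t) z) = ham (f t) (twisted z).
Proof.
move=> t01 gz Pz rz.
have dP := loc_diffeo_diff (P_diffeo gz); have dt := loc_diffeo_diff (tau_diffeo Pz).
exact: (diff_comp_chain dP dt rz (ham_tau t01 (P_img gz) Pz)).
Qed.

(** Outside the closed set [K1] the function [H 0] vanishes locally, and so does its field. The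
    differential of [psi] is injective, so the field of [F 0] would vanish at [u] as well. *)
Let reg_K1 u : V u -> ham (f 0) u != 0 -> K1 (psi (chart_inv D u)).
Proof.
move=> Vu /eqP fu; apply: contrapT => nK; apply: fu.
have [c ac cp] := atlas_cover (psi (chart_inv D u)).
have Dp : chart_dom D (phiF 0 (chart_inv D u)) by rewrite phiF0; exact: chart_inv_dom.
have cp' : chart_dom c (psi (phiF 0 (chart_inv D u))) by rewrite phiF0.
have := conj_hamiltonian_vector darbouxD psi_C1 phiF_isotopy phiH_isotopy psi_conj zero01 ac Dp cp'.
rewrite phiF0 chart_invK// => HV.
have gu : chart_good D c psi u by split.
apply: (in_chart_diff_inj darbouxD psiK psi_C1 psi_inv_C1 ac gu).
apply: det2_eq0 => v; rewrite det2C.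
set w := c _ in HV; have cw : chart_img c w by exact: chart_imgP.
have E : \forall x \near w, (H 0 \o chart_inv c) x = (0 : R^o).
  have nK' : (~` K1) (chart_inv c w) by rewrite /w chart_mapK.
  have Kw : \forall x \near w, (~` K1) (chart_inv c x).
    exact: (chart_inv_continuous_at cw (open_nbhs_nbhs (conj (closed_openC closedK1) nK'))).
  by apply: filterS Kw => x Kx; exact: H_out.
have /eqP := HV v; rewrite /area_form.
have -> : 'D_v ((H 0 \o chart_inv c) : plane R -> R^o) w = 0.
  have E' : \forall x \near w, (H 0 \o chart_inv c) x = (cst 0 : plane R -> R^o) x by apply: filterS E.
  by rewrite (near_eq_derive v E') derive_cst.
by rewrite mulf_eq0 (negPf (area_density_neq0 ac cw)) /= => /eqP ->; rewrite oppr0.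
Qed.

(** The regular points, where the field of [F 0] is nonzero, are invariant under [twisted], and
    their images under [psi] avoid the center because the field of [H 0] vanishes there. The
    singularity of the twist is therefore never met. *)
Let reg_step u : V u -> ham (f 0) u != 0 ->
  [/\ good u, P u != 0, V (twisted u) & ham (f 0) (twisted u) != 0].
Proof.
move=> Vu fu; have gu := good_of_K1 Vu (reg_K1 Vu fu); have ru := related0 gu.
have Pu : P u != 0.
  apply: contra fu => /eqP Pu; apply/eqP/(loc_diffeo_inj (P_diffeo gu)).
  by rewrite ru Pu; exact: ham_h_0.
split=> //; first exact: twisted_img.
rewrite -(twisted_conj zero01 gu Pu ru); apply: contra fu => /eqP E.
by apply/eqP/(loc_diffeo_inj (twisted_diffeo gu Pu)).
Qed.

Let core : exists2 c : R, 0 < c & forall u, quad 2 u <= c ->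
  V u /\ forall t, t \in `[0, 1] -> ham (f t) u = ham (model_hamiltonian (sigma t)) u.
Proof.
have : \forall u \near (0 : plane R), V u /\ \forall x \near u, forall t : R, t \in `[0, 1] ->
    F t (chart_inv D x) = model_hamiltonian (sigma t) x.
  by apply: filterS2 (near_chart_img V0) (near_join F_near0) => u.
move=> /nbhs_ballP[r /= r0 Hr].
(* The sup norm satisfies [|u| ^+ 2 <= 4 * quad 2 u], so this level gives at most [r ^+ 2 / 2],
   strictly inside the ball. *)
exists (r ^+ 2 / 8); first by rewrite divr_gt0 ?exprn_gt0.
move=> u uc; have [Vu Fu] : V u /\ \forall x \near u, forall t : R, t \in `[0, 1] ->
    F t (chart_inv D x) = model_hamiltonian (sigma t) x.
  apply: Hr; rewrite -ball_normE /= sub0r normrN.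
  have r2 : 0 < r ^+ 2 by exact: exprn_gt0.
  by rewrite -ltr_sqr ?nnegrE ?(ltW r0)//; have := norm_le_quad2 u; move: uc r2; lra.
split=> // t t01; apply: ham_near_eq.
by apply: filterS Fu => x /(_ t t01).
Qed.

Section Orbit.
Variable c : R.
Hypothesis c_gt0 : 0 < c.
Hypothesis core_c : forall u, quad 2 u <= c ->
  V u /\ forall t, t \in `[0, 1] -> ham (f t) u = ham (model_hamiltonian (sigma t)) u.

Let A k : plane R -> plane R := iter k twisted.
Let y k : plane R := A k 0.

Let near_core : \forall u \near (0 : plane R), quad 2 u < c.
Proof.
have qc : quad 2 u @[u --> (0 : plane R)] --> (0 : R).
  by rewrite -[X in _ --> X](@quad0 R 2); exact: C1_at_continuous (quad_C1_at 2 0).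
exact: qc _ (lt_nbhsl c_gt0).
Qed.

(** The model field is nonzero off the center, so the nonzero points of the ellipse start regular
    and stay so under iteration, even where the orbit of the center itself is not yet under
    control. *)
Let orbit_reg k u : quad 2 u <= c -> u != 0 ->
  [/\ V (A k u), ham (f 0) (A k u) != 0, loc_diffeo (A k) u
    & 'd (A k) u (ham (model_hamiltonian 2) u) = ham (f 0) (A k u)].
Proof.
move=> uc u0; elim: k => [|k [Vk fk dk ek]].
  have [Vu fu] := core_c uc; have := fu 0 zero01; rewrite sigma0 => fu0.
  have du : 'd (@id (plane R)) u (ham (model_hamiltonian 2) u) = ham (model_hamiltonian 2) u by rewrite diff_val.
  split; [exact: Vu| |exact: (loc_diffeo_id u)|by apply: (etrans du); rewrite fu0].
  by rewrite [X in X != _]fu0; exact: ham_model_neq0.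
have [gk Pk Vk' fk'] := reg_step Vk fk; have dT := twisted_diffeo gk Pk.
split; [exact: Vk'|exact: fk'|exact: (loc_diffeo_comp dk dT)|].
exact: (diff_comp_chain (loc_diffeo_diff dk) (loc_diffeo_diff dT) ek
  (twisted_conj zero01 gk Pk (related0 gk))).
Qed.

(** Demanded at all times: the conjugacy passes on fixed points of the whole flow, not zeros of the
    field at a single time. *)
Let stationary z : Prop := forall t, t \in `[0, 1] -> ham (f t) z = 0.

Let S k : Prop := [/\ V (y k), loc_diffeo (A k) 0 & stationary (y k)].

Let S0 : S 0.
Proof. by split; [exact: V0|exact: loc_diffeo_id|move=> t; exact: ham_f_0]. Qed.

(** Although the field vanishes at [y k], this point is a limit of regular points [A k u], whose
    images under [psi] lie in the closed set [K1]. *)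
Let S_K1 k : S k -> K1 (psi (chart_inv D (y k))).
Proof.
move=> [Vy dA _]; apply: contrapT => nK.
have Ac : A k u @[u --> (0 : plane R)] --> y k := C1_at_continuous (dA.1).
have Dc : chart_inv D z @[z --> y k] --> chart_inv D (y k) := chart_inv_continuous_at Vy.
have pc : psi p @[p --> chart_inv D (y k)] --> psi (chart_inv D (y k)) := psi_C1.1 _.
have N1 : \forall p \near psi (chart_inv D (y k)), ~ K1 p.
  exact: open_nbhs_nbhs (conj (closed_openC closedK1) nK).
have N2 : \forall p \near chart_inv D (y k), ~ K1 (psi p) := pc _ N1.
have N3 : \forall z \near y k, ~ K1 (psi (chart_inv D z)) := Dc _ N2.
have N4 : \forall u \near (0 : plane R), ~ K1 (psi (chart_inv D (A k u))) := Ac _ N3.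
have [u u0 [uc nu]] := near0_neq0 (filterI near_core N4).
have [Vu fu _ _] := orbit_reg k (ltW uc) u0.
by apply: nu; exact: reg_K1.
Qed.

Let S_good k : S k -> good (y k).
Proof. by move=> Sk; case: (Sk) => Vy _ _; exact: good_of_K1 Vy (S_K1 Sk). Qed.

Let S_ham_h k t : S k -> t \in `[0, 1] -> ham (h t) (P (y k)) = 0.
Proof.
move=> Sk t01; have [_ Dq] := S_good Sk; have [Vy _ zy] := Sk.
have [L [e [L0 e0 Be Le]]] := ham_lipschitz aD F_smooth Vy.
have fixH s : s \in `[0, 1] -> phiH s (psi (chart_inv D (y k))) = psi (chart_inv D (y k)).
  move=> s01; have E := congr1 (@^~ (chart_inv D (y k))) (psi_conj s01).
  apply: (etrans (esym E)); rewrite /=; congr psi.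
  exact: (isotopy_fixed darbouxD phiF_isotopy L0 e0 Be Le zy s01).
exact: (fixed_ham_eq0 darbouxD phiH_isotopy fixH Dq t01).
Qed.

Let S_step k : S k -> P (y k) != 0 -> S k.+1.
Proof.
move=> Sk Py; have gy := S_good Sk; have [Vy dA zy] := Sk.
split; [exact: twisted_img|exact: loc_diffeo_comp dA (twisted_diffeo gy Py)|].
move=> t t01; apply: (etrans (esym (ham_tau t01 (P_img gy) Py))).
by apply: diff0E; exact: S_ham_h.
Qed.

Let twisted_inj u w : good u -> good w -> twisted u = twisted w -> u = w.
Proof.
move=> gu gw /(can_inj (twistNK a (cutoff rho))) E.
have : psi (chart_inv D u) = psi (chart_inv D w) by rewrite -!chart_inv_P// E.
move=> /(can_inj psiK) E2.
by rewrite -(chart_invK gu.1) E2 chart_invK//; exact: gw.1.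
Qed.

Let orbit_returns : ~ forall k, P (y k) != 0.
Proof.
move=> Py; have Sk : forall k, S k by elim=> [|k IH]; [exact: S0|exact: S_step].
(* Injectivity of [twisted] shifts an equality down to [y 0 = y n.+1], where the center would be the
   image of [y n] under [twisted], so that [P (y n) = 0]. *)
have inj_y k n : y k <> y (k + n.+1)%N.
  elim: k => [|k IH] E.
    have : twisted (y n) = 0 by rewrite add0n in E; exact: esym E.
    by move=> /eqP; rewrite twist_eq0 => /eqP Pn; have := Py n; rewrite Pn eqxx.
  by apply: IH; apply: twisted_inj; [exact: S_good|exact: S_good|exact: E].
have yK k : (D @` K1) (y k).
  exists (chart_inv D (y k)); last by have [Vy _ _] := Sk k; exact: chart_invK.
  case: k => [|k]; first by right; exists 0 => //; rewrite /edisk /= enorm0 ltW.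
  exact: twisted_K1 (S_good (Sk k)) (S_K1 (Sk k)).
have cK : compact (D @` K1).
  apply: continuous_compact => //; apply: continuous_in_subspaceT => p; rewrite inE => Kp.
  exact: chart_continuous_at (K1D Kp).
apply: (@no_accumulation R (ham (f 0)) A c (D @` K1)) => //.
- move=> _ [p Kp <-]; apply: (ham_C1_at aD F_smooth zero01).
  exact: chart_imgP (K1D Kp).
- by move=> k; have [_ _ zy] := Sk k; exact: zy zero01.
- move=> k u uc; have [->|u0] := eqVneq u 0; first by have [] := Sk k.
  by have [] := orbit_reg k uc u0.
- by move=> k u uc u0; have [] := orbit_reg k uc u0.
(* At the center of the ellipse this is the injectivity of the orbit; elsewhere [A k u] is regular
   whereas [y j] is stationary. *)
- move=> j k u kj uc E; have [u0|u0] := eqVneq u 0.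
    have jk : (k + (j - k.+1).+1)%N = j by rewrite addnS -addSn subnKC.
    by rewrite u0 in E; apply: (inj_y k (j - k.+1)%N); rewrite jk; exact: E.
  have [_ fu _ _] := orbit_reg k (ltW uc) u0; have [_ _ zy] := Sk j.
  by move: fu; rewrite E [ham _ _](zy 0 zero01) eqxx.
Qed.

(** At time 0 every point is reached by the flow. At time 1 the points near the stationary [y k] are
    reached by [isotopy_surjective_near]. *)
Let near_related k t : S k -> t = 0 \/ t = 1 ->
  \forall z \near y k, good z /\ related t z.
Proof.
move=> Sk t_end; have ng : \forall z \near y k, good z := chart_good_open psi_C1.1 (S_good Sk).
case: t_end => [->|->]; first by apply: filterS ng => z gz; split=> //; exact: related0.
have [Vy _ zy] := Sk.
have [L [e [L0 e0 Be Le]]] := ham_lipschitz aD F_smooth Vy.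
have [r r0 Hr] := isotopy_surjective_near darbouxD phiF_isotopy L0 e0 Be Le zy.
have nr : \forall z \near y k, ball (y k) r z by exact: nbhsx_ballx.
apply: filterS2 ng nr => z gz /Hr[p pz]; split=> //.
exact: related_image one01 pz gz.
Qed.

Let A_continuous k : S k -> A k u @[u --> (0 : plane R)] --> y k.
Proof. by move=> [_ dA _]; exact: C1_at_continuous dA.1. Qed.

Let near_pull k (Q : plane R -> Prop) : S k -> (\forall z \near y k, Q z) ->
  \forall u \near (0 : plane R), Q (A k u).
Proof. by move=> Sk nQ; exact: (A_continuous Sk nQ). Qed.

Let S_before k : (forall i, (i < k)%N -> P (y i) != 0) -> S k.
Proof.
elim: k => [|k IH] Py; first exact: S0.
by apply: S_step; [apply: IH => i ik; apply: Py; exact: ltnW|exact: Py].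
Qed.

Let orbit_conj k t : t \in `[0, 1] -> t = 0 \/ t = 1 ->
  (forall i, (i < k)%N -> P (y i) != 0) -> \forall u \near (0 : plane R),
    differentiable (A k) u /\ 'd (A k) u (ham (f t) u) = ham (f t) (A k u).
Proof.
move=> t01 t_end; elim: k => [|k IH] Py.
  apply: filterE => u; split; first exact: (loc_diffeo_diff (loc_diffeo_id u)).
  by rewrite diff_val.
have Py' i : (i < k)%N -> P (y i) != 0 by move=> ik; apply: Py; exact: ltnW.
have Sk := S_before Py'; have Pc := C1_at_continuous (P_diffeo (S_good Sk)).1.
have nP : \forall z \near y k, P z != 0 := Pc _ (near_neq0 (Py k (ltnSn k))).
apply: filterS3 (IH Py') (near_pull Sk (near_related Sk t_end)) (near_pull Sk nP).
move=> u [dAu eu] [gu ru] Pu; have dT := loc_diffeo_diff (twisted_diffeo gu Pu).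
split; first exact: (differentiable_comp dAu dT).
exact: (diff_comp_chain dAu dT eu (twisted_conj t01 gu Pu ru)).
Qed.

(** The map [P \o A k] fixes the center and conjugates the model fields for [s = 2] and [s = 2^-1],
    realized at times 0 and 1, to those of the model composed with the inverse twist; these are the
    assumptions of [twist_lipschitz_of_return]. *)
Let return_lipschitz k : (forall i, (i < k)%N -> P (y i) != 0) -> P (y k) = 0 ->
  [lipschitz twist a (cutoff rho) u | u in edisk a].
Proof.
move=> Py Pk; have Sk := S_before Py; have gk := S_good Sk.
have dP := P_diffeo gk; have Pc := C1_at_continuous dP.1.
have [_ dA _] := Sk.
apply: (twist_lipschitz_of_return a_gt0 rhoC1 (A := P \o A k) Pk (loc_diffeo_comp dA dP)).
move=> s s2.
have [t [t01 t_end <-]] : exists t, [/\ t \in `[0, 1], t = 0 \/ t = 1 & sigma t = s].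
  by case: s2 => ->; [exists 0|exists 1]; split=> //; [left|right].
pose E w := ham (h t) w = ham (model_hamiltonian (sigma t) \o tau) w.
have near_E : \forall w \near P (y k), E w.
  by rewrite Pk; apply: filterS (near_join (near_h t01)) => w Ew; exact: ham_near_eq.
have near_EP : \forall z \near y k, E (P z) by exact: (near_preimage Pc near_E).
have N1 : \forall u \near (0 : plane R), [/\ good (A k u), related t (A k u) & E (P (A k u))].
  by apply: filterS2 (near_pull Sk (near_related Sk t_end)) (near_pull Sk near_EP) => u [].
apply: filterS3 (orbit_conj t01 t_end Py) N1 near_core => u [dAu eu] [gu ru hu] uc.
have [_ fu] := core_c (ltW uc); apply: etrans hu; rewrite -(fu t t01).
exact: (diff_comp_chain dAu (loc_diffeo_diff (P_diffeo gu)) eu ru).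
Qed.

Let cutoff_lipschitz : [lipschitz twist a (cutoff rho) u | u in edisk a].
Proof.
have ex : exists k, P (y k) == 0.
  by apply: contrapT => n; apply: orbit_returns => k; apply/negP => Pk; apply: n; exists k.
(* The least return index is taken so that all earlier iterates avoid the center and remain local
   diffeomorphisms at 0. *)
case: (ex_minnP ex) => k /eqP Pk kmin; apply: (return_lipschitz _ Pk) => i ik.
by apply/negP => Pi; have := kmin i Pi; rewrite leqNgt ik.
Qed.

Lemma orbit_lipschitz : [lipschitz twist a rho u | u in edisk a].
Proof.
by apply: lipschitz_eq cutoff_lipschitz => u ua; rewrite twist_cutoff.
Qed.

End Orbit.

Theorem twist_lipschitz_of_conjugate : [lipschitz twist a rho u | u in edisk a].
Proof. by have [c c0 core_c] := core; exact: orbit_lipschitz c0 core_c. Qed.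

End Rigidity.

Theorem lemma11p8 (R : realType) (M : symplectic_surface R)
  (D : chart R M) (darbouxD : darboux_chart D)
  (a : R) (a_gt0 : 0 < a) (diskD : edisk a `<=` chart_img D)
  (sigma : R -> R)
  (sigma_neq0 : forall t : R, t \in `[0, 1] -> sigma t != 0)
  (sigma_near0 : exists2 e : R, 0 < e &
     forall t : R, t \in `[0, 1] -> t < e -> sigma t = 2)
  (sigma_near1 : exists2 e : R, 0 < e &
     forall t : R, t \in `[0, 1] -> 1 - e < t -> sigma t = 2^-1)
  (F : R -> M -> R)
  (F_smooth : smooth_hamiltonian F)
  (F_near0 : \forall u \near (0 : plane R), forall t : R, t \in `[0, 1] ->
     F t (chart_inv D u) = model_hamiltonian (sigma t) u)
  (F_support : exists K : set M, [/\ compact K, K `<=` chart_dom D &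
     forall (t : R) (p : M), t \in `[0, 1] -> ~ K p -> F t p = 0])
  (rho : R -> R)
  (rho_smooth : smooth_on (`]0, 1] : set R^o) (rho : R^o -> R^o))
  (rho_near1 : exists2 e : R, 0 < e &
     forall r : R, r \in `]0, 1] -> 1 - e < r -> rho r = 0)
  (rho_pos : \forall r \near 0^'+, 0 < rho r)
  (rho_deriv : derive1 rho r @[r --> 0^'+] --> -oo)
  (twist_not_lipschitz : ~ [lipschitz twist a rho u | u in edisk a])
  (phi_rho_inv : M -> M)
  (phi_rhoK : cancel (surface_twist D a rho) phi_rho_inv)
  (phi_rhoVK : cancel phi_rho_inv (surface_twist D a rho))
  (H : R -> M -> R)
  (H_def : forall (t : R) (p : M), H t p = F t (phi_rho_inv p))
  (H_smooth : smooth_hamiltonian H)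
  (phiF phiH : R -> M -> M)
  (phiF_isotopy : hamiltonian_isotopy F phiF)
  (phiH_isotopy : hamiltonian_isotopy H phiH) :
  ~ exists psi : M -> M, C1_diffeomorphism psi /\
      forall t : R, t \in `[0, 1] -> psi \o phiF t = phiH t \o psi.
Proof.
move=> [psi [[psi_inv [psiK psi_invK psi_C1 psi_inv_C1]] psi_conj]].
have [K [compactK KD F_out]] := F_support.
have sigma0 : sigma 0 = 2.
  by have [e e0] := sigma_near0; apply=> //; rewrite in_itv/= lexx ler01.
have sigma1 : sigma 1 = 2^-1.
  have [e e0] := sigma_near1; apply; first by rewrite in_itv/= lexx ler01.
  by rewrite gtrBl.
have rhoC1 := cutoff_C1_at rho_smooth rho_near1.
apply: twist_not_lipschitz.
exact: (twist_lipschitz_of_conjugate darbouxD a_gt0 diskD rhoC1 phi_rhoK phi_rhoVK sigma_neq0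
  sigma0 sigma1 F_smooth F_near0 compactK KD F_out H_def phiF_isotopy phiH_isotopy
  psiK psi_invK psi_C1 psi_inv_C1 psi_conj).
Qed.
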